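(* If the family $\{f_t\}_t$ is Newton-admissible, then for all sufficiently small $t$ the Milnor fibration of $f_t$ at $\mathbf{0}\in\mathbb{C}^n$ is isomorphic (as a fibration) to the Milnor fibration of $f_0$ at $\mathbf{0}$.
   Context: Let $(t,\mathbf{z})=(t,z_1,\ldots,z_n)$ be coordinates on $\mathbb{C}\times\mathbb{C}^n$. For $k\in K_0:=\{1,\ldots,k_0\}$ let $f^k\colon\mathbb{C}\times\mathbb{C}^n\to\mathbb{C}$ be a non-constant polynomial with $f^k(t,\mathbf{0})=0$ for all $t$; put $f:=f^1\cdots f^{k_0}$, $f_t(\mathbf{z}):=f(t,\mathbf{z})$, $f^k_t(\mathbf{z}):=f^k(t,\mathbf{z})$. All statements concern germs at the origin. The Milnor fibration of $f_t$ at $\mathbf 0$ is $f_t\colon B_\varepsilon\cap f_t^{-1}(D^*_\delta)\to D^*_\delta$ for $0<\delta\ll\varepsilon\ll1$ ($B_\varepsilon$ closed ball in $\mathbb C^n$, $D^*_\delta$ punctured disc). Newton data: for a polynomial $g(\mathbf{z})=\sum_\alpha c_\alpha\mathbf{z}^\alpha$ with $g(\mathbf{0})=0$, $\Gamma_+(g)$ is the convex hull in $\mathbb{R}^n_+$ of $\bigcup_{c_\alpha\neq0}(\alpha+\mathbb{R}^n_+)$, and the Newton boundary $\Gamma(g)$ is the union of its compact faces. For a weight vector $\mathbf{w}=(w_1,\ldots,w_n)\in\mathbb{N}^n\setminus\{\mathbf{0}\}$ (nonnegative integers), $d(\mathbf{w};g):=\min\{\sum_i w_ix_i : x\in\Gamma_+(g)\}$,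 $\Delta(\mathbf{w};g)$ is the face of $\Gamma_+(g)$ where this minimum is attained, $g_{\mathbf{w}}:=\sum_{\alpha\in\Delta(\mathbf{w};g)}c_\alpha\mathbf{z}^\alpha$ is the face function, and $I(\mathbf{w}):=\{i: w_i=0\}$. $\mathbf w$ is positive if all $w_i>0$. For $I\subseteq\{1,\ldots,n\}$, $\mathbb{C}^I:=\{\mathbf{z}: z_i=0 \text{ for } i\notin I\}$ and $\mathbb{C}^{*I}:=\{\mathbf{z}: z_i=0\iff i\notin I\}$; $\mathbb{C}^{*n}=\mathbb{C}^{*\{1,\ldots,n\}}$. $\mathcal{V}_g$ is the set of $I$ with $g|_{\mathbb{C}^I}\equiv0$. For $i_1,\ldots,i_m$ and $u_{i_j}\in\mathbb{C}^*$, $\mathbb{C}^{*n}(u_{i_1},\ldots,u_{i_m}):=\{\mathbf{z}\in\mathbb{C}^{*n}: z_{i_j}=u_{i_j},\ 1\le j\le m\}$. Non-degenerate complete intersection: polynomials $g^1,\ldots,g^p$ vanishing at $\mathbf 0$ define a non-degenerate complete intersection germ $V(g^1,\ldots,g^p)$ if for every positive weight vector $\mathbf{w}$, the $p$-form $dg^1_{\mathbf{w}}\wedge\cdots\wedge dg^p_{\mathbf{w}}$ is nowhere zero on $V^*(g^1_{\mathbf{w}},\ldots,g^p_{\mathbf{w}}):=\{\mathbf{z}\in\mathbb{C}^{*n}: g^1_{\mathbf{w}}(\mathbf{z})=\cdots=g^p_{\mathbf{w}}(\mathbf{z})=0\}$. Local tameness: $R>0$ is a radius of local tameness of $\{g^1,\ldots,g^p\}$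 if for every nonempty $I=\{i_1,\ldots,i_m\}\in\mathcal{V}_{g^1}\cap\cdots\cap\mathcal{V}_{g^p}$, every $\mathbf{w}\in\mathbb{N}^n\setminus\{\mathbf 0\}$ with $I(\mathbf{w})=I$ and every $u_{i_1},\ldots,u_{i_m}\in\mathbb{C}^*$ with $\sum_j|u_{i_j}|^2<R$, the set $V^*(g^1_{\mathbf{w}},\ldots,g^p_{\mathbf{w}})\cap\mathbb{C}^{*n}(u_{i_1},\ldots,u_{i_m})$ is a reduced non-singular complete intersection in $\mathbb{C}^{*n}(u_{i_1},\ldots,u_{i_m})$, i.e. the differentials of $g^1_{\mathbf{w}},\ldots,g^p_{\mathbf{w}}$ with respect to the variables $(z_i)_{i\notin I}$ are linearly independent at each of its points; the germ is locally tame if such $R$ exists. Newton-admissible: $\{f_t\}_t$ is Newton-admissible if there is $R>0$ such that for all sufficiently small $t$: (i) for each $k\in K_0$, $\Gamma(f^k_t)$ is independent of $t$; (ii) for every nonempty $\{k_1,\ldots,k_p\}\subseteq K_0$, $V(f^{k_1}_t,\ldots,f^{k_p}_t)$ is a non-degenerate, locally tame complete intersection germ having a radius of local tameness greater than $R$ ($R$ independent of $t$ and of the subset). *)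

(* Defs.v *)
From HB Require Import structures.
From mathcomp Require Import all_boot all_order all_algebra.
From mathcomp Require Import complex.
From mathcomp Require Import mpoly.
From mathcomp Require Import all_classical all_reals all_analysis.
Import numFieldNormedType.Exports.
Import Order.TTheory GRing.Theory Num.Theory.

Set Implicit Arguments.
Unset Strict Implicit.
Unset Printing Implicit Defensive.

Local Open Scope classical_set_scope.
Local Open Scope ring_scope.

(* The complex numbers: C = R[i] for a real-closed complete archimedean field R
   (a realType).  Declared at type numClosedFieldType so that the generic
   topology/normed structure of mathcomp-analysis applies. *)
Definition CC (R : realType) : numClosedFieldType := R[i].

Section NewtonMilnor.
Variable R : realType.
Local Notation C := (CC R).
Variable n : nat.
Local Notation zpoly := (mpoly.mpoly n C).
Local Notation vecR := 'rV[R]_n.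
Local Notation vecC := 'rV[C]_n.

Definition normsq (x : C) : R := (complex.Re (x : R[i])) ^+ 2 + (complex.Im (x : R[i])) ^+ 2.
Definition cnorm (x : C) : R := Num.sqrt (normsq x).

Definition peval (g : zpoly) (z : vecC) : C := mpoly.meval (fun i => z ord0 i) g.

Definition spec (t : C) (F : mpoly.mpoly n {poly C}) : zpoly :=
  mpoly.map_mpoly (fun q => q.[t]) F.

Definition expo (m : mpoly.multinom n) : vecR :=
  \row_i ((mpoly.fun_of_multinom m i)%:R).

Definition dotR (a x : vecR) : R := \sum_i a ord0 i * x ord0 i.

Definition orthant : set vecR := [set v | forall i, 0 <= v ord0 i].

Definition conv_hull (S : set vecR) : set vecR :=
  [set x | exists (m : nat) (lam : 'I_m -> R) (y : 'I_m -> vecR),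
      (forall j, 0 <= lam j) /\ \sum_j lam j = 1 /\ (forall j, S (y j)) /\
      x = \sum_j lam j *: y j].

Definition Gamma_plus (g : zpoly) : set vecR :=
  conv_hull [set x | exists2 m : mpoly.multinom n, m \in mpoly.msupp g &
                     exists2 v, orthant v & x = expo m + v].

Definition face_of (P F : set vecR) : Prop :=
  exists a : vecR, F = [set x | P x /\ forall y, P y -> dotR a x <= dotR a y].

Definition newton_boundary (g : zpoly) : set vecR :=
  [set x | exists F, face_of (Gamma_plus g) F /\ compact F /\ F x].

Definition wvec (w : 'I_n -> nat) : vecR := \row_i (w i)%:R.

Definition Delta (w : 'I_n -> nat) (g : zpoly) : set vecR :=
  [set x | Gamma_plus g x /\
           forall y, Gamma_plus g y -> dotR (wvec w) x <= dotR (wvec w) y].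

Definition face_fun (w : 'I_n -> nat) (g : zpoly) : zpoly :=
  \sum_(m <- mpoly.msupp g | `[< Delta w g (expo m) >])
     mpoly.mcoeff m g *: mpoly.mpolyX C m.

Definition positive_weight (w : 'I_n -> nat) : Prop := forall i, (0 < w i)%N.
Definition nonzero_weight (w : 'I_n -> nat) : Prop := exists i, w i <> 0%N.
Definition Iw (w : 'I_n -> nat) : {set 'I_n} := [set i | w i == 0%N].

Definition in_torus (z : vecC) : Prop := forall i, z ord0 i <> 0.

Definition in_V (g : zpoly) (I : {set 'I_n}) : Prop :=
  forall z : vecC, (forall i, i \notin I -> z ord0 i = 0) -> peval g z = 0.

Definition lin_indep (K : finType) (S : {set K}) (J : {set 'I_n})
  (v : K -> 'I_n -> C) : Prop :=
  forall c : K -> C,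
    (forall i, i \in J -> \sum_(k in S) c k * v k i = 0) ->
    forall k, k \in S -> c k = 0.

Definition dpeval (g : zpoly) (i : 'I_n) (z : vecC) : C :=
  peval (mpoly.mderiv i g) z.

Definition nondegenerate_ci (K : finType) (S : {set K}) (g : K -> zpoly) : Prop :=
  forall w : 'I_n -> nat, positive_weight w ->
  forall z : vecC, in_torus z ->
    (forall k, k \in S -> peval (face_fun w (g k)) z = 0) ->
    lin_indep S [set: 'I_n] (fun k i => dpeval (face_fun w (g k)) i z).

Definition radius_local_tameness (K : finType) (S : {set K}) (g : K -> zpoly)
  (Rad : R) : Prop :=
  0 < Rad /\
  forall I : {set 'I_n}, I != finset.set0 ->
  (forall k, k \in S -> in_V (g k) I) ->
  forall w : 'I_n -> nat, nonzero_weight w -> Iw w = I ->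
  forall u : vecC, (forall i, i \in I -> u ord0 i <> 0) ->
    \sum_(i in I) normsq (u ord0 i) < Rad ->
  forall z : vecC, in_torus z -> (forall i, i \in I -> z ord0 i = u ord0 i) ->
    (forall k, k \in S -> peval (face_fun w (g k)) z = 0) ->
    lin_indep S (~: I) (fun k i => dpeval (face_fun w (g k)) i z).

Definition newton_admissible (k0 : nat) (f : 'I_k0 -> mpoly.mpoly n {poly C}) : Prop :=
  exists Rad : R, 0 < Rad /\
  exists tau : R, 0 < tau /\
  forall t : C, cnorm t < tau ->
    (forall k, newton_boundary (spec t (f k)) = newton_boundary (spec 0 (f k))) /\
    (forall S : {set 'I_k0}, S != finset.set0 ->
       nondegenerate_ci S (fun k => spec t (f k)) /\
       exists Rad', Rad < Rad' /\
                    radius_local_tameness S (fun k => spec t (f k)) Rad').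

Definition f_at (k0 : nat) (f : 'I_k0 -> mpoly.mpoly n {poly C}) (t : C)
  (z : vecC) : C := \prod_k peval (spec t (f k)) z.

Definition milnor_total (h : vecC -> C) (eps delta : R) : set vecC :=
  [set z : vecC | \sum_i normsq (z ord0 i) <= eps ^+ 2 /\
           0 < cnorm (h z) /\ cnorm (h z) < delta].

Definition fibration_iso (h1 h2 : vecC -> C) (eps delta : R) : Prop :=
  let E1 := milnor_total h1 eps delta in
  let E2 := milnor_total h2 eps delta in
  exists Phi Psi : vecC -> vecC,
    (forall z, E1 z -> E2 (Phi z)) /\ (forall z, E2 z -> E1 (Psi z)) /\
    (forall z, E1 z -> Psi (Phi z) = z) /\ (forall z, E2 z -> Phi (Psi z) = z) /\
    {within E1, continuous Phi} /\ {within E2, continuous Psi} /\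
    (forall z, E1 z -> h2 (Phi z) = h1 z).

Definition milnor_fibrations_iso (h1 h2 : vecC -> C) : Prop :=
  exists eps0 : R, 0 < eps0 /\
  forall eps : R, 0 < eps -> eps <= eps0 ->
  exists delta0 : R, 0 < delta0 /\
  forall delta : R, 0 < delta -> delta <= delta0 ->
    fibration_iso h1 h2 eps delta.

Definition nonconstant (F : mpoly.mpoly n {poly C}) : Prop :=
  forall c : C, F <> mpoly.mpolyC n (c%:P).

End NewtonMilnor.

(* Main.v *)
Require Import Defs.
From HB Require Import structures.
From mathcomp Require Import all_boot all_order all_algebra.
From mathcomp Require Import complex.
From mathcomp Require Import mpoly.
From mathcomp Require Import all_classical all_reals all_analysis.
From mathcomp Require Import ring lra zify.
Import numFieldNormedType.Exports.
Import Order.TTheory GRing.Theory Num.Theory.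

Set Implicit Arguments.
Unset Strict Implicit.
Unset Printing Implicit Defensive.

Local Open Scope classical_set_scope.
Local Open Scope ring_scope.

(** Fix t and join it to 0 by a segment. As in Ehresmann's theorem, d/ds is lifted to
a vector field tangent to the fibres of f_{st} and to the sphere, and its time-one flow
is the isomorphism. The levels {f_{st} = eta} in the closed ball are compact, so it
suffices that, uniformly in small t, the fibre through any z with |z| <= eps and
0 < |f_t(z)| <= delta is smooth at z, and transverse to the sphere when |z| = eps.

If this fails as delta -> 0, there are points z_v -> z' where d log f_t is proportional
to conj(z). Instead of the curve selection lemma one only needs the relative sizes of
the monomials: along an ultrafilter there are an integer weight w, a torus point a and
scales rho such that z_v^m / rho^m0 tends to a^m if w.m = w.m0 and to 0 if w.m > w.m0.
Constancy of the Newton boundary makes each f^k_t(z_v) asymptotic to its face function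
at a. Let S be the set of k whose face function vanishes at a. If S is empty, the Euler
identity gives sum_i w_i z_i d_i log f -> sum_k d(w; f^k); by the tangency relation the
limit is 0, so all d(w; f^k) vanish and f(z') <> 0, a contradiction. Otherwise the terms k in S dominate; non-degeneracy (z' = 0) or
local tameness (z' <> 0) removes those with d(w; f^k) > 0, and what is left is a tangency
at z' of the sphere with the stratum f^k = 0 of the coordinate torus of z'. A second
application of the same asymptotics, to points tending to the origin, shows that
small spheres have no such tangency. *)

(** * Complex numbers and limits along an ultrafilter *)

Section ComplexModulus.
Variable R : realType.
Local Notation C := (CC R).
Implicit Types x y z : C.

(** Two demands shape the argument. One radius and one bound on |f| must serve the whole segment of
    parameters, so in a sequence of counterexamples the parameter moves too; it stays in the closed
    disc of radius tau/2, so that its limit is still admissible. Moreover some coordinates of z_v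
    may vanish exactly: the set J of the others is frozen, and a coordinate outside J gets a weight
    so large that its monomials never matter.

    The ball being closed, the flow must respect a boundary. Instead of gluing an interior field to
    one near the sphere, a single rational formula is used. Its denominator is |dF|^2 times a Gram
    determinant completed by |dF|^2 (eps^2 - |z|^2)^2, positive by smoothness and transversality.
    This is bounded below only where |F| stays away from 0; but F is constant along trajectories, so
    the denominator is cut off at a level chosen for the fibre, and the cutoff is shown never to
    act. Trajectories are limits of Euler polygons along the same ultrafilter; a discrete Gronwall
    inequality gives constancy of F, invariance of the ball, uniqueness and continuity. The inverse
    map is the flow of the reversed family. *)

Definition r2c (a : R) : C := (a%:C)%C.
Definition cconj (x : C) : C := (x^*)%C.
Definition cre (x : C) : R := complex.Re (x : R[i]).
Definition cim (x : C) : R := complex.Im (x : R[i]).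

Lemma cnormE x : `|x| = r2c (cnorm x).
Proof. exact: (normc_def (x : R[i])). Qed.

Lemma r2cD a b : r2c (a + b) = r2c a + r2c b.
Proof. exact: (rmorphD (real_complex R)). Qed.
Lemma r2cM a b : r2c (a * b) = r2c a * r2c b.
Proof. exact: (rmorphM (real_complex R)). Qed.
Lemma r2cN a : r2c (- a) = - r2c a.
Proof. exact: (rmorphN (real_complex R)). Qed.
Lemma r2c0 : r2c 0 = 0. Proof. by []. Qed.
Lemma r2c1 : r2c 1 = 1. Proof. by []. Qed.
Lemma r2cV a : r2c a^-1 = (r2c a)^-1.
Proof. exact: (fmorphV (real_complex R)). Qed.
Lemma r2cX a k : r2c (a ^+ k) = r2c a ^+ k.
Proof. exact: (rmorphXn (real_complex R)). Qed.
Lemma r2c_nat k : r2c k%:R = k%:R.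
Proof. exact: (rmorph_nat (real_complex R)). Qed.
Lemma r2c_inj : injective r2c. Proof. exact: complexI. Qed.
Lemma ler_r2c a b : (r2c a <= r2c b) = (a <= b).
Proof. exact: lecR. Qed.
Lemma ltr_r2c a b : (r2c a < r2c b) = (a < b).
Proof. exact: ltcR. Qed.
Lemma r2c_sum I (s : seq I) P (F : I -> R) :
  r2c (\sum_(i <- s | P i) F i) = \sum_(i <- s | P i) r2c (F i).
Proof. exact: (rmorph_sum (real_complex R)). Qed.
Lemma r2c_eq0 a : (r2c a == 0) = (a == 0).
Proof. by rewrite -r2c0 (inj_eq r2c_inj). Qed.

Lemma cre_r2c a : cre (r2c a) = a. Proof. by []. Qed.
Lemma creD x y : cre (x + y) = cre x + cre y. Proof. by case: x y => [a b] [c d]. Qed.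
Lemma cimD x y : cim (x + y) = cim x + cim y. Proof. by case: x y => [a b] [c d]. Qed.
Lemma creN x : cre (- x) = - cre x. Proof. by case: x. Qed.
Lemma cimN x : cim (- x) = - cim x. Proof. by case: x. Qed.
Lemma creM x y : cre (x * y) = cre x * cre y - cim x * cim y. Proof. by case: x y => [a b] [c d]. Qed.
Lemma cimM x y : cim (x * y) = cre x * cim y + cim x * cre y. Proof. by case: x y => [a b] [c d]. Qed.
Lemma cre_conj x : cre (cconj x) = cre x. Proof. by case: x. Qed.
Lemma cim_conj x : cim (cconj x) = - cim x. Proof. by case: x. Qed.
Lemma cconjD x y : cconj (x + y) = cconj x + cconj y. Proof. exact: (rmorphD (@conjc R)). Qed.
Lemma cconjM x y : cconj (x * y) = cconj x * cconj y. Proof. exact: (rmorphM (@conjc R)). Qed.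
Lemma cconjN x : cconj (- x) = - cconj x. Proof. exact: (rmorphN (@conjc R)). Qed.
Lemma cconjK x : cconj (cconj x) = x. Proof. exact: conjcK. Qed.
Lemma cconj_r2c a : cconj (r2c a) = r2c a. Proof. exact: conjc_real. Qed.
Lemma cconj_sum I (s : seq I) P (F : I -> C) :
  cconj (\sum_(i <- s | P i) F i) = \sum_(i <- s | P i) cconj (F i).
Proof. exact: (rmorph_sum (@conjc R)). Qed.
Lemma cre_sum I (s : seq I) P (F : I -> C) :
  cre (\sum_(i <- s | P i) F i) = \sum_(i <- s | P i) cre (F i).
Proof. by apply: (big_morph cre creD). Qed.

Lemma c_eq x y : cre x = cre y -> cim x = cim y -> x = y.
Proof. by case: x y => [a b] [c d] /= -> ->. Qed.

Lemma cmul_conj x : x * cconj x = r2c (normsq x).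
Proof. by apply: c_eq; rewrite ?creM ?cimM cre_conj cim_conj /=; rewrite /normsq -/(cre x) -/(cim x); ring. Qed.

Lemma cre_def x : r2c (cre x) = (x + cconj x) / 2%:R.
Proof. exact: ReJ_add. Qed.

Lemma normsq_ge0 x : 0 <= normsq x.
Proof. by rewrite addr_ge0 ?sqr_ge0. Qed.
Lemma cnorm_ge0 x : 0 <= cnorm x. Proof. exact: sqrtr_ge0. Qed.
Lemma cnorm_sqr x : cnorm x ^+ 2 = normsq x.
Proof. by rewrite sqr_sqrtr ?normsq_ge0. Qed.
Lemma cnorm0 : cnorm (0 : C) = 0.
Proof. by apply: r2c_inj; rewrite -cnormE normr0. Qed.
Lemma cnorm1 : cnorm (1 : C) = 1.
Proof. by apply: r2c_inj; rewrite -cnormE normr1. Qed.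
Lemma cnorm_eq0 x : (cnorm x == 0) = (x == 0).
Proof. by rewrite -r2c_eq0 -cnormE normr_eq0. Qed.
Lemma cnorm_gt0 x : (0 < cnorm x) = (x != 0).
Proof. by rewrite lt_neqAle cnorm_ge0 andbT eq_sym cnorm_eq0. Qed.
Lemma normsq_eq0 x : (normsq x == 0) = (x == 0).
Proof. by rewrite -cnorm_sqr expf_eq0 /= cnorm_eq0. Qed.
Lemma cnormM x y : cnorm (x * y) = cnorm x * cnorm y.
Proof. by apply: r2c_inj; rewrite r2cM -!cnormE normrM. Qed.
Lemma cnormV x : cnorm x^-1 = (cnorm x)^-1.
Proof. by apply: r2c_inj; rewrite r2cV -!cnormE normfV. Qed.
Lemma cnormN x : cnorm (- x) = cnorm x.
Proof. by apply: r2c_inj; rewrite -!cnormE normrN. Qed.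
Lemma cnorm_distC x y : cnorm (x - y) = cnorm (y - x).
Proof. by rewrite -cnormN opprB. Qed.
Lemma cnormD x y : cnorm (x + y) <= cnorm x + cnorm y.
Proof. by rewrite -ler_r2c r2cD -!cnormE ler_normD. Qed.
Lemma cnorm_sum I (s : seq I) P (F : I -> C) :
  cnorm (\sum_(i <- s | P i) F i) <= \sum_(i <- s | P i) cnorm (F i).
Proof.
elim/big_rec2: _ => [|i a b _ h]; first by rewrite cnorm0.
by apply: le_trans (cnormD _ _) _; rewrite lerD2l.
Qed.
Lemma cnorm_conj x : cnorm (cconj x) = cnorm x.
Proof. by rewrite /cnorm /normsq -/(cre _) -/(cim _) cre_conj cim_conj sqrrN. Qed.
Lemma cnorm_r2c a : cnorm (r2c a) = `|a|.
Proof. by rewrite /cnorm /normsq /= expr0n /= addr0 sqrtr_sqr. Qed.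
Lemma cre_le x : `|cre x| <= cnorm x.
Proof. by rewrite -sqrtr_sqr ler_wsqrtr // lerDl sqr_ge0. Qed.
Lemma cim_le x : `|cim x| <= cnorm x.
Proof. by rewrite -sqrtr_sqr ler_wsqrtr // lerDr sqr_ge0. Qed.
Lemma normsqM x y : normsq (x * y) = normsq x * normsq y.
Proof. by rewrite -!cnorm_sqr cnormM exprMn. Qed.
Lemma normsq_r2c a : normsq (r2c a) = a ^+ 2.
Proof. by rewrite -cnorm_sqr cnorm_r2c real_normK ?num_real. Qed.

End ComplexModulus.

(* A nonprincipal ultrafilter on nat makes every bounded sequence convergent,
   so no subsequence ever has to be extracted. *)
Definition free_ultra (U : set_system nat) : Prop :=
  [/\ UltraFilter U, forall A, U A -> exists k, A k & forall k, U [set v | (k <= v)%N]].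

Lemma free_ultra_exists : exists U, free_ultra U.
Proof.
have [U [UU sU]] := ultraFilterLemma (F := \oo%classic) _.
exists U; split => //.
  by move=> A; exact: filter_ex.
by move=> k; apply: sU; exists k.
Qed.

Section UltraLimits.
Variables (R : realType) (U : set_system nat).
Hypothesis hU : free_ultra U.
Local Notation C := (CC R).

Lemma uW (A B : set nat) : U A -> (forall v, A v -> B v) -> U B.
Proof. by case: hU => uu _ _ uA sAB; apply: filterS uA. Qed.
Lemma uI (A B : set nat) : U A -> U B -> U [set v | A v /\ B v].
Proof. by case: hU => uu _ _; exact: filterI. Qed.
Lemma uT (A : set nat) : (forall v, A v) -> U A.
Proof. by case: hU => uu _ _ h; apply: filterS filterT => v _. Qed.
Lemma u_ex (A : set nat) : U A -> exists v, A v.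
Proof. by case: hU => _ h _; exact: h. Qed.
Lemma u_ge k : U [set v | (k <= v)%N].
Proof. by case: hU. Qed.
Lemma u_or (A : set nat) : U A \/ U [set v | ~ A v].
Proof. by case: hU => uu _ _; exact: in_ultra_setVsetC. Qed.
Lemma u_not (A : set nat) : ~ U A -> U [set v | ~ A v].
Proof. by case: (u_or A). Qed.
Lemma u_all (I : finType) (A : I -> set nat) :
  (forall i, U (A i)) -> U [set v | forall i, A i v].
Proof.
move=> h; have : U [set v | forall i, i \in enum I -> A i v].
  elim: (enum I) => [|i s IH]; first exact: uT.
  by refine (uW (uI (h i) IH) _) => v [ai as_] j; rewrite inE => /orP[/eqP->//|]; exact: as_.
by move=> k; refine (uW k _) => v av i; apply: av; rewrite mem_enum.
Qed.
Lemma u_seq (I : eqType) (s : seq I) (A : I -> set nat) :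
  (forall i, i \in s -> U (A i)) -> U [set v | forall i, i \in s -> A i v].
Proof.
elim: s => [|i s IH] h; first exact: uT.
have h' j : j \in s -> U (A j) by move=> js; apply: h; rewrite inE js orbT.
refine (uW (uI (h i (mem_head _ _)) (IH h')) _) => v [ai as_] j.
by rewrite inE => /orP[/eqP->//|]; exact: as_.
Qed.
(** An ultrafilter cannot avoid every cell of a finite partition. This freezes the discrete data of
    a sequence, such as the set of nonzero coordinates or a set of factors. *)
Lemma u_const (I : finType) (phi : nat -> I) : exists i, U [set v | phi v = i].
Proof.
apply: contrapT => /forallNP h.
have /u_ex[v] := u_all (fun i => u_not (h i)).
by move=> /(_ (phi v)); apply.
Qed.

(** Stated with the real-valued [cnorm], so that tolerances are real numbers and limits of real
    sequences can be treated through [r2c]. *)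
Definition tends (phi : nat -> C) (l : C) : Prop :=
  forall e : R, 0 < e -> U [set v | cnorm (phi v - l) < e].

Lemma tends_ext phi psi l : U [set v | phi v = psi v] -> tends phi l -> tends psi l.
Proof. by move=> h t e e0; refine (uW (uI h (t e e0)) _) => v [/= <-]. Qed.
Lemma tends_cst l : tends (fun=> l) l.
Proof. by move=> e e0; apply: uT => v; rewrite /= subrr cnorm0. Qed.
Lemma tendsD phi psi l m : tends phi l -> tends psi m ->
  tends (fun v => phi v + psi v) (l + m).
Proof.
move=> t t' e e0; have e2 : 0 < e / 2 by rewrite divr_gt0.
refine (uW (uI (t _ e2) (t' _ e2)) _) => v [/= a b].
rewrite opprD addrACA; apply: le_lt_trans (cnormD _ _) _; lra.
Qed.
Lemma tendsN phi l : tends phi l -> tends (fun v => - phi v) (- l).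
Proof. by move=> t e e0; refine (uW (t e e0) _) => v /=; rewrite -cnormN opprB opprK addrC. Qed.
Lemma tendsB phi psi l m : tends phi l -> tends psi m ->
  tends (fun v => phi v - psi v) (l - m).
Proof. by move=> t t'; apply: tendsD t (tendsN t'). Qed.
Lemma tends_bounded phi l : tends phi l -> U [set v | cnorm (phi v) < cnorm l + 1].
Proof.
move=> t; refine (uW (t 1 ltr01) _) => v /= h.
have := cnormD (phi v - l) l; rewrite subrK; lra.
Qed.
Lemma tends0M phi psi (b : R) : tends phi 0 -> U [set v | cnorm (psi v) <= b] ->
  tends (fun v => phi v * psi v) 0.
Proof.
move=> t h e e0; have b1 : 0 < `|b| + 1 by rewrite ltr_wpDl.
refine (uW (uI (t (e / (`|b| + 1)) (divr_gt0 e0 b1)) h) _) => v [/=].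
rewrite !subr0 cnormM ltr_pdivlMr // => a c.
apply: le_lt_trans a; apply: ler_wpM2l; rewrite ?cnorm_ge0 //.
by apply: (le_trans c); apply: (le_trans (ler_norm _)); rewrite lerDl.
Qed.
Lemma tendsM phi psi l m : tends phi l -> tends psi m ->
  tends (fun v => phi v * psi v) (l * m).
Proof.
move=> t t'.
have a : tends (fun v => (phi v - l) * psi v) 0.
  apply: (@tends0M _ _ (cnorm m + 1)); first by rewrite -(subrr l); apply: tendsB t (tends_cst _).
  by refine (uW (tends_bounded t') _) => v /ltW.
have b : tends (fun v => (psi v - m) * l) 0.
  apply: (@tends0M _ _ (cnorm l)); first by rewrite -(subrr m); apply: tendsB t' (tends_cst _).
  by apply: uT => v /=; exact: lexx.
have := tendsD (tendsD a b) (tends_cst (l * m)); rewrite !add0r.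
by apply: tends_ext; apply: uT => v /=; ring.
Qed.
Lemma tendsX phi l k : tends phi l -> tends (fun v => phi v ^+ k) (l ^+ k).
Proof.
move=> t; elim: k => [|k IH]; first exact: tends_cst.
rewrite exprS; apply: tends_ext (tendsM t IH).
by apply: uT => v /=; rewrite exprS.
Qed.
Lemma tends_sum I (s : seq I) (P : pred I) (F : I -> nat -> C) (l : I -> C) :
  (forall i, P i -> tends (F i) (l i)) ->
  tends (fun v => \sum_(i <- s | P i) F i v) (\sum_(i <- s | P i) l i).
Proof.
move=> h; elim: s => [|i s IH].
  rewrite big_nil; apply: tends_ext (tends_cst _).
  by apply: uT => v /=; rewrite big_nil.
rewrite big_cons; case: ifP => pi; last first.
  by apply: tends_ext IH; apply: uT => v /=; rewrite big_cons pi.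
apply: tends_ext (tendsD (h i pi) IH).
by apply: uT => v /=; rewrite big_cons pi.
Qed.
Lemma tends_prod I (s : seq I) (P : pred I) (F : I -> nat -> C) (l : I -> C) :
  (forall i, P i -> tends (F i) (l i)) ->
  tends (fun v => \prod_(i <- s | P i) F i v) (\prod_(i <- s | P i) l i).
Proof.
move=> h; elim: s => [|i s IH].
  rewrite big_nil; apply: tends_ext (tends_cst _).
  by apply: uT => v /=; rewrite big_nil.
rewrite big_cons; case: ifP => pi; last first.
  by apply: tends_ext IH; apply: uT => v /=; rewrite big_cons pi.
apply: tends_ext (tendsM (h i pi) IH).
by apply: uT => v /=; rewrite big_cons pi.
Qed.
Lemma tends_uniq phi l m : tends phi l -> tends phi m -> l = m.
Proof.
move=> t t'; apply/eqP; rewrite -subr_eq0 -cnorm_eq0.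
apply: contrapT => /negP; rewrite cnorm_eq0 -cnorm_gt0 => p.
have e2 : 0 < cnorm (l - m) / 2 by rewrite divr_gt0.
have /u_ex[v [/= a b]] := uI (t _ e2) (t' _ e2).
have := cnormD (l - phi v) (phi v - m).
rewrite (cnorm_distC l) addrA subrK; lra.
Qed.
Lemma tends_neq0 phi l : tends phi l -> l != 0 -> U [set v | cnorm l / 2 < cnorm (phi v)].
Proof.
move=> t; rewrite -cnorm_gt0 => p.
have e2 : 0 < cnorm l / 2 by rewrite divr_gt0.
refine (uW (t _ e2) _) => v /= h.
have := cnormD (l - phi v) (phi v); rewrite subrK cnorm_distC; lra.
Qed.
Lemma tendsV phi l : l != 0 -> tends phi l -> tends (fun v => (phi v)^-1) l^-1.
Proof.
move=> l0 t.
have a : tends (fun v => (phi v - l) * (- (phi v)^-1 * l^-1)) 0.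
  apply: (@tends0M _ _ ((cnorm l / 2)^-1 * (cnorm l)^-1)).
    by rewrite -(subrr l); apply: tendsB t (tends_cst _).
  refine (uW (tends_neq0 t l0) _) => v /= h.
  have p : 0 < cnorm l by rewrite cnorm_gt0.
  rewrite cnormM cnormN !cnormV ler_pM2r ?invr_gt0 //.
  rewrite lef_pV2 ?posrE ?(ltW h) //; lra.
have := tendsD a (tends_cst l^-1); rewrite add0r.
apply: tends_ext; refine (uW (tends_neq0 t l0) _) => v /= h.
have : phi v != 0 by rewrite -cnorm_gt0; apply: le_lt_trans h; rewrite divr_ge0 ?cnorm_ge0.
move=> p; field; by rewrite p l0.
Qed.
Lemma tends_conj phi l : tends phi l -> tends (fun v => cconj (phi v)) (cconj l).
Proof. by move=> t e e0; refine (uW (t e e0) _) => v /=; rewrite -cconjN -cconjD cnorm_conj. Qed.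
Lemma tends_cnorm phi l : tends phi l -> tends (fun v => r2c (cnorm (phi v))) (r2c (cnorm l)).
Proof.
move=> t e e0; refine (uW (t e e0) _) => v /= h; apply: le_lt_trans h.
rewrite -r2cN -r2cD cnorm_r2c ler_norml lerBlDl.
have := cnormD (phi v - l) l; have := cnormD (l - phi v) (phi v).
by rewrite !subrK (cnorm_distC l) => *; apply/andP; split; lra.
Qed.
Lemma tends_normsq phi l : tends phi l -> tends (fun v => r2c (normsq (phi v))) (r2c (normsq l)).
Proof.
move=> t; rewrite -cmul_conj; apply: tends_ext (tendsM t (tends_conj t)).
by apply: uT => v /=; rewrite cmul_conj.
Qed.
Lemma tends_le (phi : nat -> R) a b : tends (fun v => r2c (phi v)) (r2c a) ->
  U [set v | phi v <= b] -> a <= b.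
Proof.
move=> t h; rewrite leNgt; apply/negP => ba.
have p : 0 < a - b by rewrite subr_gt0.
have /u_ex[v [/= c d]] := uI (t _ p) h.
move: c; rewrite -r2cN -r2cD cnorm_r2c ltr_norml; lra.
Qed.
Lemma tends_ge (phi : nat -> R) a b : tends (fun v => r2c (phi v)) (r2c a) ->
  U [set v | b <= phi v] -> b <= a.
Proof.
move=> t h; rewrite -lerN2; apply: (@tends_le (fun v => - phi v)).
  by rewrite r2cN; apply: tends_ext (tendsN t); apply: uT => v /=; rewrite r2cN.
by refine (uW h _) => v /=; rewrite lerN2.
Qed.
Lemma tends_cnorm_le phi l b : tends phi l -> U [set v | cnorm (phi v) <= b] -> cnorm l <= b.
Proof. by move=> t; apply: tends_le (tends_cnorm t). Qed.
Lemma tends_squeeze (phi : nat -> C) (eps : nat -> R) :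
  tends (fun v => r2c (eps v)) 0 -> U [set v | cnorm (phi v) <= eps v] -> tends phi 0.
Proof.
move=> t h e e0; refine (uW (uI (t e e0) h) _) => v [/=].
rewrite !subr0 cnorm_r2c => a b; apply: le_lt_trans a; apply: le_trans b (ler_norm _).
Qed.
Lemma tends_inv_nat : tends (fun v => r2c v.+1%:R^-1) 0.
Proof.
move=> e e0; refine (uW (u_ge (Num.truncn e^-1)) _) => v /= h.
rewrite subr0 cnorm_r2c ger0_norm ?invr_ge0 ?ler0n //.
rewrite invf_plt ?posrE ?ltr0n //.
apply: lt_le_trans (truncnS_gt _) _; by rewrite ler_nat ltnS.
Qed.

(** The limit is the supremum of the reals lying below [phi] on a set of [U]: a slightly larger
    number is not below it on such a set, hence is above it on one, since [U] is ultra. *)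
Lemma real_limit (phi : nat -> R) b : U [set v | `|phi v| <= b] ->
  exists l, tends (fun v => r2c (phi v)) (r2c l).
Proof.
move=> h; pose A := [set x : R | U [set v | x <= phi v]].
have supA : has_sup A.
  split; first by exists (- b); refine (uW h _) => v /=; rewrite ler_norml => /andP[].
  exists b => x xA; have /u_ex[v [/= c d]] := uI h xA.
  by apply: le_trans d _; apply: le_trans (ler_norm _) c.
exists (sup A) => e e0.
have e2 : 0 < e / 2 by rewrite divr_gt0.
have [x xA lx] := sup_adherent e2 supA.
have nA : ~ A (sup A + e / 2).
  by move=> /(sup_upper_bound supA); rewrite gerDl leNgt e2.
refine (uW (uI xA (u_not nA)) _) => v [/= c /negP]; rewrite -ltNge => d.
by rewrite -r2cN -r2cD cnorm_r2c ltr_norml; apply/andP; split; lra.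
Qed.

Lemma bounded_limit (phi : nat -> C) b : U [set v | cnorm (phi v) <= b] ->
  exists l, tends phi l.
Proof.
move=> h.
have [] := @real_limit (fun v => cre (phi v)) b.
  by refine (uW h _) => v /=; apply: le_trans; exact: cre_le.
move=> p tp; have [] := @real_limit (fun v => cim (phi v)) b.
  by refine (uW h _) => v /=; apply: le_trans; exact: cim_le.
move=> q tq; exists (r2c p + (Complex 0 1 : C) * r2c q).
apply: tends_ext (tendsD tp (tendsM (tends_cst _) tq)).
by apply: uT => v /=; rewrite [RHS](complexE (phi v : R[i])).
Qed.

Lemma bounded_limit_vec (I : Type) (phi : nat -> I -> C) b :
  U [set v | forall i, cnorm (phi v i) <= b] ->
  exists l : I -> C, forall i, tends (fun v => phi v i) (l i).
Proof.
move=> h; have : forall i, exists l, tends (fun v => phi v i) l; last by move=> /choice[l hl]; exists l.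
move=> i; by apply: (@bounded_limit _ b); refine (uW h _) => v /=; apply.
Qed.

End UltraLimits.
(** * Newton boundaries and face functions *)

Section NewtonWeights.
Variables (R : realType) (n : nat).
Local Notation C := (CC R).
Local Notation zpoly := (mpoly.mpoly n C).
Implicit Types (w : 'I_n -> nat) (g : zpoly) (m : mpoly.multinom n) (z : 'rV[C]_n).

Definition expn_of m (i : 'I_n) : nat := mpoly.fun_of_multinom m i.
Definition wt w m : nat := (\sum_i w i * expn_of m i)%N.
Definition mon z m : C := \prod_i z ord0 i ^+ expn_of m i.

Lemma dotRDr (a x y : 'rV[R]_n) : dotR a (x + y) = dotR a x + dotR a y.
Proof. by rewrite -big_split; apply: eq_bigr => i _; rewrite mxE mulrDr. Qed.

Lemma dotR_sumZ (a : 'rV[R]_n) k (lam : 'I_k -> R) (y : 'I_k -> 'rV[R]_n) :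
  dotR a (\sum_j lam j *: y j) = \sum_j lam j * dotR a (y j).
Proof.
rewrite /dotR; under eq_bigr => i _ do rewrite summxE mulr_sumr.
rewrite exchange_big; apply: eq_bigr => j _; rewrite mulr_sumr.
by apply: eq_bigr => i _; rewrite mxE mulrCA.
Qed.

Lemma dot_wvec w m : dotR (wvec R w) (expo R m) = (wt w m)%:R.
Proof. by rewrite /dotR /wt natr_sum; apply: eq_bigr => i _; rewrite !mxE natrM. Qed.

Lemma dot_ge0 (a v : 'rV[R]_n) : (forall i, 0 <= a ord0 i) -> orthant v -> 0 <= dotR a v.
Proof. by move=> h hv; apply: sumr_ge0 => i _; rewrite mulr_ge0. Qed.

Lemma Gamma_plus_ge w g (d : nat) x :
  (forall m, m \in mpoly.msupp g -> (d <= wt w m)%N) ->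
  Gamma_plus g x -> d%:R <= dotR (wvec R w) x.
Proof.
move=> h [k [lam [y [l0 [l1 [Sy ->]]]]]]; rewrite dotR_sumZ.
rewrite -[leLHS]mul1r -{1}l1 mulr_suml; apply: ler_sum => j _.
apply: ler_wpM2l => //; have [m ms [v vo ->]] := Sy j.
rewrite dotRDr dot_wvec.
rewrite -[d%:R]addr0; apply: lerD; first by rewrite ler_nat h.
by apply: dot_ge0 => // i; rewrite mxE.
Qed.

Lemma expo_in_Gamma_plus g m : m \in mpoly.msupp g -> Gamma_plus g (expo R m).
Proof.
move=> ms; exists 1%N, (fun=> 1), (fun=> expo R m); split => //; split.
  by rewrite big_ord1.
split; last by rewrite big_ord1 scale1r.
move=> _; exists m => //; exists 0; last by rewrite addr0.
by move=> i; rewrite mxE.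
Qed.

(** On the convex hull a form with nonnegative coefficients is minimised at an exponent, so lying on
    the face becomes a comparison of finitely many integers. *)
Lemma Delta_expo w g m : m \in mpoly.msupp g ->
  Delta w g (expo R m) <-> (forall m', m' \in mpoly.msupp g -> (wt w m <= wt w m')%N).
Proof.
move=> ms; split=> [[_ h] m' ms'|h].
  by have := h _ (expo_in_Gamma_plus ms'); rewrite !dot_wvec ler_nat.
split; first exact: expo_in_Gamma_plus.
by move=> y yG; rewrite dot_wvec; apply: Gamma_plus_ge yG.
Qed.

Lemma exists_argmin (T : eqType) (s : seq T) (F : T -> R) x : x \in s ->
  exists2 y, y \in s & forall x', x' \in s -> F y <= F x'.
Proof.
elim: s x => // a s IH x _; case: s IH => [|b s] IH.
  by exists a; rewrite ?mem_head // => y; rewrite inE => /eqP->.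
have [y ys hy] := IH b (mem_head _ _).
have [h|h] := leP (F y) (F a).
  by exists y; rewrite 1?in_cons ?ys ?orbT // => x'; rewrite in_cons => /orP[/eqP->|/hy].
exists a; rewrite ?mem_head // => x'; rewrite inE => /orP[/eqP->//|/hy]; lra.
Qed.

(* A point of the support minimising the concave function N^2 w.m + N |m| - |m|^2
   is a vertex, exposed by the gradient of that function. *)
Lemma vertex_in_boundary w g m : m \in mpoly.msupp g ->
  exists m0, [/\ m0 \in mpoly.msupp g, newton_boundary g (expo R m0) & (wt w m0 <= wt w m)%N].
Proof.
move=> ms.
have [D hD] : exists D : nat, forall m', m' \in mpoly.msupp g ->
    (\sum_i expn_of m' i <= D)%N /\ (\sum_i expn_of m' i ^ 2 <= D)%N.
  exists (\sum_(m' <- mpoly.msupp g) (\sum_i expn_of m' i + \sum_i expn_of m' i ^ 2))%N.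
  move=> m' ms'; rewrite (big_rem m' ms') /=; lia.
(* [D] bounds degrees and square norms on the support. As N > 2D, the gradient N^2 w + N - 2 m0 has
   positive entries; as N^2 > N D + D, a minimiser of [F] cannot weigh more than m. *)
pose N := (2 * D + 2)%N.
pose sq m' : R := \sum_i (expn_of m' i)%:R ^+ 2.
pose dg m' : R := \sum_i (expn_of m' i)%:R.
pose F m' : R := (N ^ 2 * wt w m')%:R + N%:R * dg m' - sq m'.
have [m0 m0s hm0] := exists_argmin F ms.
have sqE m' : sq m' = (\sum_i expn_of m' i ^ 2)%:R.
  by rewrite natr_sum; apply: eq_bigr => i _; rewrite natrX.
have dgE m' : dg m' = (\sum_i expn_of m' i)%:R by rewrite natr_sum.
pose a : 'rV[R]_n := \row_i (N ^ 2 * w i + N)%:R - 2 *: expo R m0.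
have aE m' : dotR a (expo R m') = (N ^ 2 * wt w m')%:R + N%:R * dg m'
     - 2 * \sum_i (expn_of m0 i)%:R * (expn_of m' i)%:R.
  rewrite /dotR /wt natrM natr_sum !mulr_sumr -big_split -sumrB.
  by apply: eq_bigr => i _ /=; rewrite !mxE -!/(expn_of _ _) natrD !natrM; ring.
have dist m' : sq m' - 2 * (\sum_i (expn_of m0 i)%:R * (expn_of m' i)%:R) + sq m0
     = \sum_i ((expn_of m' i)%:R - (expn_of m0 i)%:R) ^+ 2 :> R.
  rewrite mulr_sumr -sumrB -big_split; apply: eq_bigr => i _ /=; ring.
have am0 : dotR a (expo R m0) = F m0 - sq m0.
  rewrite aE /F; have -> : \sum_i (expn_of m0 i)%:R * (expn_of m0 i)%:R = sq m0.
    by apply: eq_bigr => i _; rewrite expr2.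
  ring.
(* Completing the square, F m' - F m0 equals [a] applied to m' - m0, minus |m' - m0|^2. Minimality
   of m0 therefore leaves a quadratic gap, and [a] exposes m0 alone. *)
have gap m' : m' \in mpoly.msupp g ->
    \sum_i ((expn_of m' i)%:R - (expn_of m0 i)%:R) ^+ 2 <= dotR a (expo R m') - dotR a (expo R m0).
  move=> ms'; rewrite -dist am0 aE; have := hm0 _ ms'; rewrite /F; lra.
have apos i : 0 < a ord0 i.
  rewrite !mxE; have [h _] := hD _ m0s.
  have : (expn_of m0 i <= D)%N.
    by apply: leq_trans h; rewrite (bigD1 i) //= leq_addr.
  rewrite -/(expn_of m0 i) => h'; rewrite subr_gt0 -natrM ltr_nat /N; nia.
have uniq y : (exists2 m', m' \in mpoly.msupp g & exists2 v, orthant v & y = expo R m' + v) ->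
    dotR a (expo R m0) <= dotR a y /\ (dotR a y = dotR a (expo R m0) -> y = expo R m0).
  move=> [m' ms' [v vo ->]]; rewrite dotRDr.
  have v0 : 0 <= dotR a v by apply: dot_ge0 => // i; exact: ltW.
  have s0 : 0 <= \sum_i ((expn_of m' i)%:R - (expn_of m0 i)%:R) ^+ 2 :> R.
    by apply: sumr_ge0 => i _; exact: sqr_ge0.
  have gm := gap _ ms'; split; first lra.
  move=> e; have av : dotR a v = 0 by lra.
  have se : \sum_i ((expn_of m' i)%:R - (expn_of m0 i)%:R) ^+ 2 = 0 :> R by lra.
  apply/rowP => i; rewrite !mxE.
  have vi : v ord0 i = 0.
    have /allP/(_ i) := etrans (esym (psumr_eq0 _ (fun i _ => mulr_ge0 (ltW (apos i)) (vo i)))) (introT eqP av).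
    by rewrite mem_index_enum mulf_eq0 (gt_eqF (apos i)) => /(_ isT)/eqP.
  have /allP/(_ i) := etrans (esym (psumr_eq0 _ (fun i _ => sqr_ge0 ((expn_of m' i)%:R - (expn_of m0 i)%:R : R)))) (introT eqP se).
  rewrite mem_index_enum sqrf_eq0 subr_eq0 => /(_ isT)/eqP e'.
  by rewrite vi addr0.
exists m0; split => //.
  exists [set expo R m0]; split; last by split; [exact: compact_set1|].
  have lower y : Gamma_plus g y -> dotR a (expo R m0) <= dotR a y.
    move=> [k [lam [y' [l0 [l1 [Sy ->]]]]]]; rewrite dotR_sumZ.
    rewrite -[leLHS]mul1r -l1 mulr_suml; apply: ler_sum => j _.
    by apply: ler_wpM2l => //; case: (uniq _ (Sy j)).
  exists a; apply/seteqP; split=> [x ->|x [xG hx]] /=.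
    by split; [exact: expo_in_Gamma_plus|].
  have e : dotR a x = dotR a (expo R m0).
    by apply/eqP; rewrite eq_le lower // hx //; exact: expo_in_Gamma_plus.
  case: xG e => k [lam [y' [l0 [l1 [Sy ->]]]]]; rewrite dotR_sumZ => e.
  have e0 : \sum_j lam j * (dotR a (y' j) - dotR a (expo R m0)) = 0.
    under eq_bigr do rewrite mulrBr; rewrite sumrB e -mulr_suml l1; ring.
  have ge j : 0 <= lam j * (dotR a (y' j) - dotR a (expo R m0)).
    by rewrite mulr_ge0 // subr_ge0; case: (uniq _ (Sy j)).
  rewrite -[RHS]scale1r -l1 scaler_suml; apply: eq_bigr => j _.
  have /allP/(_ j) := etrans (esym (psumr_eq0 _ (fun j _ => ge j))) (introT eqP e0).
  rewrite mem_index_enum mulf_eq0 => /(_ isT)/orP[/eqP->|]; first by rewrite !scale0r.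
  by rewrite subr_eq0 => /eqP h; case: (uniq _ (Sy j)) => _ /(_ h) ->.
have := hm0 _ ms; rewrite /F !sqE !dgE -!natrM -!natrD => h.
have [d1 d2] := hD _ ms; have [d3 d4] := hD _ m0s.
move: h; set A := (\sum_i _)%N; set B := (\sum_i _)%N; set A' := (\sum_i _)%N; set B' := (\sum_i _)%N => h.
have {}h : (N ^ 2 * wt w m0 + N * A + B' <= N ^ 2 * wt w m + N * A' + B)%N.
  by rewrite -(ler_nat R) !natrD in h *; lra.
rewrite leqNgt; apply/negP => lt.
have : (N ^ 2 * (wt w m).+1 <= N ^ 2 * wt w m0)%N by rewrite leq_mul2l lt orbT.
rewrite -/A -/B -/A' -/B' in d1 d2 d3 d4.
rewrite mulnS; move: h; rewrite /N; nia.
Qed.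

(** The weight is carried from g to g' by a vertex: it lies on the common boundary, hence in
    [Gamma_plus g'], which is impossible if all exponents of g' are heavier. By symmetry both
    polynomials have the same least weight. *)
Lemma boundary_min_weight w g g' m : newton_boundary g = newton_boundary g' ->
  m \in mpoly.msupp g -> exists2 m', m' \in mpoly.msupp g' & (wt w m' <= wt w m)%N.
Proof.
move=> e ms; have [m0 [_ m0b m0w]] := vertex_in_boundary w ms.
apply: contrapT => h.
have [F [[a Fa] [_ Fx]]] : newton_boundary g' (expo R m0) by rewrite -e.
have : Gamma_plus g' (expo R m0) by move: Fx; rewrite Fa => -[].
have hh m' : m' \in mpoly.msupp g' -> (wt w m < wt w m')%N.
  by move=> ms'; rewrite ltnNge; apply/negP => le; apply: h; exists m'.
move/(Gamma_plus_ge hh); rewrite dot_wvec ler_nat => /leq_trans/(_ m0w).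
by rewrite ltnn.
Qed.

Lemma mcoeff_face_fun w g d m :
  (forall m', m' \in mpoly.msupp g -> (d <= wt w m')%N) ->
  (exists2 m0, m0 \in mpoly.msupp g & wt w m0 = d) ->
  mpoly.mcoeff m (face_fun w g) = if wt w m == d then mpoly.mcoeff m g else 0.
Proof.
move=> dmin [m0 m0s m0d]; rewrite /face_fun.
have P m' : m' \in mpoly.msupp g -> `[< Delta w g (expo R m') >] = (wt w m' == d).
  move=> ms'; apply/asboolP/eqP; rewrite (Delta_expo w ms').
    by move=> /(_ _ m0s); rewrite m0d => h; apply/eqP; rewrite eqn_leq h dmin.
  by move=> -> .
rewrite big_seq_cond raddf_sum /=.
under eq_bigr => m' _ do rewrite mpoly.mcoeffZ mpoly.mcoeffX.
have [ms|ms] := boolP (m \in mpoly.msupp g); last first.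
  rewrite big1; first by move: ms; rewrite -mpoly.mcoeff_eq0 => /eqP->; rewrite if_same.
  move=> m' /andP[ms' _]; case: eqP => [e|]; last by rewrite mulr0.
  by rewrite -e ms' in ms.
rewrite (bigID (pred1 m)) /= [X in _ + X]big1 ?addr0; last first.
  by move=> m' /andP[_ /negPf->]; rewrite mulr0.
under eq_bigl => m'.
  rewrite (_ : _ && _ = (m' == m) && (wt w m == d)); last first.
    by case: eqP => [->|_]; rewrite ?andbF // andbT ms P.
  over.
case: ifP => h; last by rewrite big1 // => m'; rewrite andbF.
under eq_bigl do rewrite andbT.
by rewrite -big_filter (filter_pred1_uniq (mpoly.msupp_uniq g) ms) big_seq1 eqxx mulr1.
Qed.

(** The support may change with the parameter. Summing over a fixed list containing all supports
    makes two members of the family comparable term by term. *)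
Lemma pevalE g z (Ms : seq (mpoly.multinom n)) : uniq Ms -> {subset mpoly.msupp g <= Ms} ->
  peval g z = \sum_(m <- Ms) mpoly.mcoeff m g * mon z m.
Proof.
move=> un sub; rewrite /peval mpoly.mevalE.
rewrite [RHS](bigID (mem (mpoly.msupp g))) /= [X in _ = _ + X]big1 ?addr0; last first.
  by move=> m; rewrite -mpoly.mcoeff_eq0 => /eqP->; rewrite mul0r.
rewrite -[RHS]big_filter; apply: perm_big; apply: uniq_perm.
- exact: mpoly.msupp_uniq.
- exact: filter_uniq.
by move=> m; rewrite mem_filter; case: (boolP (m \in mpoly.msupp g)) => // /sub ->.
Qed.

Lemma dpeval_sum g z i (Ms : seq (mpoly.multinom n)) : uniq Ms -> {subset mpoly.msupp g <= Ms} ->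
  dpeval g i z = \sum_(m <- Ms) mpoly.mcoeff m g * dpeval (mpoly.mpolyX C m) i z.
Proof.
move=> un sub.
have -> : dpeval g i z = \sum_(m <- mpoly.msupp g) mpoly.mcoeff m g * dpeval (mpoly.mpolyX C m) i z.
  have e : mpoly.mderiv i g = \sum_(m <- mpoly.msupp g)
      mpoly.mcoeff m g *: mpoly.mderiv i (mpoly.mpolyX C m).
    rewrite [in LHS](mpoly.mpolyE g) raddf_sum.
    by apply: eq_bigr => m _; exact: mpoly.mderivZ.
  rewrite /dpeval /peval e raddf_sum.
  by apply: eq_bigr => m _; exact: mpoly.mevalZ.
rewrite [RHS](bigID (mem (mpoly.msupp g))) /= [X in _ = _ + X]big1 ?addr0; last first.
  by move=> m; rewrite -mpoly.mcoeff_eq0 => /eqP->; rewrite mul0r.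
rewrite -[RHS]big_filter; apply: perm_big; apply: uniq_perm.
- exact: mpoly.msupp_uniq.
- exact: filter_uniq.
by move=> m; rewrite mem_filter; case: (boolP (m \in mpoly.msupp g)) => // /sub ->.
Qed.

(** The operator z_i d/dz_i multiplies each monomial by its exponent, so derivatives taken in this
    form have the same scales as values. *)
Lemma dpevalE g z i (Ms : seq (mpoly.multinom n)) : uniq Ms -> {subset mpoly.msupp g <= Ms} ->
  z ord0 i * dpeval g i z = \sum_(m <- Ms) mpoly.mcoeff m g * ((expn_of m i)%:R * mon z m).
Proof.
move=> un sub; rewrite (dpeval_sum _ _ un sub) mulr_sumr; apply: eq_bigr => m _.
rewrite mulrCA; congr (_ * _); rewrite /dpeval mpoly.mderivX /peval mpoly.mevalZ mpoly.mevalX mulrCA.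
rewrite -/(expn_of m i); case e : (expn_of m i) => [|k]; first by rewrite !mul0r.
congr (_ * _); rewrite /mon (bigD1 i) //= [in RHS](bigD1 i) //= mulrA; congr (_ * _).
  by rewrite mpoly.mnmBE mpoly.mnm1E eqxx -/(expn_of m i) e subn1 /= exprS.
apply: eq_bigr => j ji; congr (_ ^+ _).
by rewrite mpoly.mnmBE mpoly.mnm1E eq_sym (negPf ji) subn0.
Qed.

End NewtonWeights.
(** * Monomials along a sequence *)

Section MonomialAsymptotics.
Variables (R : realType) (n : nat) (U : set_system nat).
Hypothesis hU : free_ultra U.
Local Notation C := (CC R).
Local Notation mnm := (mpoly.multinom n).

Definition rmon (rho : 'I_n -> R) (m : mnm) : R := \prod_i rho i ^+ expn_of m i.
Definition supp_in (J : {set 'I_n}) (m : mnm) : bool :=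
  [forall i, (i \notin J) ==> (expn_of m i == 0%N)].

Lemma supp_inP J m i : supp_in J m -> i \notin J -> expn_of m i = 0%N.
Proof. by move=> /forallP/(_ i)/implyP h /h/eqP. Qed.

Lemma supp_inPn J m : ~~ supp_in J m -> exists2 i, i \notin J & expn_of m i != 0%N.
Proof.
by rewrite /supp_in negb_forall => /existsP; case=> i; rewrite negb_imply => /andP[iJ mi]; exists i.
Qed.

Lemma rmon_gt0 rho m : (forall i, 0 < rho i) -> 0 < rmon rho m.
Proof. by move=> h; apply: prodr_gt0 => i _; exact: exprn_gt0. Qed.

Lemma mon_notin (J : {set 'I_n}) (z : 'rV[C]_n) (m : mnm) : (forall i, (z ord0 i != 0) = (i \in J)) ->
  ~~ supp_in J m -> mon z m = 0.
Proof.
move=> hz /supp_inPn[i iJ mi].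
rewrite /mon (bigD1 i) //= (_ : z ord0 i = 0) ?expr0n ?(negPf mi) ?mul0r //.
by apply/eqP; rewrite -[_ == _]negbK hz.
Qed.

Lemma colB (x y : 'cV[R]_n) i : (x - y) i ord0 = x i ord0 - y i ord0.
Proof. by rewrite !mxE. Qed.

(** For x = - log |z| this is log |z^m0 / z^m|: it tends to +infinity when z^m is negligible against
    z^m0. *)
Definition logdiff (m0 m : mnm) (x : 'cV[R]_n) : R :=
  \sum_i ((expn_of m i)%:R - (expn_of m0 i)%:R) * x i ord0.

Lemma logdiffB m0 m x y : logdiff m0 m (x - y) = logdiff m0 m x - logdiff m0 m y.
Proof. by rewrite /logdiff -sumrB; apply: eq_bigr => i _; rewrite !mxE mulrBr. Qed.
Lemma logdiffD m0 m x y : logdiff m0 m (x + y) = logdiff m0 m x + logdiff m0 m y.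
Proof. by rewrite /logdiff -big_split; apply: eq_bigr => i _; rewrite !mxE mulrDr. Qed.
Lemma logdiffN m0 m x : logdiff m m0 x = - logdiff m0 m x.
Proof. by rewrite /logdiff -sumrN; apply: eq_bigr => i _; rewrite -mulNr opprB. Qed.

Definition lognorm (m0 m : mnm) : R := \sum_i `|(expn_of m i)%:R - (expn_of m0 i)%:R|.
Lemma logdiff_le m0 m (x : 'cV[R]_n) K : (forall i, `|x i ord0| <= K) ->
  `|logdiff m0 m x| <= lognorm m0 m * K.
Proof.
move=> h; apply: (le_trans (ler_norm_sum _ _ _)); rewrite mulr_suml.
by apply: ler_sum => i _; rewrite normrM ler_wpM2l.
Qed.

Lemma mulmx_bound p q (M : 'M[R]_(p, q)) : exists2 K, 0 <= K &
  forall (x : 'cV[R]_q) k, 0 <= k -> (forall j, `|x j ord0| <= k) ->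
    forall i, `|(M *m x) i ord0| <= K * k.
Proof.
exists (\sum_i \sum_j `|M i j|); first by apply: sumr_ge0 => i _; apply: sumr_ge0.
move=> x k k0 h i; rewrite mxE; apply: (le_trans (ler_norm_sum _ _ _)).
apply: (@le_trans _ _ ((\sum_j `|M i j|) * k)).
  by rewrite mulr_suml; apply: ler_sum => j _; rewrite normrM ler_wpM2l.
apply: ler_wpM2r => //; rewrite [leRHS](bigD1 i) //= lerDl.
by apply: sumr_ge0 => ? _; apply: sumr_ge0.
Qed.

Lemma common_denominator (q : 'I_n -> rat) : exists2 D : nat, (0 < D)%N &
  forall i, 0 <= q i -> exists k : nat, k%:R = D%:R * q i.
Proof.
exists (\prod_i `|denq (q i)|)%N; first by apply: prodn_gt0 => i; rewrite absz_gt0 denq_neq0.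
move=> i qi; exists (\prod_(j | j != i) `|denq (q j)| * `|numq (q i)|)%N.
rewrite [in RHS](bigD1 i) //= !natrM [RHS]mulrAC mulrC; congr (_ * _).
rewrite mulrC !pmulrn !gez0_abs ?numq_ge0 ?denq_ge0 //.
by rewrite numqE.
Qed.

Lemma log_trichotomy (phi : nat -> R) :
  [\/ exists2 K, 0 <= K & U [set v | `|phi v| <= K],
      forall K, U [set v | K <= phi v] | forall K, U [set v | K <= - phi v]].
Proof.
have [h|/existsNP[K /(u_not hU) hK]] := pselect (forall K, U [set v | K <= phi v]).
  by constructor 2.
have [h|/existsNP[K' /(u_not hU) hK']] := pselect (forall K, U [set v | K <= - phi v]).
  by constructor 3.
constructor 1; exists (`|K| + `|K'|); first by rewrite addr_ge0.
refine (uW hU (uI hU hK hK') _) => v [/= /negP a /negP b].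
rewrite -!ltNge in a b; rewrite ler_norml.
have := ler_norm K; have := ler_norm K'; have := normr_ge0 K; have := normr_ge0 K'.
by move=> *; apply/andP; split; lra.
Qed.

Variables (z : nat -> 'rV[C]_n) (J : {set 'I_n}) (b : R) (Ms : seq mnm).
Hypothesis hJ : U [set v | forall i, (z v ord0 i != 0) = (i \in J)].
Hypothesis hb : U [set v | forall i, cnorm (z v ord0 i) <= b].
Hypothesis Ms0 : mpoly.mnm0 \in Ms.
Hypothesis Ms1 : forall i, mpoly.mnm1 i \in Ms.

Lemma expn_of0 i : expn_of (mpoly.mnm0 : mnm) i = 0%N.
Proof. by rewrite /expn_of mpoly.mnm0E. Qed.
Lemma expn_of1 i j : expn_of (mpoly.mnm1 i : mnm) j = (i == j).
Proof. by rewrite /expn_of mpoly.mnm1E. Qed.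
Lemma supp_in0 : supp_in J mpoly.mnm0.
Proof. by apply/forallP => i; rewrite expn_of0 eqxx implybT. Qed.
Lemma supp_in1 i : supp_in J (mpoly.mnm1 i) = (i \in J).
Proof.
apply/forallP/idP => [/(_ i)|iJ j]; rewrite expn_of1.
  by rewrite eqxx /= implybF negbK.
by apply/implyP => jJ; case: (i =P j) => // e; rewrite -e iJ in jJ.
Qed.

Lemma wt0 w : wt w (mpoly.mnm0 : mnm) = 0%N.
Proof. by rewrite /wt big1 // => i _; rewrite expn_of0 muln0. Qed.
Lemma wt1 w i : wt w (mpoly.mnm1 i : mnm) = w i.
Proof.
rewrite /wt (bigD1 i) //= big1 ?addn0 ?expn_of1 ?eqxx ?muln1 // => j ji.
by rewrite expn_of1 eq_sym (negPf ji) muln0.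
Qed.

(* With x = - log |z|, the integral forms m - m0 split into those bounded along x
   and those tending to infinity. Subtracting a bounded vector from x gives y
   annihilated by the bounded forms; rounding x before projecting gives a rational
   point of the same subspace, hence the weight. *)
Theorem monomial_asymptotics :
  exists (w : 'I_n -> nat) (a : 'rV[C]_n) (rho : nat -> 'I_n -> R),
  [/\ in_torus a, forall v i, 0 < rho v i,
   (forall m0 m, m0 \in Ms -> m \in Ms -> supp_in J m0 -> (wt w m0 <= wt w m)%N ->
     tends U (fun v => mon (z v) m / r2c (rmon (rho v) m0))
       (if wt w m0 == wt w m then mon a m else 0)) &
   (forall m0 m, m0 \in Ms -> m \in Ms -> supp_in J m0 -> ~~ supp_in J m ->
     (wt w m0 < wt w m)%N)].
Proof.
pose x v : 'cV[R]_n := \col_i (if i \in J then - ln (cnorm (z v ord0 i)) else 0).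
pose MJ := [seq m <- Ms | supp_in J m].
pose Bd m0 m := exists2 K, 0 <= K & U [set v | `|logdiff m0 m (x v)| <= K].
pose B0 := [seq p <- [seq (m0, m) | m0 <- MJ, m <- MJ] | `[< Bd p.1 p.2 >]].
pose p0 : mnm * mnm := (mpoly.mnm0, mpoly.mnm0).
pose A : 'M[rat]_(size B0, n) := \matrix_(k, i)
  ((expn_of (nth p0 B0 k).2 i)%:R - (expn_of (nth p0 B0 k).1 i)%:R).
(* From A G A = A it follows that P = 1 - G A is a projection onto the kernel of the bounded forms.
   Its entries are rational, which later yields integer weights. *)
pose G := pinvmx A.
have AGA : A *m G *m A = A by apply: mulmxKpV; exact: submx_refl.
pose r := (ratr : rat -> R).
pose P : 'M[rat]_n := 1%:M - G *m A.
have AP : A *m P = 0 by rewrite mulmxBr mulmx1 mulmxA AGA subrr.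
have ArE (k : 'I_(size B0)) (u : 'cV[R]_n) :
    (map_mx r A *m u) k ord0 = logdiff (nth p0 B0 k).1 (nth p0 B0 k).2 u.
  rewrite mxE; apply: eq_bigr => i _; rewrite !mxE.
  by rewrite /r rmorphB /= !ratr_nat.
have ld0 (u : 'cV[R]_n) m0 m : m0 \in MJ -> m \in MJ -> Bd m0 m -> map_mx r A *m u = 0 ->
    logdiff m0 m u = 0.
  move=> h0 h1 hB e.
  have pB : (m0, m) \in B0.
    rewrite mem_filter; apply/andP; split; first exact/asboolP.
    by apply/allpairsP; exists (m0, m).
  have kl : (index (m0, m) B0 < size B0)%N by rewrite index_mem.
  by have := ArE (Ordinal kl) u; rewrite /= nth_index //= e mxE.
pose y v := map_mx r P *m x v.
have yE v : x v - y v = map_mx r G *m (map_mx r A *m x v).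
  rewrite /y /P map_mxB map_mx1 mulmxBl mul1mx map_mxM mulmxA; by rewrite opprB addrC subrK.
have Ay v : map_mx r A *m y v = 0 by rewrite mulmxA -map_mxM AP map_mx0 mul0mx.
have [K1 K10 hK1] : exists2 K1, 0 <= K1 & U [set v | forall k, `|(map_mx r A *m x v) k ord0| <= K1].
  have h : forall k : 'I_(size B0), exists K, 0 <= K /\ U [set v | `|(map_mx r A *m x v) k ord0| <= K].
    move=> k; have : nth p0 B0 k \in B0 by rewrite mem_nth.
    rewrite mem_filter => /andP[/asboolP[K K0 hK] _].
    by exists K; split => //; refine (uW hU hK _) => v /=; rewrite ArE.
  have [K hK] := choice h.
  exists (\sum_k K k); first by apply: sumr_ge0 => k _; case: (hK k).
  refine (uW hU (u_all hU (fun k => (hK k).2)) _) => v /= hv k.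
  apply: (le_trans (hv k)); rewrite (bigD1 k) //= lerDl.
  by apply: sumr_ge0 => j _; case: (hK j).
have [KG KG0 hG] := mulmx_bound (map_mx r G).
pose K2 := KG * K1.
have hxy : U [set v | forall i, `|(x v - y v) i ord0| <= K2].
  by refine (uW hU hK1 _) => v hv i; rewrite yE; apply: hG.
have [KP KP0 hP] := mulmx_bound (map_mx r P).
pose Pos m0 m := forall K, U [set v | K <= logdiff m0 m (x v)].
have tri m0 m : [\/ Bd m0 m, Pos m0 m | Pos m m0].
  case: (log_trichotomy (fun v => logdiff m0 m (x v))) => h; [constructor 1|constructor 2|constructor 3] => //.
  by move=> K; refine (uW hU (h K) _) => v /= hK; rewrite logdiffN.
have Posy m0 m : Pos m0 m -> forall K, U [set v | K <= logdiff m0 m (y v)].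
  move=> h K; refine (uW hU (uI hU (h (K + lognorm m0 m * K2)) hxy) _) => v [/= h1 h2].
  have := logdiff_le m0 m h2; rewrite logdiffB ler_norml => /andP[_]; lra.
(* As z_i is bounded, x_i cannot tend to -infinity; this makes the weights nonnegative. *)
have xge i : i \in J -> ~ Pos (mpoly.mnm1 i) (mpoly.mnm0).
  move=> iJ h.
  have [v [/= h1 [h2 h3]]] := u_ex hU (uI hU (h (ln (`|b| + 1) + 1)) (uI hU hb hJ)).
  have zi : 0 < cnorm (z v ord0 i) by rewrite cnorm_gt0 h3.
  move: h1; rewrite /logdiff (bigD1 i) //= big1 ?addr0; last first.
    by move=> j ji; rewrite expn_of0 expn_of1 eq_sym (negPf ji) subrr mul0r.
  rewrite expn_of0 expn_of1 eqxx mxE iJ sub0r mulN1r opprK => h1.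
  have : ln (cnorm (z v ord0 i)) <= ln (`|b| + 1).
    have b1 : 0 < `|b| + 1 by rewrite ltr_wpDl.
    rewrite ler_ln ?posrE ?zi ?b1 //.
    by apply: (le_trans (h2 i)); apply: (le_trans (ler_norm _)); rewrite lerDl.
  lra.
(* A single index [v0] serves all pairs: there every unbounded form exceeds [lognorm * KP], the most
   by which rounding [x v0] to integers and projecting can change it. *)
have hall : U [set v | forall q, q \in [seq (m0, m) | m0 <- MJ, m <- MJ] ->
    Pos q.1 q.2 -> lognorm q.1 q.2 * KP + 1 <= logdiff q.1 q.2 (y v)].
  apply: u_seq => // q _.
  have [h|h] := pselect (Pos q.1 q.2); last by apply: uT => // v /h.
  by refine (uW hU (Posy _ _ h (lognorm q.1 q.2 * KP + 1)) _) => v.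
have [v0 hv0] := u_ex hU hall.
pose q : 'cV[rat]_n := \col_i (Num.floor (x v0 i ord0))%:~R.
pose wq : 'cV[rat]_n := P *m q.
have hq i : `|(map_mx r q - x v0) i ord0| <= 1.
  rewrite 2!mxE /q !mxE /r ratr_int -/(x v0 i ord0).
  have /andP[h1 h2] := floor_itv (x v0 i ord0).
  rewrite mxE in h1 h2; rewrite intrD in h2.
  by rewrite ler_norml; apply/andP; split; lra.
have wqE : map_mx r wq = y v0 + map_mx r P *m (map_mx r q - x v0).
  by rewrite map_mxM mulmxBr addrC subrK.
have wqA : map_mx r A *m map_mx r wq = 0.
  by rewrite -map_mxM mulmxA AP mul0mx map_mx0.
have wqpos m0 m : m0 \in MJ -> m \in MJ -> Pos m0 m -> 0 < logdiff m0 m (map_mx r wq).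
  move=> h0 h1 h.
  have pin : (m0, m) \in [seq (m0, m) | m0 <- MJ, m <- MJ].
    by apply/allpairsP; exists (m0, m).
  have /= hy := hv0 _ pin h.
  have hh i : `|(map_mx r P *m (map_mx r q - x v0)) i ord0| <= KP.
    by rewrite -[KP]mulr1; apply: hP.
  have := logdiff_le m0 m hh; rewrite ler_norml => /andP[h2 _].
  have -> : logdiff m0 m (map_mx r wq) = logdiff m0 m (y v0) + logdiff m0 m (map_mx r P *m (map_mx r q - x v0)).
    by rewrite wqE logdiffD.
  lra.
have MJ0 : mpoly.mnm0 \in MJ by rewrite mem_filter supp_in0.
have MJ1 i : i \in J -> mpoly.mnm1 i \in MJ by move=> iJ; rewrite mem_filter supp_in1 iJ Ms1.
have ld1 i u : logdiff (mpoly.mnm0) (mpoly.mnm1 i) u = u i ord0.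
  rewrite /logdiff (bigD1 i) //= big1 ?addr0; last first.
    by move=> j ji; rewrite expn_of0 expn_of1 eq_sym (negPf ji) subrr mul0r.
  by rewrite expn_of0 expn_of1 eqxx subr0 mul1r.
have wq_ge0 i : i \in J -> 0 <= wq i ord0.
  move=> iJ; have -> : (0 <= wq i ord0) = (0 <= logdiff (mpoly.mnm0) (mpoly.mnm1 i) (map_mx r wq)).
    by rewrite ld1 [in RHS]mxE /r ler0q.
  case: (tri (mpoly.mnm0) (mpoly.mnm1 i)) => h.
  - by rewrite (ld0 _ _ _ _ _ h) // MJ1.
  - by apply/ltW/wqpos => //; exact: MJ1.
  - by have := xge i iJ h.
have [D D0 hD] := common_denominator (fun i => wq i ord0).
have hD' i : exists k : nat, i \in J -> k%:R = D%:R * wq i ord0.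
  case: (boolP (i \in J)) => iJ; last by exists 0%N.
  by have [k hk] := hD i (wq_ge0 i iJ); exists k.
have [k hk] := choice hD'.
pose wJ m := (\sum_(i in J) k i * expn_of m i)%N.
(* Above the weight of every listed monomial supported in [J]. Given to the coordinates outside [J],
   it makes every monomial that vanishes along the sequence heavier than those. *)
pose N := (\sum_(m <- Ms) wJ m).+1.
pose w i := if i \in J then k i else N.
have wtJ m : supp_in J m -> wt w m = wJ m.
  move=> ms; rewrite /wt (bigID (mem J)) /= [X in (_ + X)%N]big1 ?addn0; last first.
    by move=> i iJ; rewrite (supp_inP ms iJ) muln0.
  by apply: eq_bigr => i iJ; rewrite /w iJ.
have wtdiff m0 m : supp_in J m0 -> supp_in J m ->
    (wt w m)%:R - (wt w m0)%:R = D%:R * logdiff m0 m (map_mx r wq).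
  move=> s0 s1; rewrite !wtJ // /wJ !natr_sum -sumrB /logdiff mulr_sumr.
  rewrite [RHS](bigID (mem J)) /= [X in _ = _ + X]big1 ?addr0; last first.
    by move=> i iJ; rewrite !(supp_inP _ iJ) // subrr mul0r mulr0.
  apply: eq_bigr => i iJ; rewrite !natrM -mulrBr mulrCA [LHS]mulrC; congr (_ * _).
  have := congr1 r (hk i iJ); rewrite /r rmorphM /= !ratr_nat => ->; by rewrite [in RHS]mxE.
have Dp : 0 < D%:R :> R by rewrite ltr0n.
have inMJ m : m \in Ms -> supp_in J m -> m \in MJ by move=> h1 h2; rewrite mem_filter h2.
have wtBd m0 m : m0 \in Ms -> m \in Ms -> supp_in J m0 -> supp_in J m -> Bd m0 m -> wt w m = wt w m0.
  move=> i0 i1 s0 s1 h; have := wtdiff _ _ s0 s1.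
  rewrite (ld0 _ _ _ _ _ h) ?inMJ // mulr0 => /eqP.
  by rewrite subr_eq0 eqr_nat => /eqP.
have wtPos m0 m : m0 \in Ms -> m \in Ms -> supp_in J m0 -> supp_in J m -> Pos m0 m -> (wt w m0 < wt w m)%N.
  move=> i0 i1 s0 s1 h; have := wtdiff _ _ s0 s1.
  have := wqpos m0 m (inMJ _ i0 s0) (inMJ _ i1 s1) h => hp.
  by have := mulr_gt0 Dp hp => + e; rewrite -e subr_gt0 ltr_nat.
have wtN m0 m : m0 \in Ms -> m \in Ms -> supp_in J m0 -> ~~ supp_in J m -> (wt w m0 < wt w m)%N.
  move=> i0 i1 s0 /supp_inPn[i iJ mi].
  have h1 : (wt w m0 < N)%N by rewrite wtJ // ltnS (big_rem m0 i0) /= leq_addr.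
  apply: (leq_trans h1); rewrite /wt (bigD1 i) //= /w (negPf iJ).
  by apply: leq_trans (leq_addr _ _); rewrite leq_pmulr // lt0n.
(* The rescaled coordinates have modulus exp (- (x - y)_i) on [J]. As x - y is bounded, they stay
   between two positive constants and their limit lies in the torus. *)
pose av v i : C := if i \in J then z v ord0 i * r2c (expR (y v i ord0)) else 1.
have avn : U [set v | forall i, i \in J -> cnorm (av v i) = expR (- (x v - y v) i ord0)].
  refine (uW hU hJ _) => v hv i iJ; have zi : 0 < cnorm (z v ord0 i) by rewrite cnorm_gt0 hv.
  rewrite /av iJ cnormM cnorm_r2c ger0_norm ?expR_ge0 // -[cnorm (z v ord0 i)]lnK ?posrE //.
  have xE : x v i ord0 = - ln (cnorm (z v ord0 i)) by rewrite mxE iJ.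
  rewrite -expRD; congr expR; rewrite colB xE; ring.
have [a0 ha0] : exists a0 : 'I_n -> C, forall i, tends U (fun v => av v i) (a0 i).
  apply: (@bounded_limit_vec _ _ hU _ _ (expR K2 + 1)).
  refine (uW hU (uI hU avn hxy) _) => v [/= h1 h2] i.
  have [iJ|iJ] := boolP (i \in J); last by rewrite /av (negPf iJ) cnorm1 lerDr expR_ge0.
  rewrite h1 //; apply: (@le_trans _ _ (expR K2)); last by rewrite lerDl.
  by rewrite ler_expR; apply: le_trans (h2 i); rewrite -normrN ler_norm.
have a0n0 i : a0 i != 0.
  have h : expR (- K2) <= cnorm (a0 i) \/ i \notin J.
    have [iJ|iJ] := boolP (i \in J); [left|by right].
    apply: (@tends_ge _ _ hU (fun v => cnorm (av v i))); first exact: (tends_cnorm hU (ha0 i)).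
    refine (uW hU (uI hU avn hxy) _) => v [/= h1 h2].
    by rewrite h1 // ler_expR lerN2; apply: le_trans (ler_norm _) (h2 i).
  case: h => h; first by rewrite -cnorm_gt0; apply: lt_le_trans h; exact: expR_gt0.
  have -> : a0 i = 1 by apply: (tends_uniq hU (ha0 i)); rewrite /av (negPf h); exact: tends_cst.
  exact: oner_neq0.
exists w, (\row_i a0 i), (fun v i => expR (- y v i ord0)); split => //.
- by move=> i; rewrite mxE; apply/eqP.
- by move=> v i; exact: expR_gt0.
move=> m0 m i0 i1 s0 le.
have [s1|s1] := boolP (supp_in J m); last first.
  rewrite ltn_eqF ?wtN //; apply: tends_ext (tends_cst hU 0) => //.
  by refine (uW hU hJ _) => v hv /=; rewrite (mon_notin hv s1) mul0r.
(* With rho = exp (- y) the quotient splits into a convergent factor and exp (- logdiff m0 m y). The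
   latter is 1 for a bounded pair, as [y] is killed by the bounded forms, and tends to 0 when z^m is
   negligible. *)
have factor : U [set v | (\prod_i av v i ^+ expn_of m i) * r2c (expR (- logdiff m0 m (y v))) =
   mon (z v) m / r2c (rmon (fun i => expR (- y v i ord0)) m0)].
  apply: uT => // v /=.
  rewrite -r2cV /rmon -prodfV /logdiff -sumrN expR_sum.
  rewrite /mon !(big_morph _ (@r2cM R) (@r2c1 R)) -!big_split /=.
  apply: eq_bigr => i _; have [iJ|iJ] := boolP (i \in J); last first.
    by rewrite !(supp_inP _ iJ) // !expr0 subrr mul0r oppr0 expR0 invr1.
  rewrite /av iJ exprMn -mulrA; congr (_ * _).
  rewrite -r2cX -r2cM; congr r2c.
  rewrite -!expRM_natl -expRN -expRD; congr expR; ring.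
have tav : tends U (fun v => \prod_i av v i ^+ expn_of m i) (mon (\row_i a0 i) m).
  rewrite /mon; apply: tends_prod => // i _; rewrite mxE.
  exact: tendsX.
apply: tends_ext factor _ => //.
case: (tri m0 m) => h.
- rewrite (wtBd _ _ _ _ _ _ h) // eqxx.
  apply: tends_ext tav => //; apply: uT => // v /=.
  by rewrite (ld0 (y v) _ _ _ _ h) ?inMJ // oppr0 expR0 mulr1.
- rewrite ltn_eqF ?wtPos //.
  rewrite -(mulr0 (mon (\row_i a0 i) m)); apply: tendsM => //.
  move=> e e0; refine (uW hU (Posy _ _ h (e^-1)) _) => v /= hv.
  rewrite subr0 cnorm_r2c ger0_norm ?expR_ge0 // expRN invf_plt ?posrE ?expR_gt0 //.
  by apply: le_lt_trans hv _; have := expR_ge1Dx (logdiff m0 m (y v)); lra.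
- by have := wtPos _ _ i1 i0 s1 s0 h; rewrite ltnNge le.
Qed.

End MonomialAsymptotics.

(** * Face functions as leading terms along a sequence *)

Section FaceLimits.
Variables (R : realType) (n : nat) (U : set_system nat).
Hypothesis hU : free_ultra U.
Local Notation C := (CC R).
Local Notation mnm := (mpoly.multinom n).

Definition N2 (z : 'rV[C]_n) : R := \sum_i normsq (z ord0 i).

Lemma normsq_le_N2 (z : 'rV[C]_n) i : normsq (z ord0 i) <= N2 z.
Proof. by rewrite /N2 (bigD1 i) //= lerDl sumr_ge0 // => j _; exact: normsq_ge0. Qed.
Lemma cnorm_le_N2 z i b : 0 <= b -> N2 z <= b ^+ 2 -> cnorm (z ord0 i) <= b.
Proof.
move=> b0 h; rewrite -(@ler_pXn2r _ 2) ?nnegrE ?cnorm_ge0 // cnorm_sqr.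
exact: le_trans (normsq_le_N2 z i) h.
Qed.
Lemma tends_mon (z : nat -> 'rV[C]_n) (z' : 'rV[C]_n) m : (forall i, tends U (fun v => z v ord0 i) (z' ord0 i)) ->
  tends U (fun v => mon (z v) m) (mon z' m).
Proof. by move=> h; apply: tends_prod => // i _; apply: tendsX. Qed.

Lemma tends_peval_family (sp : C -> mpoly.mpoly n C) (Ms : seq mnm) t t'
    (z : nat -> 'rV[C]_n) (z' : 'rV[C]_n) :
  uniq Ms -> (forall t0, {subset mpoly.msupp (sp t0) <= Ms}) ->
  (forall m, tends U (fun v => mpoly.mcoeff m (sp (t v))) (mpoly.mcoeff m (sp t'))) ->
  (forall i, tends U (fun v => z v ord0 i) (z' ord0 i)) ->
  tends U (fun v => peval (sp (t v)) (z v)) (peval (sp t') z').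
Proof.
move=> un sub hc hz; rewrite (pevalE _ un (sub t')).
have : tends U (fun v => \sum_(m <- Ms) mpoly.mcoeff m (sp (t v)) * mon (z v) m)
    (\sum_(m <- Ms) mpoly.mcoeff m (sp t') * mon z' m).
  by apply: tends_sum => // m _; apply: tendsM => //; exact: tends_mon.
by apply: tends_ext => //; apply: uT => // v /=; rewrite -(pevalE _ un (sub _)).
Qed.

Lemma peval_supp (J : {set 'I_n}) (g : mpoly.mpoly n C) (z : 'rV[C]_n) : (forall i, (z ord0 i != 0) = (i \in J)) ->
  peval g z != 0 -> exists2 m, m \in mpoly.msupp g & supp_in J m.
Proof.
move=> hz h; apply: contrapT => hn; move: h.
rewrite (pevalE _ (mpoly.msupp_uniq g) (fun m => id)) big_seq big1 ?eqxx // => m ms.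
rewrite (mon_notin hz) ?mulr0 //; apply/negP => s; apply: hn; by exists m.
Qed.

Lemma supp_in_V (I : {set 'I_n}) (g : mpoly.mpoly n C) :
  (forall m, m \in mpoly.msupp g -> ~~ supp_in I m) -> in_V g I.
Proof.
move=> h z hz.
rewrite (pevalE _ (mpoly.msupp_uniq g) (fun m => id)) big_seq big1 // => m /h /supp_inPn[i iI mi].
by rewrite /mon (bigD1 i) //= hz // expr0n (negPf mi) mul0r mulr0.
Qed.

(** The conclusion of [monomial_asymptotics], made into a hypothesis: [rmon (rho v) m0] is the scale
    of the monomial m0, and the last clause puts monomials vanishing along the sequence above all
    others. *)
Definition asym (z : nat -> 'rV[C]_n) (J : {set 'I_n}) (Ms : seq mnm)
   (w : 'I_n -> nat) (a : 'rV[C]_n) (rho : nat -> 'I_n -> R) : Prop :=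
  [/\ in_torus a, forall v i, 0 < rho v i,
   (forall m0 m, m0 \in Ms -> m \in Ms -> supp_in J m0 -> (wt w m0 <= wt w m)%N ->
     tends U (fun v => mon (z v) m / r2c (rmon (rho v) m0))
       (if wt w m0 == wt w m then mon a m else 0)) &
   (forall m0 m, m0 \in Ms -> m \in Ms -> supp_in J m0 -> ~~ supp_in J m ->
     (wt w m0 < wt w m)%N)].

Variables (z : nat -> 'rV[C]_n) (J : {set 'I_n}) (Ms : seq mnm)
   (w : 'I_n -> nat) (a : 'rV[C]_n) (rho : nat -> 'I_n -> R).
Hypothesis Hasym : asym z J Ms w a rho.
Hypothesis Ms0 : mpoly.mnm0 \in Ms.
Hypothesis Ms1 : forall i, mpoly.mnm1 i \in Ms.
Hypothesis Msu : uniq Ms.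

Lemma rmon0 r : rmon r (mpoly.mnm0 : mnm) = 1 :> R.
Proof. by rewrite /rmon big1 // => i _; rewrite expn_of0 expr0. Qed.
Lemma rmon1 (r : 'I_n -> R) i : rmon r (mpoly.mnm1 i : mnm) = r i.
Proof.
rewrite /rmon (bigD1 i) //= big1 ?mulr1 ?expn_of1 ?eqxx ?expr1 // => j ji.
by rewrite expn_of1 eq_sym (negPf ji) expr0.
Qed.
Lemma mon1 (y : 'rV[C]_n) i : mon y (mpoly.mnm1 i) = y ord0 i.
Proof.
rewrite /mon (bigD1 i) //= big1 ?mulr1 ?expn_of1 ?eqxx ?expr1 // => j ji.
by rewrite expn_of1 eq_sym (negPf ji) expr0.
Qed.

Definition zlim : 'rV[C]_n := \row_i (if w i == 0%N then a ord0 i else 0).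

(** Compare the monomial z_i with the monomial 1, whose weight is 0 and whose scale is 1. *)
Lemma tends_zlim i : tends U (fun v => z v ord0 i) (zlim ord0 i).
Proof.
case: Hasym => _ _ h _.
have := h _ _ Ms0 (Ms1 i) (supp_in0 J); rewrite wt0 wt1 leq0n => /(_ isT).
rewrite mon1 mxE eq_sym; apply: tends_ext => //; apply: uT => // v /=.
by rewrite rmon0 mon1 divr1.
Qed.

Lemma weight0_in_J i : w i = 0%N -> i \in J.
Proof.
case: Hasym => _ _ _ h wi; apply: contrapT => /negP iJ.
by have := h _ _ Ms0 (Ms1 i) (supp_in0 J); rewrite supp_in1 wt0 wt1 wi => /(_ iJ).
Qed.

Lemma mon_zlim m : mon zlim m = if wt w m == 0%N then mon a m else 0.
Proof.
case: eqP => [e|/eqP e].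
  apply: eq_bigr => i _; rewrite mxE; case: (w i =P 0%N) => // /eqP wi.
  have : (w i * expn_of m i <= wt w m)%N by rewrite /wt (bigD1 i) //= leq_addr.
  by rewrite e leqn0 muln_eq0 (negPf wi) /= => /eqP->; rewrite !expr0.
move: e; rewrite /wt sum_nat_eq0 => /forallPn; case=> i /=.
rewrite muln_eq0 negb_or => /andP[wi mi].
by rewrite /mon (bigD1 i) //= mxE (negPf wi) expr0n (negPf mi) mul0r.
Qed.

Lemma tends_normsq_ratio i0 i : i0 \in J -> (w i0 <= w i)%N ->
  tends U (fun v => r2c (normsq (z v ord0 i)) / r2c (rho v i0 ^+ 2))
    (r2c (if w i0 == w i then normsq (a ord0 i) else 0)).
Proof.
move=> iJ le; case: Hasym => _ hr h _.
have := h _ _ (Ms1 i0) (Ms1 i); rewrite supp_in1 !wt1 => /(_ iJ le) /(tends_normsq hU).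
rewrite mon1 [r2c (if _ then _ else _)](_ : _ = r2c (normsq (if w i0 == w i then a ord0 i else 0))).
  apply: tends_ext => //; apply: uT => // v /=.
  by rewrite rmon1 mon1 -r2cV normsqM normsq_r2c r2cM -r2cV exprVn.
by case: ifP => // _; congr r2c; apply/esym/eqP; rewrite normsq_eq0.
Qed.

(* The vector (|z_i|^2 mu) is asymptotically proportional to (|a_i|^2), restricted
   to the coordinates of least weight. *)
Lemma tends_radial (mu : nat -> C) (l : 'I_n -> C) : (exists i, i \in J) ->
  (forall i, tends U (fun v => r2c (normsq (z v ord0 i)) * mu v) (l i)) ->
  exists i0 kappa, [/\ i0 \in J, forall i, (w i0 <= w i)%N &
    forall i, l i = kappa * r2c (if w i0 == w i then normsq (a ord0 i) else 0)].
Proof.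
move=> [j0 j0J] hl; have [i0 i0J hmin] := arg_minnP w j0J.
case: (Hasym) => ha hr h hN.
have hmin' i : (w i0 <= w i)%N.
  have [iJ|iJ] := boolP (i \in J); first exact: hmin.
  have := hN _ _ (Ms1 i0) (Ms1 i); rewrite !supp_in1 !wt1 => /(_ i0J iJ); exact: ltnW.
have r0 : normsq (a ord0 i0) != 0 by rewrite normsq_eq0; apply/eqP/ha.
exists i0, (l i0 / r2c (normsq (a ord0 i0))); split => // i.
have t0 := tends_normsq_ratio i0J (leqnn _); rewrite eqxx in t0.
have t1 := tends_normsq_ratio i0J (hmin' i).
have rC : r2c (normsq (a ord0 i0)) != 0 by rewrite r2c_eq0.
(* This eliminates the unknown [mu]: |z_i0|^2 mu converges and |z_i0|^2 / rho_i0^2 has a nonzero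
   limit, so rho_i0^2 mu converges and determines all the other components. *)
have key (A B X M : C) : A != 0 -> X != 0 -> A * M / (A / X) * (B / X) = B * M.
  by move=> h1 h2; field; rewrite h1 h2.
apply: (tends_uniq hU (hl i)).
have := tendsM hU (tendsM hU (hl i0) (tendsV hU rC t0)) t1.
apply: tends_ext => //; refine (uW hU (tends_neq0 hU t0 rC) _) => v /= hv.
have x0 : r2c (rho v i0 ^+ 2) != 0 by rewrite r2c_eq0 gt_eqF // exprn_gt0.
have y0 : r2c (normsq (z v ord0 i0)) != 0.
  apply/eqP => e; move: hv; rewrite e mul0r cnorm0 ltNge divr_ge0 ?cnorm_ge0 //.
exact: key.
Qed.

Section OneFunction.
Variables (sp : C -> mpoly.mpoly n C) (tau : R).
Hypothesis sub : forall t0, {subset mpoly.msupp (sp t0) <= Ms}.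
Hypothesis hNB : forall t, cnorm t < tau -> newton_boundary (sp t) = newton_boundary (sp 0).
Variables (t : nat -> C) (t' : C).
Hypothesis ht : forall m, tends U (fun v => mpoly.mcoeff m (sp (t v))) (mpoly.mcoeff m (sp t')).
Hypothesis htau : forall v, cnorm (t v) < tau.
Hypothesis htau' : cnorm t' < tau.

(** Constancy of the Newton boundary gives all members the same least weight. A minimiser for t'
    involves only the variables of [J], since otherwise it would be heavier than the exponent
    supported in [J] from which the argument starts. *)
Lemma least_exponent : U [set v | exists2 m, m \in mpoly.msupp (sp (t v)) & supp_in J m] ->
  exists m0, [/\ m0 \in mpoly.msupp (sp t'), supp_in J m0 &
    forall t0, cnorm t0 < tau -> forall m, m \in mpoly.msupp (sp t0) -> (wt w m0 <= wt w m)%N].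
Proof.
move=> /(u_ex hU)[v0 [m1 m1s m1J]].
have e t0 t1 : cnorm t0 < tau -> cnorm t1 < tau -> newton_boundary (sp t0) = newton_boundary (sp t1).
  by move=> h0 h1; rewrite (hNB h0) (hNB h1).
have [m2 m2s m2w] := boundary_min_weight w (e _ _ (htau v0) htau') m1s.
have [m0 m0s hm0] := exists_argmin (fun m => (wt w m)%:R : R) m2s.
exists m0; split => //.
  apply: contrapT => /negP nJ; case: Hasym => _ _ _ /(_ m1 m0 (sub m1s) (sub m0s) m1J nJ).
  by rewrite ltnNge (leq_trans _ m2w) // -(ler_nat R) hm0.
move=> t0 h0 m ms; have [m3 m3s m3w] := boundary_min_weight w (e _ _ h0 htau') ms.
by apply: leq_trans m3w; rewrite -(ler_nat R) hm0.
Qed.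

Variable m0 : mnm.
Hypothesis m0s : m0 \in mpoly.msupp (sp t').
Hypothesis m0J : supp_in J m0.
Hypothesis m0min : forall t0, cnorm t0 < tau -> forall m, m \in mpoly.msupp (sp t0) -> (wt w m0 <= wt w m)%N.

Let G := face_fun w (sp t').

Lemma mcoeff_G m : mpoly.mcoeff m G = if wt w m == wt w m0 then mpoly.mcoeff m (sp t') else 0.
Proof. by apply: mcoeff_face_fun => [m'|]; [exact: m0min|exists m0]. Qed.

Lemma msupp_G : {subset mpoly.msupp G <= Ms}.
Proof.
move=> m; rewrite mpoly.mcoeff_msupp mcoeff_G; case: ifP => [_|]; last by rewrite eqxx.
by rewrite -mpoly.mcoeff_msupp; exact: sub.
Qed.

(** The factor [e] is 1 for values and an exponent for logarithmic derivatives. A monomial lighter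
    than m0 might blow up after division by the scale of m0, but it is absent for every [t v], not
    merely in the limit. *)
Lemma tends_face (e : mnm -> C) :
  tends U (fun v => (\sum_(m <- Ms) mpoly.mcoeff m (sp (t v)) * (e m * mon (z v) m))
      / r2c (rmon (rho v) m0))
    (\sum_(m <- Ms) mpoly.mcoeff m G * (e m * mon a m)).
Proof.
case: Hasym => _ _ h _.
have : tends U (fun v => \sum_(m <- Ms) (if m \in Ms then mpoly.mcoeff m (sp (t v)) * (e m * (mon (z v) m / r2c (rmon (rho v) m0))) else 0))
   (\sum_(m <- Ms) (if m \in Ms then mpoly.mcoeff m G * (e m * mon a m) else 0)).
  apply: tends_sum => // m _; case: ifP => mMs; last exact: tends_cst.
  have tc : tends U (fun v => mpoly.mcoeff m (sp (t v))) (mpoly.mcoeff m (sp t')).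
    exact: ht.
  have [le|lt] := leqP (wt w m0) (wt w m); last first.
    rewrite mcoeff_G ltn_eqF // mul0r; apply: tends_ext (tends_cst hU 0) => //.
    apply: uT => // v /=; rewrite (_ : mpoly.mcoeff m _ = 0) ?mul0r //.
    apply/eqP; rewrite mpoly.mcoeff_eq0; apply: contraL lt; rewrite -leqNgt; exact: m0min.
  have := tendsM hU tc (tendsM hU (tends_cst hU (e m)) (h _ _ (sub m0s) mMs m0J le)).
  by rewrite mcoeff_G eq_sym; case: ifP => // _; rewrite !mulr0 mul0r.
have E (X : mnm -> C) : \sum_(m <- Ms) (if m \in Ms then X m else 0) = \sum_(m <- Ms) X m.
  by rewrite -big_mkcond -big_seq.
rewrite E; apply: tends_ext => //; apply: uT => // v /=.
by rewrite E mulr_suml; apply: eq_bigr => m _; rewrite !mulrA.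
Qed.

Lemma tends_peval_face :
  tends U (fun v => peval (sp (t v)) (z v) / r2c (rmon (rho v) m0)) (peval G a).
Proof.
rewrite (pevalE _ Msu msupp_G); have := tends_face (fun=> 1).
under eq_bigr do rewrite mul1r; apply: tends_ext => //; apply: uT => // v /=.
by rewrite (pevalE _ Msu (@sub (t v))); under eq_bigr do rewrite mul1r.
Qed.

Lemma tends_dpeval_face i :
  tends U (fun v => z v ord0 i * dpeval (sp (t v)) i (z v) / r2c (rmon (rho v) m0))
    (a ord0 i * dpeval G i a).
Proof.
rewrite (dpevalE _ _ Msu msupp_G); have := tends_face (fun m => (expn_of m i)%:R).
apply: tends_ext => //; apply: uT => // v /=.
by rewrite (dpevalE _ _ Msu (@sub (t v))).
Qed.

Lemma euler_face : \sum_i (w i)%:R * (a ord0 i * dpeval G i a) = (wt w m0)%:R * peval G a.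
Proof.
under eq_bigr => i _ do rewrite (dpevalE _ _ Msu msupp_G) mulr_sumr.
rewrite exchange_big (pevalE _ Msu msupp_G) mulr_sumr; apply: eq_bigr => m _ /=.
rewrite mcoeff_G; case: eqP => [<-|_]; last by rewrite mul0r mulr0 big1 // => i _; rewrite mul0r mulr0.
rewrite /wt natr_sum mulr_suml; apply: eq_bigr => i _; rewrite natrM; ring.
Qed.

(** If the least weight is 0, the face function keeps exactly the monomials in the coordinates of
    weight 0, and [zlim] kills all the others. *)
Lemma face_weight0 : wt w m0 = 0%N -> peval G a = peval (sp t') zlim /\
  forall i, a ord0 i * dpeval G i a = zlim ord0 i * dpeval (sp t') i zlim.
Proof.
move=> e; split=> [|i].
  rewrite (pevalE _ Msu msupp_G) (pevalE _ Msu (@sub t')); apply: eq_bigr => m _.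
  by rewrite mcoeff_G mon_zlim e; case: eqP; rewrite ?mul0r ?mulr0.
rewrite (dpevalE _ _ Msu msupp_G) (dpevalE _ _ Msu (@sub t')); apply: eq_bigr => m _.
by rewrite mcoeff_G mon_zlim e; case: eqP; rewrite ?mul0r ?mulr0.
Qed.

(** An exponent supported on the zero weights would weigh 0, less than the minimum. This is what
    makes local tameness applicable to [Iw w]. *)
Lemma weight_gt0_in_V : (0 < wt w m0)%N -> in_V (sp t') (Iw w).
Proof.
move=> h; apply: supp_in_V => m ms; apply/negP => s.
have := m0min htau' ms; suff -> : wt w m = 0%N by rewrite leqNgt h.
rewrite /wt big1 // => i _; have [|iI] := boolP (i \in Iw w).
  by rewrite finset.inE => /eqP->.
by rewrite (supp_inP s iI) muln0.
Qed.

Lemma face_exponent_zlim : wt w m0 = 0%N -> forall i, expn_of m0 i != 0%N -> zlim ord0 i != 0.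
Proof.
move=> e i mi; case: Hasym => ha _ _ _; rewrite mxE.
have : (w i * expn_of m0 i <= wt w m0)%N by rewrite /wt (bigD1 i) //= leq_addr.
by rewrite e leqn0 muln_eq0 (negPf mi) orbF => ->; apply/eqP/ha.
Qed.

End OneFunction.
End FaceLimits.
(** * Transversality *)

Section Admissible.
Variables (R : realType) (n k0 : nat).
Local Notation C := (CC R).
Local Notation mnm := (mpoly.multinom n).
Variables (sp : 'I_k0 -> C -> mpoly.mpoly n C) (tau Rad : R) (Ms : seq mnm).
Variable U : set_system nat.
Hypothesis hU : free_ultra U.
Hypothesis tau0 : 0 < tau.
Hypothesis Ms0 : mpoly.mnm0 \in Ms.
Hypothesis Ms1 : forall i, mpoly.mnm1 i \in Ms.
Hypothesis Msu : uniq Ms.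
Hypothesis Hsub : forall k t0, {subset mpoly.msupp (sp k t0) <= Ms}.
Hypothesis Hcont : forall k m t t', tends U t t' ->
  tends U (fun v => mpoly.mcoeff m (sp k (t v))) (mpoly.mcoeff m (sp k t')).
Hypothesis Hadm : forall t : C, cnorm t < tau ->
    (forall k, newton_boundary (sp k t) = newton_boundary (sp k 0)) /\
    (forall S : {set 'I_k0}, S != finset.set0 ->
       nondegenerate_ci S (fun k => sp k t) /\
       exists Rad', Rad < Rad' /\
                    radius_local_tameness S (fun k => sp k t) Rad').

(** Limits of parameters stay in the closed disc of radius tau/2, hence in the open disc where
    admissibility is assumed. *)
Lemma half_lt_tau t : cnorm t <= tau / 2 -> cnorm t < tau.
Proof. by move=> h; apply: le_lt_trans h _; move: tau0; lra. Qed.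

Lemma NB_const k t : cnorm t < tau -> newton_boundary (sp k t) = newton_boundary (sp k 0).
Proof. by move=> h; case: (Hadm h). Qed.

Lemma asym_setup (t : nat -> C) (z : nat -> 'rV[C]_n) b :
  (forall v, cnorm (t v) <= tau / 2) -> (forall v i, cnorm (z v ord0 i) <= b) ->
  exists t' J w a rho, [/\ tends U t t', cnorm t' <= tau / 2,
    U [set v | forall i, (z v ord0 i != 0) = (i \in (J : {set 'I_n}))] & asym U z J Ms w a rho].
Proof.
move=> ht hz.
have [t' tt'] : exists t', tends U t t' by apply: (@bounded_limit _ _ hU _ (tau / 2)); exact: uT.
have [J hJ] := u_const hU (fun v => [set i | z v ord0 i != 0]%SET).
have hJ' : U [set v | forall i, (z v ord0 i != 0) = (i \in J)].
  by refine (uW hU hJ _) => v /= <- i; rewrite finset.inE.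
have hb : U [set v | forall i, cnorm (z v ord0 i) <= b] by apply: uT.
have [w [a [rho h]]] := monomial_asymptotics hU hJ' hb Ms0 Ms1.
exists t', J, w, a, rho; split => //.
by apply: (tends_cnorm_le hU tt'); apply: uT.
Qed.

Definition facecond (t' : C) (J : {set 'I_n}) (w : 'I_n -> nat) k m0 :=
  [/\ m0 \in mpoly.msupp (sp k t'), supp_in J m0 &
    forall t0, cnorm t0 < tau -> forall m, m \in mpoly.msupp (sp k t0) -> (wt w m0 <= wt w m)%N].

(** A Lagrange condition sum_k c_k df^k = mu conj(z) on the coordinate torus of z: after
    multiplication by z_i, the vanishing coordinates impose nothing. The second clause says that
    each f^k has a monomial that does not vanish at z, which [least_exponent] needs. *)
Definition tangent (t : C) (z : 'rV[C]_n) (S : {set 'I_k0}) (c : 'I_k0 -> C) (mu : C) : Prop :=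
  [/\ forall k, k \in S -> peval (sp k t) z = 0,
     forall k, k \in S -> exists2 m, m \in mpoly.msupp (sp k t) &
        forall i, expn_of m i != 0%N -> z ord0 i != 0 &
     forall i, \sum_(k in S) c k * (z ord0 i * dpeval (sp k t) i z) = r2c (normsq (z ord0 i)) * mu].

Lemma sum_neq0_ex (c : 'I_k0 -> C) (S : {set 'I_k0}) :
  \sum_(k in S) r2c (cnorm (c k)) = 1 -> exists2 k, k \in S & c k != 0.
Proof.
move=> h; apply: contrapT => hn; move: h; rewrite big1 => [/eqP|k kS].
  by rewrite eq_sym oner_eq0.
suff -> : c k = 0 by rewrite cnorm0.
by apply/eqP; apply: contrapT => /negP ck; apply: hn; exists k.
Qed.

(* The stratum of the zero set through z is transverse to the sphere: at a limit of
   tangencies the Euler identity of the face functions is contradicted. *)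
Lemma milnor_radius : exists2 eps0 : R, 0 < eps0 &
  forall t (z : 'rV[C]_n) S c mu, cnorm t <= tau / 2 -> z != 0 -> N2 z <= eps0 ^+ 2 ->
    tangent t z S c mu -> forall k, k \in S -> c k = 0.
Proof.
apply: contrapT => hneg.
have bad v : exists x : C * 'rV[C]_n * {set 'I_k0} * ('I_k0 -> C) * C,
    [/\ cnorm x.1.1.1.1 <= tau / 2, x.1.1.1.2 != 0, N2 x.1.1.1.2 <= v.+1%:R^-1 ^+ 2,
        tangent x.1.1.1.1 x.1.1.1.2 x.1.1.2 x.1.2 x.2 & exists2 k, k \in x.1.1.2 & x.1.2 k != 0].
  apply: contrapT => hv; apply: hneg; exists v.+1%:R^-1; first by rewrite invr_gt0 ltr0n.
  move=> t z S c mu h1 h2 h3 h4 k kS; apply: contrapT => /eqP ck; apply: hv.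
  by exists (t, z, S, c, mu); split => //; exists k.
have [x hx] := choice bad.
pose t v := (x v).1.1.1.1; pose z v := (x v).1.1.1.2; pose c v := (x v).1.2; pose mu v := (x v).2.
have [S hS] := u_const hU (fun v => (x v).1.1.2).
have inv1 v : v.+1%:R^-1 <= 1 :> R by rewrite invf_le1 ?ltr0n // ler1n.
have inv0 v : 0 <= v.+1%:R^-1 :> R by rewrite invr_ge0 ler0n.
have hzb v i : cnorm (z v ord0 i) <= v.+1%:R^-1.
  by apply: cnorm_le_N2 => //; case: (hx v).
have ht v : cnorm (t v) <= tau / 2 by case: (hx v).
have [t' [J [w [a [rho [tt' t'b hJ Has]]]]]] := asym_setup ht (fun v i => le_trans (hzb v i) (inv1 v)).
have [ha hrho _ hN] := Has.
have htau v : cnorm (t v) < tau := half_lt_tau (ht v).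
have htau' : cnorm t' < tau := half_lt_tau t'b.
have z0 i : tends U (fun v => z v ord0 i) 0.
  by apply: (tends_squeeze hU (@tends_inv_nat R U hU)); apply: uT => // v /=; exact: hzb.
(* The points tend to the origin whereas a_i is nonzero, so no weight is 0 and non-degeneracy will
   apply. *)
have wpos i : (0 < w i)%N.
  rewrite lt0n; apply/eqP => wi.
  have := tends_uniq hU (z0 i) (@tends_zlim _ _ _ hU _ _ _ _ _ _ Has Ms0 Ms1 i).
  by rewrite mxE wi eqxx => /esym; exact: ha.
have hm k : exists m0, k \in S -> facecond t' J w k m0.
  have [kS|kS] := boolP (k \in S); last by exists mpoly.mnm0.
  have [|m0 h0] := least_exponent hU Has (@Hsub k) (@NB_const k) htau htau'; last by exists m0.
  refine (uW hU (uI hU hS hJ) _) => v [/= eS eJ].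
  have [_ _ _ [_ h2 _] _] := hx v; have [|m ms hm] := h2 k; first by rewrite eS.
  exists m => //; apply/forallP => i; apply/implyP => iJ.
  by apply: contraNT iJ => mi; rewrite -eJ hm.
have [mm hmm] := choice hm.
pose rr v k := r2c (rmon (rho v) (mm k)).
have rr0 v k : rr v k != 0 by rewrite r2c_eq0 gt_eqF // rmon_gt0.
(* Each multiplier absorbs the scale of its function, so that the derivatives it multiplies
   converge. Dividing by the total modulus [M] then gives limiting multipliers that are not all
   zero. *)
pose c1 v k := c v k * rr v k.
pose M v := \sum_(k in S) cnorm (c1 v k).
have M0 : U [set v | 0 < M v].
  refine (uW hU hS _) => v /= eS; have [_ _ _ _ [k]] := hx v; rewrite eS => kS ck.
  rewrite /M (bigD1 k) //= ltr_wpDr ?sumr_ge0 // => [j _|]; first exact: cnorm_ge0.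
  by rewrite cnorm_gt0 mulf_neq0.
pose c2 v k := if k \in S then c1 v k / r2c (M v) else 0.
have [cs hcs] : exists cs : 'I_k0 -> C, forall k, tends U (fun v => c2 v k) (cs k).
  apply: (@bounded_limit_vec _ _ hU _ _ 1); refine (uW hU M0 _) => v /= Mv k.
  rewrite /c2; case: ifP => kS; last by rewrite cnorm0.
  rewrite cnormM cnormV cnorm_r2c (gtr0_norm Mv) ler_pdivrMr // mul1r /M (bigD1 k) //= lerDl.
  by apply: sumr_ge0 => j _; exact: cnorm_ge0.
have cs1 : \sum_(k in S) r2c (cnorm (cs k)) = 1.
  have h1 : tends U (fun v => \sum_(k in S) r2c (cnorm (c2 v k))) (\sum_(k in S) r2c (cnorm (cs k))).
    by apply: tends_sum => // k _; apply: tends_cnorm.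
  apply: (tends_uniq hU h1); apply: tends_ext (tends_cst hU 1) => //.
  refine (uW hU M0 _) => v /= Mv.
  rewrite -r2c_sum; rewrite -[LHS]r2c1; congr r2c; apply/esym.
  transitivity (M v / M v); last by rewrite divff // gt_eqF.
  rewrite {1}/M mulr_suml; apply: eq_bigr => k kS.
  by rewrite /c2 kS cnormM cnormV cnorm_r2c (gtr0_norm Mv).
have [k1 k1S ck1] := sum_neq0_ex cs1.
pose Dd k i := a ord0 i * dpeval (face_fun w (sp k t')) i a.
pose l i := \sum_(k in S) cs k * Dd k i.
have hl i : tends U (fun v => r2c (normsq (z v ord0 i)) * (mu v / r2c (M v))) (l i).
  have h1 : tends U (fun v => \sum_(k in S) c2 v k * (z v ord0 i * dpeval (sp k (t v)) i (z v) / rr v k)) (l i).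
    apply: tends_sum => // k kS; apply: tendsM => //.
    have [h1 h2 h3] := hmm k kS.
    exact: (tends_dpeval_face hU Has Msu (@Hsub k) (fun m => Hcont k m tt') htau htau' h1 h2 h3).
  apply: tends_ext h1 => //; refine (uW hU hS _) => v /= eS.
  have [_ _ _ [_ _ h2] _] := hx v; rewrite mulrA -h2 mulr_suml eS.
  apply: eq_bigr => k kS; rewrite /c2 kS /c1.
  rewrite -/(c v) -/(t v) -/(z v); have := rr0 v k.
  move: (dpeval _ _ _) (rr v k) (r2c (M v))^-1 (z v ord0 i) (c v k) => B X Y Z A hX.
  by field; rewrite hX.
have J0 : exists i, i \in J.
  have /(u_ex hU)[v hv] := hJ.
  have [_ zn0 _ _ _] := hx v; apply: contrapT => hn; case/negP: zn0; apply/eqP/rowP => i.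
  by rewrite [RHS]mxE; apply/eqP/negPn; rewrite hv; apply/negP => iJ; apply: hn; exists i.
have [i0 [kap [i0J imin lE]]] := tends_radial hU Has Ms1 J0 hl.
have face0 k : k \in S -> peval (face_fun w (sp k t')) a = 0.
  move=> kS; have [h1 h2 h3] := hmm k kS.
  have tp := tends_peval_face hU Has Msu (@Hsub k) (fun m => Hcont k m tt') htau htau' h1 h2 h3.
  apply: (tends_uniq hU tp); apply: tends_ext (tends_cst hU 0) => //.
  by refine (uW hU hS _) => v /= eS; have [_ _ _ [h4 _ _] _] := hx v; rewrite h4 ?eS // mul0r.
have euler : \sum_i (w i)%:R * l i = 0.
  transitivity (\sum_(k in S) cs k * \sum_i (w i)%:R * Dd k i).
    rewrite /l; under eq_bigr do rewrite mulr_sumr; rewrite exchange_big.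
    by apply: eq_bigr => k _; rewrite mulr_sumr; apply: eq_bigr => i _; rewrite mulrCA.
  apply: big1 => k kS; have [h1 h2 h3] := hmm k kS.
  by rewrite (euler_face a Msu (@Hsub k) htau' h1 h3) face0 // !mulr0.
(* By the Euler identity 0 = sum_i w_i l_i, which is kap times the sum of w_i |a_i|^2 over the
   coordinates of least weight, a positive number. Then the differentials of the face functions are
   dependent at [a]. *)
have kap0 : kap = 0.
  move: euler; under eq_bigr => i _ do rewrite lE mulrCA -r2c_nat -r2cM.
  rewrite -mulr_sumr -r2c_sum => /eqP; rewrite mulf_eq0 r2c_eq0 => /orP[/eqP//|].
  rewrite psumr_eq0 => [/allP/(_ i0 (mem_index_enum _))|i _]; last first.
    by rewrite mulr_ge0 ?ler0n //; case: ifP => // _; exact: normsq_ge0.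
  rewrite eqxx /= mulf_eq0 pnatr_eq0 normsq_eq0 => /orP[/eqP wi|/eqP ai].
    by have := wpos i0; rewrite wi.
  by have := ha i0; rewrite ai.
have S0 : S != finset.set0 by apply/finset.set0Pn; exists k1.
have [/(_ w wpos a ha face0 cs)nd _] := (Hadm htau').2 S S0.
move/eqP: ck1; apply; apply: nd k1S => i _.
have := lE i; rewrite kap0 mul0r /l /Dd => /eqP.
under eq_bigr do rewrite mulrCA; rewrite -mulr_sumr mulf_eq0 => /orP[/eqP ai|/eqP//].
by have := ha i; rewrite ai.
Qed.

(** Both alternatives go into the multiplier: lam = 0 describes a critical point of log f, an
    arbitrary lam on the sphere a failure of transversality. The bound [eps0 ^+ 2 < Rad] places the
    weight-zero coordinates of [a] within the radius of local tameness. *)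
Lemma no_critical eps0 : eps0 ^+ 2 < Rad ->
  (forall t (z : 'rV[C]_n) S c mu, cnorm t <= tau / 2 -> z != 0 -> N2 z <= eps0 ^+ 2 ->
    tangent t z S c mu -> forall k, k \in S -> c k = 0) ->
  forall eps, 0 < eps -> eps <= eps0 ->
  exists2 delta, 0 < delta & forall t (z : 'rV[C]_n) (lam : C), cnorm t <= tau / 2 ->
    N2 z <= eps ^+ 2 -> (forall k, peval (sp k t) z != 0) ->
    cnorm (\prod_k peval (sp k t) z) <= delta ->
    (lam = 0 \/ N2 z = eps ^+ 2) ->
    (forall i, z ord0 i * (\sum_k dpeval (sp k t) i z / peval (sp k t) z) = r2c (normsq (z ord0 i)) * lam) ->
    False.
Proof.
move=> eRad hmil eps e0 ee0; apply: contrapT => hneg.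
have bad v : exists x : C * 'rV[C]_n * C,
    [/\ cnorm x.1.1 <= tau / 2, N2 x.1.2 <= eps ^+ 2, (forall k, peval (sp k x.1.1) x.1.2 != 0),
      cnorm (\prod_k peval (sp k x.1.1) x.1.2) <= v.+1%:R^-1 &
      (x.2 = 0 \/ N2 x.1.2 = eps ^+ 2) /\
      (forall i, x.1.2 ord0 i * (\sum_k dpeval (sp k x.1.1) i x.1.2 / peval (sp k x.1.1) x.1.2)
         = r2c (normsq (x.1.2 ord0 i)) * x.2)].
  apply: contrapT => hv; apply: hneg; exists v.+1%:R^-1; first by rewrite invr_gt0 ltr0n.
  by move=> t z lam h1 h2 h3 h4 h5 h6; apply: hv; exists (t, z, lam).
have [x hx] := choice bad.
pose t v := (x v).1.1; pose z v := (x v).1.2; pose lam v := (x v).2.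
have ht v : cnorm (t v) <= tau / 2 by case: (hx v).
have hzb v i : cnorm (z v ord0 i) <= eps by apply: cnorm_le_N2 (ltW e0) _; case: (hx v).
have hp v k : peval (sp k (t v)) (z v) != 0 by case: (hx v).
have hN2 v : N2 (z v) <= eps ^+ 2 by case: (hx v).
have [t' [J [w [a [rho [tt' t'b hJ Has]]]]]] := asym_setup ht hzb.
have [ha hrho _ hN] := Has.
have htau v : cnorm (t v) < tau := half_lt_tau (ht v).
have htau' : cnorm t' < tau := half_lt_tau t'b.
pose z' := zlim w a.
have tz i : tends U (fun v => z v ord0 i) (z' ord0 i) := @tends_zlim _ _ _ hU _ _ _ _ _ _ Has Ms0 Ms1 i.
have N2z' : tends U (fun v => r2c (N2 (z v))) (r2c (N2 z')).
  rewrite /N2 r2c_sum; have h1 : tends U (fun v => \sum_i r2c (normsq (z v ord0 i))) (\sum_i r2c (normsq (z' ord0 i))).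
    by apply: tends_sum => // i _; apply: tends_normsq.
  by apply: tends_ext h1 => //; apply: uT => // v /=; rewrite r2c_sum.
have hm k : exists m0, facecond t' J w k m0.
  have [|m0 h0] := least_exponent hU Has (@Hsub k) (@NB_const k) htau htau'; last by exists m0.
  by refine (uW hU hJ _) => v /= hv; exact: peval_supp hv (hp v k).
have [mm hmm] := choice hm.
pose rr v k := r2c (rmon (rho v) (mm k)).
have rr0 v k : rr v k != 0 by rewrite r2c_eq0 gt_eqF // rmon_gt0.
pose Ph k := peval (face_fun w (sp k t')) a.
pose Dd k i := a ord0 i * dpeval (face_fun w (sp k t')) i a.
pose phi v k := peval (sp k (t v)) (z v) / rr v k.
have phi0 v k : phi v k != 0 by rewrite mulf_neq0 ?invr_eq0.
have tphi k : tends U (fun v => phi v k) (Ph k).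
  have [h1 h2 h3] := hmm k.
  exact: (tends_peval_face hU Has Msu (@Hsub k) (fun m => Hcont k m tt') htau htau' h1 h2 h3).
have tD k i : tends U (fun v => z v ord0 i * dpeval (sp k (t v)) i (z v) / rr v k) (Dd k i).
  have [h1 h2 h3] := hmm k.
  exact: (tends_dpeval_face hU Has Msu (@Hsub k) (fun m => Hcont k m tt') htau htau' h1 h2 h3).
pose S0 : {set 'I_k0} := [set k | Ph k == 0]%SET.
have S0P k : (k \in S0) = (Ph k == 0) by rewrite finset.inE.
(* The terms df^k / f^k with k in [S0] blow up relative to the others. Dividing by [M] gives their
   coefficients total modulus 1 and sends the remaining coefficients to 0. If [S0] is empty,
   everything converges already and [M] is 1. *)
pose M v := if S0 == finset.set0 then 1 else \sum_(k in S0) (cnorm (phi v k))^-1.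
have Mge v k : k \in S0 -> (cnorm (phi v k))^-1 <= M v.
  move=> kS; rewrite /M; case: eqP => [e|_]; first by rewrite e finset.inE in kS.
  by rewrite (bigD1 k) //= lerDl sumr_ge0 // => j _; rewrite invr_ge0 cnorm_ge0.
have M0 v : 0 < M v.
  have [e|/finset.set0Pn[k kS]] := eqVneq S0 finset.set0; first by rewrite /M e eqxx ltr01.
  by apply: lt_le_trans (Mge v k kS); rewrite invr_gt0 cnorm_gt0.
pose ind : C := if S0 == finset.set0 then 1 else 0.
have tM : tends U (fun v => (r2c (M v))^-1) ind.
  rewrite /ind; case: (eqVneq S0 finset.set0) => [e|/finset.set0Pn[k kS]].
    by apply: tends_ext (tends_cst hU 1) => //; apply: uT => // v /=; rewrite /M e eqxx invr1.
  have tk : tends U (fun v => r2c (cnorm (phi v k))) 0.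
    by have := tends_cnorm hU (tphi k); move: kS; rewrite S0P => /eqP->; rewrite cnorm0.
  apply: (tends_squeeze hU tk); apply: uT => // v /=.
  rewrite cnormV cnorm_r2c (gtr0_norm (M0 v)) -[leRHS]invrK lef_pV2 ?posrE ?invr_gt0 ?cnorm_gt0 //.
  exact: Mge.
pose c v k := (phi v k)^-1 / r2c (M v).
have hc k : exists l, tends U (fun v => c v k) l /\ (k \notin S0 -> l = (Ph k)^-1 * ind).
  have [kS|kS] := boolP (k \in S0).
    have [l hl] : exists l, tends U (fun v => c v k) l; last by exists l.
    apply: (@bounded_limit _ _ hU _ 1); apply: uT => // v /=.
    rewrite cnormM !cnormV cnorm_r2c (gtr0_norm (M0 v)) ler_pdivrMr ?M0 // mul1r.
    exact: Mge.
  exists ((Ph k)^-1 * ind); split => //; apply: tendsM => //; apply: tendsV => //.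
  by rewrite -S0P.
have [cs hcs] := choice hc.
have tcs k : tends U (fun v => c v k) (cs k) by case: (hcs k).
pose l i := \sum_k cs k * Dd k i.
have hl i : tends U (fun v => r2c (normsq (z v ord0 i)) * (lam v / r2c (M v))) (l i).
  have h1 : tends U (fun v => \sum_k c v k * (z v ord0 i * dpeval (sp k (t v)) i (z v) / rr v k)) (l i).
    by apply: tends_sum => // k _; apply: tendsM.
  apply: tends_ext h1 => //; apply: uT => // v /=.
  have [_ _ _ _ [_ h2]] := hx v; rewrite mulrA -h2 mulr_sumr mulr_suml.
  apply: eq_bigr => k _; rewrite /c /phi invfM invrK -/(t v) -/(z v).
  have := rr0 v k; have := hp v k.
  move: (peval _ _) (dpeval _ _ _) (rr v k) (r2c (M v))^-1 (z v ord0 i) => A B X Y Z hA hX.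
  by field; rewrite hA hX.
(* Either lam = 0 for [U]-many indices and the limit is 0, or the points lie on the sphere. Then
   |z'| = eps > 0, so some weight is 0 and the least-weight coordinates of [tends_radial] are those
   of weight 0. *)
have hB : exists kap, forall i, l i = kap * r2c (if w i == 0%N then normsq (a ord0 i) else 0).
  have [h0|/(u_not hU) h0] := pselect (U [set v | lam v = 0]).
    exists 0 => i; rewrite mul0r; apply: (tends_uniq hU (hl i)).
    apply: tends_ext (tends_cst hU 0) => //; refine (uW hU h0 _) => v /= ->.
    by rewrite mul0r mulr0.
  have eN : N2 z' = eps ^+ 2.
    apply: r2c_inj; apply: (tends_uniq hU N2z'); apply: tends_ext (tends_cst hU _) => //.
    by refine (uW hU h0 _) => v /= hv; have [_ _ _ _ [[//|->] _]] := hx v.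
  have [i1 wi1] : exists i1, w i1 = 0%N.
    apply: contrapT => hn; have : 0 < N2 z' by rewrite eN exprn_gt0.
    rewrite /N2 big1 ?ltxx // => i _; apply/eqP; rewrite normsq_eq0 mxE.
    by case: (w i =P 0%N) => // wi; case: hn; exists i.
  have [|i0 [kap [_ imin lE]]] := tends_radial hU Has Ms1 _ hl.
    by exists i1; apply: (weight0_in_J Has Ms0 Ms1).
  exists kap => i; rewrite lE; have := imin i1; rewrite wi1 leqn0 => /eqP->.
  by rewrite eq_sym.
have [kap lE] := hB.
have l0 i : (0 < w i)%N -> l i = 0 by move=> wi; rewrite lE gtn_eqF // mulr0.
have face0 k : wt w (mm k) = 0%N -> Ph k = peval (sp k t') z' /\
    (forall i, Dd k i = z' ord0 i * dpeval (sp k t') i z').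
  by have [h1 _ h3] := hmm k; apply: (face_weight0 a Msu (@Hsub k) htau' h1 h3).
have Dd0 k i : wt w (mm k) = 0%N -> (0 < w i)%N -> Dd k i = 0.
  by move=> hk wi; rewrite (face0 k hk).2 mxE gtn_eqF // mul0r.
have [e|S0n] := eqVneq S0 finset.set0.
  have csE k : cs k = (Ph k)^-1.
    by have [_ ->] := hcs k; rewrite /ind e ?eqxx ?mulr1 // finset.inE.
  have Ph0 k : Ph k != 0 by rewrite -S0P e finset.inE.
  have eul : \sum_i (w i)%:R * l i = \sum_k (wt w (mm k))%:R.
    transitivity (\sum_k cs k * \sum_i (w i)%:R * Dd k i).
      rewrite /l; under eq_bigr do rewrite mulr_sumr; rewrite exchange_big.
      by apply: eq_bigr => k _; rewrite mulr_sumr; apply: eq_bigr => i _; rewrite mulrCA.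
    apply: eq_bigr => k _; have [h1 _ h3] := hmm k.
    by rewrite (euler_face a Msu (@Hsub k) htau' h1 h3) csE -/(Ph k) mulrCA mulVf // mulr1.
  move: eul; rewrite big1 => [|i _]; last first.
    by have [->|wi] := posnP (w i); rewrite ?mul0r // l0 // mulr0.
  move/esym/eqP; rewrite -natr_sum pnatr_eq0 sum_nat_eq0 => /forallP hk.
  have tf : tends U (fun v => \prod_k peval (sp k (t v)) (z v)) (\prod_k peval (sp k t') z').
    apply: tends_prod => // k _.
    exact: (tends_peval_family hU Msu (@Hsub k) (fun m => Hcont k m tt') tz).
  have tf0 : tends U (fun v => \prod_k peval (sp k (t v)) (z v)) 0.
    by apply: (tends_squeeze hU (@tends_inv_nat R U hU)); apply: uT => // v /=; case: (hx v).
  have /eqP := tends_uniq hU tf tf0; rewrite prodf_seq_eq0 => /hasP[k _ /=].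
  by have [<- _] := face0 k (eqP (hk k)); rewrite (negPf (Ph0 k)).
have cs_out k : k \notin S0 -> cs k = 0.
  by move=> kS; have [_ ->] := hcs k; rewrite // /ind (negPf S0n) mulr0.
have [k1 k1S ck1] : exists2 k, k \in S0 & cs k != 0.
  apply: sum_neq0_ex.
  have h1 : tends U (fun v => \sum_(k in S0) r2c (cnorm (c v k))) (\sum_(k in S0) r2c (cnorm (cs k))).
    by apply: tends_sum => // k _; apply: tends_cnorm.
  apply: (tends_uniq hU h1); apply: tends_ext (tends_cst hU 1) => //.
  apply: uT => // v /=; rewrite -r2c_sum -[LHS]r2c1; congr r2c; apply/esym.
  transitivity (M v / M v); last by rewrite divff // gt_eqF.
  rewrite {1}/M (negPf S0n) mulr_suml; apply: eq_bigr => k kS.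
  by rewrite /c cnormM !cnormV cnorm_r2c (gtr0_norm (M0 v)).
have lS0 i : l i = \sum_(k in S0) cs k * Dd k i.
  rewrite /l (bigID (mem S0)) /= [X in _ + X]big1 ?addr0 // => k kS.
  by rewrite cs_out // mul0r.
have divide (S : {set 'I_k0}) i : \sum_(k in S) cs k * Dd k i = 0 ->
    \sum_(k in S) cs k * dpeval (face_fun w (sp k t')) i a = 0.
  rewrite /Dd; under eq_bigr do rewrite mulrCA.
  rewrite -mulr_sumr => /eqP; rewrite mulf_eq0 => /orP[/eqP ai|/eqP//].
  by have := ha i; rewrite ai.
have facez (S : {set 'I_k0}) : S \subset S0 -> forall k, k \in S -> peval (face_fun w (sp k t')) a = 0.
  by move=> sub k kS; have := fintype.subsetP sub k kS; rewrite S0P => /eqP.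
have [I0|I0] := eqVneq (Iw w) finset.set0.
  have wpos : positive_weight w.
    by move=> i; rewrite lt0n; apply/negP => wi; have : i \in Iw w by [rewrite finset.inE]; rewrite I0 finset.inE.
  have [nd _] := (Hadm htau').2 S0 S0n.
  move/eqP: ck1; apply; apply: (nd w wpos a ha (facez S0 (fintype.subxx _)) cs) k1S => i _.
  by apply: divide; rewrite -lS0 l0.
pose S1 : {set 'I_k0} := [set k in S0 | (0 < wt w (mm k))%N]%SET.
have S1s : S1 \subset S0 by apply/fintype.subsetP => k; rewrite finset.inE => /andP[].
have S1z : forall k, k \in S1 -> cs k = 0.
  have [->|S1n] := eqVneq S1 finset.set0; first by move=> k; rewrite finset.inE.
  have [_ [Rad' [RR [_ tame]]]] := (Hadm htau').2 S1 S1n.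
  have [k2 k2S] := finset.set0Pn _ S1n.
  have wn : nonzero_weight w.
    move: k2S; rewrite finset.inE => /andP[_]; rewrite lt0n /wt sum_nat_eq0 negb_forall => /existsP; case=> i /=.
    by rewrite muln_eq0 negb_or => /andP[/eqP wi _]; exists i.
  have inV k : k \in S1 -> in_V (sp k t') (Iw w).
    rewrite finset.inE => /andP[_ hk]; have [_ _ h3] := hmm k.
    exact: (weight_gt0_in_V htau' h3 hk).
  have su : \sum_(i in Iw w) normsq (a ord0 i) < Rad'.
    apply: le_lt_trans RR; apply: le_trans (ltW eRad).
    apply: (@le_trans _ _ (N2 z')).
      rewrite /N2 [leRHS](bigID (mem (Iw w))) /= -[leLHS]addr0; apply: lerD; last first.
        by apply: sumr_ge0 => i _; exact: normsq_ge0.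
      by apply: ler_sum => i; rewrite finset.inE mxE => ->.
    apply: (@le_trans _ _ (eps ^+ 2)); first by apply: (tends_le hU N2z'); apply: uT.
    by rewrite ler_pXn2r ?nnegrE ?(ltW e0) // (le_trans (ltW e0)).
  (* The point [a] defines its own slice. In the variables of positive weight the functions of
     weight 0 have no derivative, so the relation there involves [S1] only. *)
  have := tame (Iw w) I0 inV w wn erefl a (fun i _ => ha i) su a ha (fun i _ => erefl) (facez S1 S1s) cs.
  apply => i; rewrite finset.in_setC finset.inE => wi; apply: divide.
  rewrite -[RHS](l0 i) ?lt0n // lS0 [RHS](bigID (mem S1)) /= [X in _ + X]big1 ?addr0; last first.
    move=> k /andP[kS]; rewrite finset.inE kS /= -leqNgt leqn0 => /eqP hk.
    by rewrite Dd0 ?mulr0 // lt0n.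
  apply: eq_bigl => k; apply/idP/andP => [h|[]//]; split => //.
  exact: (fintype.subsetP S1s).
pose S2 : {set 'I_k0} := [set k in S0 | wt w (mm k) == 0%N]%SET.
have S2P k : k \in S2 -> k \in S0 /\ wt w (mm k) = 0%N by rewrite finset.inE => /andP[? /eqP].
have k1S2 : k1 \in S2.
  rewrite finset.inE k1S /=; apply: contraNT ck1 => h; apply/eqP/S1z.
  by rewrite finset.inE k1S lt0n.
have z'n : z' != 0.
  have [i iI] := finset.set0Pn _ I0; apply/eqP => /rowP/(_ i).
  by move: iI; rewrite finset.inE !mxE => -> /ha.
have N2e : N2 z' <= eps0 ^+ 2.
  apply: (@le_trans _ _ (eps ^+ 2)); first by apply: (tends_le hU N2z'); apply: uT.
  by rewrite ler_pXn2r ?nnegrE ?(ltW e0) // (le_trans (ltW e0)).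
suff tg : tangent t' z' S2 cs kap by have /eqP := hmil _ _ _ _ _ t'b z'n N2e tg k1 k1S2; rewrite (negPf ck1).
split=> [k /S2P[kS hk]|k /S2P[kS hk]|i].
- by have [<- _] := face0 k hk; apply/eqP; rewrite -S0P.
- have [h1 _ _] := hmm k; exists (mm k) => // i; exact: (face_exponent_zlim Has hk).
rewrite mulrC (_ : normsq (z' ord0 i) = if w i == 0%N then normsq (a ord0 i) else 0); last first.
  rewrite mxE; case: ifP => // _; apply/eqP; by rewrite normsq_eq0.
rewrite -lE lS0 [RHS](bigID (mem S1)) /= [X in _ = X + _]big1 ?add0r; last first.
  by move=> k /andP[_ /S1z->]; rewrite mul0r.
apply: eq_big => [k|k /S2P[kS hk]]; last by rewrite (face0 k hk).2.
by rewrite !finset.inE; case: (Ph k == 0); rewrite //= -eqn0Ngt.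
Qed.

End Admissible.
(** * Ordinary differential equations by Euler polygons *)

Section RealLimits.
Variables (R : realType) (U : set_system nat).
Hypothesis hU : free_ultra U.

Definition rtends (phi : nat -> R) (a : R) : Prop := tends U (fun v => r2c (phi v)) (r2c a).

Lemma rtends_cst a : rtends (fun=> a) a. Proof. exact: tends_cst. Qed.
Lemma rtendsD phi psi a b : rtends phi a -> rtends psi b -> rtends (fun v => phi v + psi v) (a + b).
Proof.
move=> h1 h2; rewrite /rtends r2cD; apply: tends_ext (tendsD hU h1 h2) => //.
by apply: uT => // v /=; rewrite r2cD.
Qed.
Lemma rtendsM phi psi a b : rtends phi a -> rtends psi b -> rtends (fun v => phi v * psi v) (a * b).
Proof.
move=> h1 h2; rewrite /rtends r2cM; apply: tends_ext (tendsM hU h1 h2) => //.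
by apply: uT => // v /=; rewrite r2cM.
Qed.
Lemma rtends_inv_nat : rtends (fun v => v.+1%:R^-1) 0.
Proof. exact: tends_inv_nat. Qed.
Lemma rtends_squeeze (phi psi : nat -> R) a : rtends psi 0 -> U [set v | `|phi v - a| <= psi v] -> rtends phi a.
Proof.
move=> h hb; have : tends U (fun v => r2c (phi v - a)) 0.
  by apply: (tends_squeeze hU h); refine (uW hU hb _) => v /=; rewrite cnorm_r2c.
move=> h'; have := tendsD hU h' (tends_cst hU (r2c a)); rewrite add0r.
by apply: tends_ext => //; apply: uT => // v /=; rewrite -r2cD subrK.
Qed.
Lemma rtends_le phi a b : rtends phi a -> U [set v | phi v <= b] -> a <= b.
Proof. exact: tends_le. Qed.
Lemma rtends_ge phi a b : rtends phi a -> U [set v | b <= phi v] -> b <= a.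
Proof. exact: tends_ge. Qed.

(** Cut the interval into N equal steps of length h <= 1/N. Iteration gives (1 + L h)^N (e s0 + N K
    h^2), at most e^L (e s0 + K / N), and the quadratic defect disappears as N grows. *)
Lemma discrete_gronwall (e : R -> R) (L K h0 s0 s1 : R) : 0 <= L -> 0 <= K -> 0 < h0 ->
  s0 <= s1 -> s1 - s0 <= 1 -> 0 <= e s0 ->
  (forall s h, s0 <= s -> 0 <= h -> h <= h0 -> s + h <= s1 -> e (s + h) <= (1 + L * h) * e s + K * h ^+ 2) ->
  e s1 <= expR L * e s0.
Proof.
move=> L0 K0 hh0 s01 s1b es0 step.
have : rtends (fun v => expR L * (e s0 + K * v.+1%:R^-1)) (expR L * (e s0 + K * 0)).
  apply: rtendsM; first exact: rtends_cst.
  apply: rtendsD; first exact: rtends_cst.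
  by apply: rtendsM; [exact: rtends_cst|exact: rtends_inv_nat].
rewrite mulr0 addr0 => /rtends_ge; apply.
have hsmall := rtends_inv_nat hh0.
refine (uW hU hsmall _) => v /=; rewrite subr0 cnorm_r2c.
have N0 : 0 < v.+1%:R :> R by rewrite ltr0n.
rewrite gtr0_norm ?invr_gt0 // => hv.
pose h := (s1 - s0) / v.+1%:R.
have h_ge0 : 0 <= h by rewrite divr_ge0 ?subr_ge0 // ltW.
have h_le : h <= v.+1%:R^-1 by rewrite /h ler_piMl // invr_ge0 ltW.
have main j : (j <= v.+1)%N -> e (s0 + j%:R * h) <= (1 + L * h) ^+ j * (e s0 + j%:R * (K * h ^+ 2)).
  elim: j => [_|j IH jv]; first by rewrite expr0 mul0r !addr0 mul1r mul0r addr0.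
  have := step (s0 + j%:R * h) h _ h_ge0 (le_trans h_le (ltW hv)) _.
  have e1 : s0 + j.+1%:R * h = s0 + j%:R * h + h by rewrite -natr1; ring.
  rewrite e1 => hs; apply: le_trans (hs _ _) _.
  - by rewrite lerDl mulr_ge0.
  - rewrite -e1; have : j.+1%:R * h <= v.+1%:R * h by rewrite ler_wpM2r // ler_nat.
    by rewrite [v.+1%:R * h]mulrC divfK ?gt_eqF //; lra.
  have p1 : 1 <= 1 + L * h by rewrite lerDl mulr_ge0.
  have p2 : 1 <= (1 + L * h) ^+ j.+1 by apply: exprn_ege1.
  have IH' := IH (ltnW jv).
  have q0 : 0 <= K * h ^+ 2 by rewrite mulr_ge0 ?sqr_ge0.
  apply: (@le_trans _ _ ((1 + L * h) ^+ j.+1 * (e s0 + j%:R * (K * h ^+ 2)) + (1 + L * h) ^+ j.+1 * (K * h ^+ 2))).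
    apply: lerD; last by rewrite ler_peMl.
    by rewrite exprS -mulrA; apply: ler_wpM2l IH'; lra.
  by rewrite -mulrDr -addrA -natr1 mulrDl mul1r.
have := main v.+1 (leqnn _).
have -> : s0 + v.+1%:R * h = s1 by rewrite mulrC divfK ?gt_eqF // addrC subrK.
move/le_trans; apply.
have q1 : (1 + L * h) ^+ v.+1 <= expR L.
  apply: (@le_trans _ _ (expR (L * h) ^+ v.+1)).
    by rewrite lerXn2r ?nnegrE ?expR_ge0 ?expR_ge1Dx // addr_ge0 // mulr_ge0.
  rewrite -expRM_natl ler_expR mulrC -mulrA ler_piMr //.
  by rewrite divfK ?gt_eqF.
have q2 : v.+1%:R * (K * h ^+ 2) <= K * v.+1%:R^-1.
  have -> : v.+1%:R * (K * h ^+ 2) = K * ((v.+1%:R * h) * h) by rewrite expr2; ring.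
  apply: ler_wpM2l => //; rewrite [v.+1%:R * h]mulrC divfK ?gt_eqF //.
  by apply: le_trans (ler_piMl h_ge0 s1b) h_le.
apply: ler_pM => //.
- by apply: exprn_ge0; rewrite addr_ge0 // mulr_ge0.
- by rewrite addr_ge0 // mulr_ge0 ?ler0n // mulr_ge0 ?sqr_ge0.
- by rewrite lerD2l.
Qed.
End RealLimits.

Section Flows.
Variables (R : realType) (n : nat) (U : set_system nat).
Hypothesis hU : free_ultra U.
Local Notation C := (CC R).
Local Notation vec := ('rV[C]_n).

Definition zn (z : vec) : R := \sum_i cnorm (z ord0 i).

Lemma zn_ge0 z : 0 <= zn z. Proof. by apply: sumr_ge0 => i _; exact: cnorm_ge0. Qed.
Lemma znD x y : zn (x + y) <= zn x + zn y.
Proof. by rewrite -big_split; apply: ler_sum => i _; rewrite mxE cnormD. Qed.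
Lemma znN x : zn (- x) = zn x.
Proof. by apply: eq_bigr => i _; rewrite mxE cnormN. Qed.
Lemma zn_distC x y : zn (x - y) = zn (y - x).
Proof. by rewrite -znN opprB. Qed.
Lemma zn0 : zn 0 = 0.
Proof. by apply: big1 => i _; rewrite mxE cnorm0. Qed.
Lemma zn_eq0 z : zn z = 0 -> z = 0.
Proof.
move=> /eqP; rewrite psumr_eq0 => [/allP h|i _]; last exact: cnorm_ge0.
apply/rowP => i; rewrite mxE; apply/eqP; rewrite -cnorm_eq0.
exact: (h i (mem_index_enum i)).
Qed.
Lemma znZ (a : R) z : zn (r2c a *: z) = `|a| * zn z.
Proof. by rewrite /zn mulr_sumr; apply: eq_bigr => i _; rewrite mxE cnormM cnorm_r2c. Qed.
Lemma cnorm_le_zn (z : vec) i : cnorm (z ord0 i) <= zn z.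
Proof. by rewrite /zn (bigD1 i) //= lerDl sumr_ge0 // => j _; exact: cnorm_ge0. Qed.
Lemma tends_zn (Y : nat -> vec) (y : vec) : (forall i, tends U (fun v => Y v ord0 i) (y ord0 i)) ->
  rtends U (fun v => zn (Y v - y)) 0.
Proof.
move=> h; have : tends U (fun v => \sum_i r2c (cnorm (Y v ord0 i - y ord0 i))) (\sum_(i < n) 0).
  apply: tends_sum => // i _; have := tendsB hU (h i) (tends_cst hU (y ord0 i)).
  by rewrite subrr => /(tends_cnorm hU); rewrite cnorm0.
rewrite big1 //; apply: tends_ext => //; apply: uT => // v /=.
by rewrite -r2c_sum; congr r2c; apply: eq_bigr => i _; rewrite !mxE.
Qed.

(* A solution is encoded by a uniform second order error, so that neither
   derivatives nor integrals are needed. *)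
Definition solves (V : R -> vec -> vec) (y : R -> vec) (K : R) : Prop :=
  forall s h, 0 <= s -> 0 <= h -> s + h <= 1 ->
    zn (y (s + h) - y s - r2c h *: V s (y s)) <= K * h ^+ 2.

Definition bounded_lipschitz (V : R -> vec -> vec) (M L : R) : Prop :=
  [/\ 0 <= M, 0 <= L, forall s y, 0 <= s <= 1 -> zn (V s y) <= M &
   forall s s' y y', 0 <= s <= 1 -> 0 <= s' <= 1 ->
     zn (V s y - V s' y') <= L * (`|s - s'| + zn (y - y'))].

Variables (V : R -> vec -> vec) (M L : R).
Hypothesis HV : bounded_lipschitz V M L.

Lemma solution_lipschitz y K s h : 0 <= K -> solves V y K -> 0 <= s -> 0 <= h -> s + h <= 1 ->
  zn (y (s + h) - y s) <= (M + K) * h.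
Proof.
move=> K0 hy s0 h0 sh; have [M0 L0 hM _] := HV.
have h1 := hy s h s0 h0 sh; have := znD (y (s + h) - y s - r2c h *: V s (y s)) (r2c h *: V s (y s)).
rewrite subrK znZ (ger0_norm h0).
have hs : 0 <= s <= 1 by apply/andP; split => //; lra.
have : h * zn (V s (y s)) <= h * M by apply: ler_wpM2l => //; apply: hM.
have : K * h ^+ 2 <= K * h by apply: ler_wpM2l => //; rewrite expr2 ler_piMr //; lra.
lra.
Qed.

(** Subtracting the two expansions leaves a Lipschitz term and a quadratic defect. The estimate
    serves both for uniqueness and for continuity in the initial point. *)
Lemma solutions_contract y1 y2 K1 K2 s : 0 <= K1 -> 0 <= K2 -> solves V y1 K1 -> solves V y2 K2 ->
  0 <= s <= 1 -> zn (y1 s - y2 s) <= expR L * zn (y1 0 - y2 0).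
Proof.
move=> K10 K20 h1 h2 /andP[s0 s1]; have [M0 L0 _ hL] := HV.
apply: (@discrete_gronwall _ _ hU (fun s => zn (y1 s - y2 s)) L (K1 + K2) 1 0 s) => //;
  rewrite ?addr_ge0 ?ltr01 ?subr0 ?zn_ge0 //.
move=> u h u0 hh _ uh.
have uh1 : u + h <= 1 by apply: le_trans s1.
have a1 := h1 u h u0 hh uh1; have a2 := h2 u h u0 hh uh1.
have u01 : 0 <= u <= 1 by rewrite u0 (le_trans _ uh1) // lerDl.
have a3 := hL u u (y1 u) (y2 u) u01 u01; rewrite subrr normr0 add0r in a3.
have e : y1 (u + h) - y2 (u + h) = ((y1 (u + h) - y1 u - r2c h *: V u (y1 u)) -
   (y2 (u + h) - y2 u - r2c h *: V u (y2 u))) + ((y1 u - y2 u) + r2c h *: (V u (y1 u) - V u (y2 u))).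
  by apply/rowP => i; rewrite !mxE; ring.
rewrite e; apply: le_trans (znD _ _) _.
have b1 := znD (y1 (u + h) - y1 u - r2c h *: V u (y1 u)) (- (y2 (u + h) - y2 u - r2c h *: V u (y2 u))).
rewrite znN in b1.
have b2 := znD (y1 u - y2 u) (r2c h *: (V u (y1 u) - V u (y2 u))); rewrite znZ (ger0_norm hh) in b2.
have b3 : h * zn (V u (y1 u) - V u (y2 u)) <= h * (L * zn (y1 u - y2 u)) by apply: ler_wpM2l.
rewrite addrC; apply: lerD.
  apply: le_trans b2 _; rewrite mulrDl mul1r lerD2l; apply: le_trans b3 _.
  by rewrite mulrCA mulrA.
by apply: le_trans b1 _; rewrite mulrDl; apply: lerD.
Qed.

Fixpoint euler_path (x : vec) (N j : nat) : vec :=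
  if j is j'.+1 then euler_path x N j' + r2c N%:R^-1 *: V (j'%:R / N%:R) (euler_path x N j') else x.

(** During time m/N the polygon moves by at most M m/N, so the field changes by at most L (1 + M)
    m/N. The resulting quadratic error does not involve N and survives the limit. *)
Lemma euler_bounds x N j m : (0 < N)%N -> (j + m <= N)%N ->
  zn (euler_path x N (j + m) - euler_path x N j) <= M * (m%:R / N%:R) /\
  zn (euler_path x N (j + m) - euler_path x N j - r2c (m%:R / N%:R) *: V (j%:R / N%:R) (euler_path x N j))
    <= L * (1 + M) * (m%:R / N%:R) ^+ 2.
Proof.
move=> N0; have [M0 L0 hM hL] := HV.
have NR : 0 < N%:R :> R by rewrite ltr0n.
have fr k : (k <= N)%N -> 0 <= (k%:R / N%:R : R) <= 1.
  by move=> kN; apply/andP; split; [apply: divr_ge0|rewrite ler_pdivrMr // mul1r ler_nat].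
elim: m => [|m IH] jm.
  by rewrite addn0 mul0r subrr zn0 mulr0 sub0r znN znZ normr0 mul0r expr0n mulr0.
have jm' : (j + m <= N)%N by apply: leq_trans jm; rewrite leq_add2l.
have [IH1 IH2] := IH jm'; rewrite addnS /=.
set Y := euler_path x N (j + m) in IH1 IH2 *; set X := euler_path x N j in IH1 IH2 *.
have jN : (j <= N)%N by apply: leq_trans jm'; rewrite leq_addr.
have i0 : 0 <= N%:R^-1 :> R by rewrite invr_ge0 ltW.
have mS : m.+1%:R / N%:R = m%:R / N%:R + N%:R^-1 :> R by rewrite -natr1 mulrDl mul1r.
have d0 : 0 <= m%:R / N%:R :> R by rewrite divr_ge0 ?ler0n ?ltW.
split.
  have -> : Y + r2c N%:R^-1 *: V ((j + m)%:R / N%:R) Y - X = (Y - X) + r2c N%:R^-1 *: V ((j + m)%:R / N%:R) Y.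
    by rewrite addrAC.
  apply: le_trans (znD _ _) _; rewrite znZ ger0_norm // mS mulrDr.
  apply: lerD => //; rewrite mulrC; apply: ler_wpM2r => //; exact/hM/fr.
have -> : Y + r2c N%:R^-1 *: V ((j + m)%:R / N%:R) Y - X - r2c (m.+1%:R / N%:R) *: V (j%:R / N%:R) X =
  (Y - X - r2c (m%:R / N%:R) *: V (j%:R / N%:R) X) + r2c N%:R^-1 *: (V ((j + m)%:R / N%:R) Y - V (j%:R / N%:R) X).
  by rewrite mS r2cD; apply/rowP => i; rewrite !mxE; ring.
apply: le_trans (znD _ _) _; rewrite znZ ger0_norm //.
have := hL _ _ Y X (fr _ jm') (fr _ jN).
have -> : (j + m)%:R / N%:R - j%:R / N%:R = m%:R / N%:R :> R by rewrite natrD mulrDl addrAC subrr add0r.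
rewrite (ger0_norm d0) => h.
have h1 : zn (V ((j + m)%:R / N%:R) Y - V (j%:R / N%:R) X) <= L * (1 + M) * (m%:R / N%:R).
  apply: le_trans h _; rewrite -mulrA; apply: ler_wpM2l => //; rewrite mulrDl mul1r; lra.
have h2 : N%:R^-1 * zn (V ((j + m)%:R / N%:R) Y - V (j%:R / N%:R) X) <= N%:R^-1 * (L * (1 + M) * (m%:R / N%:R)).
  exact: ler_wpM2l.
have K0 : 0 <= L * (1 + M) by rewrite mulr_ge0 // addr_ge0.
apply: le_trans (lerD IH2 h2) _; rewrite mS.
move: K0 d0 i0; move: (N%:R^-1) (m%:R / N%:R) (L * (1 + M)) => i d K K0 d0 i0.
have -> : K * (d + i) ^+ 2 = K * d ^+ 2 + i * (K * d) + (K * (d * i) + K * (i * i)) by ring.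
by rewrite lerDl addr_ge0 // !mulr_ge0.
Qed.

(** For each s the solution is the limit along [U] of the polygons with v+1 steps, read at the last
    node before s. The bounds of [euler_bounds] pass to this pointwise limit. *)
Theorem solution_exists x : exists y, y 0 = x /\ solves V y (L * (1 + M)).
Proof.
have [M0 L0 hM hL] := HV.
pose fl v (s : R) := Num.truncn (s * v.+1%:R).
have flP v (s : R) : 0 <= s -> (fl v s)%:R / v.+1%:R <= s /\ s - v.+1%:R^-1 <= (fl v s)%:R / v.+1%:R.
  move=> s0; have N0 : 0 < v.+1%:R :> R by rewrite ltr0n.
  have p : 0 <= s * v.+1%:R by rewrite mulr_ge0 // ltW.
  have /andP[h1 h2] := truncn_itv p; rewrite ler_pdivrMr // h1; split => //.
  rewrite ler_pdivlMr // mulrBl mulVf ?gt_eqF //.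
  by move: h2; rewrite -/(fl v s) -natr1; lra.
have flN v (s : R) : 0 <= s <= 1 -> (fl v s <= v.+1)%N.
  move=> /andP[s0 s1]; have [h _] := flP v s s0.
  have N0 : 0 < v.+1%:R :> R by rewrite ltr0n.
  rewrite -(ler_nat R); move: h; rewrite ler_pdivrMr // => /le_trans; apply.
  by rewrite -[leRHS]mul1r ler_wpM2r // ltW.
have fl_mono v (s h : R) : 0 <= s -> 0 <= h -> (fl v s <= fl v (s + h)%R)%N.
  by move=> s0 h0; apply: le_truncn; rewrite ler_wpM2r ?ler0n // lerDl.
pose Y v s := euler_path x v.+1 (fl v s).
have tfl s : 0 <= s -> rtends U (fun v => (fl v s)%:R / v.+1%:R) s.
  move=> s0; apply: (@rtends_squeeze _ _ hU _ (fun v => v.+1%:R^-1)); first exact: rtends_inv_nat.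
  apply: uT => // v /=.
  have i0 : 0 <= v.+1%:R^-1 :> R by rewrite invr_ge0.
  have [h1 h2] := flP v s s0; rewrite ler_norml.
  move: h1 h2 i0; move: (v.+1%:R^-1) ((fl v s)%:R / v.+1%:R) => B A h1 h2 i0.
  by apply/andP; split; lra.
have ex s : exists y : vec, 0 <= s <= 1 -> forall i, tends U (fun v => Y v s ord0 i) (y ord0 i).
  have [s01|] := boolP (0 <= s <= 1); last by exists 0.
  have [] := @bounded_limit_vec _ _ hU _ (fun v i => Y v s ord0 i) (zn x + M).
    apply: uT => // v i; apply: le_trans (cnorm_le_zn _ _) _.
    have [] := @euler_bounds x v.+1 0 (fl v s) isT; first exact: flN.
    rewrite add0n /= -/(Y v s) => h _; have := znD (Y v s - x) x; rewrite subrK.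
    move/le_trans; apply; rewrite addrC lerD2l; apply: le_trans h _.
    rewrite -[leRHS]mulr1; apply: ler_wpM2l => //.
    by rewrite ler_pdivrMr ?ltr0n // mul1r ler_nat; exact: flN.
  by move=> l hl; exists (\row_i l i) => _ i; rewrite mxE.
have [y hy] := choice ex.
exists y; split.
  apply/rowP => i; have h := hy 0 _ i; apply: (tends_uniq hU (h _)); first by rewrite lexx ler01.
  apply: tends_ext (tends_cst hU _) => //; apply: uT => // v /=.
  by rewrite /Y /fl mul0r truncn0.
move=> s h s0 h0 sh.
have s01 : 0 <= s <= 1 by apply/andP; split => //; lra.
have sh01 : 0 <= s + h <= 1 by apply/andP; split => //; lra.
have t1 := tends_zn (hy s s01); have t2 := tends_zn (hy _ sh01).
pose d v : R := (fl v (s + h))%:R / v.+1%:R - (fl v s)%:R / v.+1%:R.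
have td : rtends U d h.
  have := rtendsD hU (tfl (s + h) (addr_ge0 s0 h0)) (rtendsM hU (rtends_cst hU (-1)) (tfl s s0)).
  rewrite mulN1r addrAC subrr add0r; apply: tends_ext => //; apply: uT => // v /=.
  by rewrite mulN1r.
have tdh : rtends U (fun v => `|d v - h|) 0.
  have : tends U (fun v => r2c (d v) - r2c h) 0.
    by rewrite -(subrr (r2c h)); apply: tendsB td (tends_cst hU _).
  move=> /(tends_cnorm hU); rewrite cnorm0; apply: tends_ext => //; apply: uT => // v /=.
  by rewrite -r2cN -r2cD cnorm_r2c.
have tfs : rtends U (fun v => `|(fl v s)%:R / v.+1%:R - s|) 0.
  have : tends U (fun v => r2c ((fl v s)%:R / v.+1%:R) - r2c s) 0.
    by rewrite -(subrr (r2c s)); apply: tendsB (tfl s s0) (tends_cst hU _).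
  move=> /(tends_cnorm hU); rewrite cnorm0; apply: tends_ext => //; apply: uT => // v /=.
  by rewrite -r2cN -r2cD cnorm_r2c.
have tB : rtends U (fun v => L * (1 + M) * (d v * d v) + (zn (Y v (s + h) - y (s + h)) + (zn (Y v s - y s) +
    (M * `|d v - h| + h * (L * (`|(fl v s)%:R / v.+1%:R - s| + zn (Y v s - y s)))))))
  (L * (1 + M) * (h * h) + (0 + (0 + (M * 0 + h * (L * (0 + 0)))))).
  have c := rtends_cst hU.
  apply: (rtendsD hU); first by apply: (rtendsM hU) => //; exact: (rtendsM hU).
  apply: (rtendsD hU) => //; apply: (rtendsD hU) => //.
  apply: (rtendsD hU); first exact: (rtendsM hU).
  by apply: (rtendsM hU) => //; apply: (rtendsM hU) => //; exact: (rtendsD hU).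
rewrite !(mulr0, addr0) -expr2 in tB.
apply: (rtends_ge hU tB); apply: uT => // v /=.
have [m em] : exists m, fl v (s + h) = (fl v s + m)%N.
  by exists (fl v (s + h)%R - fl v s)%N; rewrite subnKC // fl_mono.
have [|_] := @euler_bounds x v.+1 (fl v s) m isT; first by rewrite -em; exact: flN.
rewrite -em -/(Y v s) -/(Y v (s + h)).
have -> : m%:R / v.+1%:R = d v by rewrite /d em natrD mulrDl addrAC subrr add0r.
set V' := V _ (Y v s) => hE.
have e : y (s + h) - y s - r2c h *: V s (y s) = (Y v (s + h) - Y v s - r2c (d v) *: V')
   + (- (Y v (s + h) - y (s + h)) + ((Y v s - y s) + (r2c (d v - h) *: V' + r2c h *: (V' - V s (y s))))).
  by rewrite r2cD r2cN; apply/rowP => i; rewrite !mxE; ring.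
rewrite e; apply: le_trans (znD _ _) _; apply: lerD; first by rewrite -expr2.
apply: le_trans (znD _ _) _; rewrite znN; apply: lerD => //.
apply: le_trans (znD _ _) _; apply: lerD => //.
have fs01 : 0 <= ((fl v s)%:R / v.+1%:R : R) <= 1.
  by apply/andP; split; [apply: divr_ge0|rewrite ler_pdivrMr ?ltr0n // mul1r ler_nat flN].
apply: le_trans (znD _ _) _; rewrite !znZ; apply: lerD.
  by rewrite mulrC; apply: ler_wpM2r => //; exact: hM.
by rewrite (ger0_norm h0); apply: ler_wpM2l => //; exact: hL.
Qed.

End Flows.
(** * Lipschitz functions and first order expansions *)

Section BoxCalculus.
Variables (R : realType) (n : nat) (B : R).
Local Notation C := (CC R).
Local Notation vec := ('rV[C]_n).
Implicit Types (phi psi : R -> vec -> C).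

Definition inbox (s : R) (z : vec) : Prop := 0 <= s <= 1 /\ forall i, cnorm (z ord0 i) <= B.
Definition pdist (s s' : R) (z z' : vec) : R := `|s - s'| + zn (z - z').

Lemma pdist_ge0 s s' z z' : 0 <= pdist s s' z z'.
Proof. by rewrite addr_ge0 ?zn_ge0. Qed.
Lemma pdistC s s' z z' : pdist s s' z z' = pdist s' s z' z.
Proof. by rewrite /pdist distrC zn_distC. Qed.
Hint Resolve pdist_ge0 : core.

Definition BL phi : Prop := exists M L, [/\ 0 <= M, 0 <= L,
  forall s z, inbox s z -> cnorm (phi s z) <= M &
  forall s s' z z', inbox s z -> inbox s' z' ->
    cnorm (phi s z - phi s' z') <= L * pdist s s' z z'].

Lemma BL_ext phi psi : (forall s z, phi s z = psi s z) -> BL phi -> BL psi.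
Proof.
move=> e [M [L [M0 L0 h1 h2]]]; exists M, L; split => // [s z|s s' z z']; rewrite -!e.
  exact: h1.
exact: h2.
Qed.
Lemma BL_cst c : BL (fun _ _ => c).
Proof.
exists (cnorm c), 0; split => //; first exact: cnorm_ge0.
by move=> *; rewrite subrr cnorm0 mul0r.
Qed.
Lemma BL_coord i : BL (fun _ z => z ord0 i).
Proof.
exists `|B|, 1; split => // [s z [_ h]|s s' z z' _ _].
  exact: le_trans (h i) (ler_norm _).
rewrite mul1r; apply: le_trans (lerD (normr_ge0 (s - s')) (lexx _)); rewrite add0r.
by have := cnorm_le_zn (z - z') i; rewrite !mxE.
Qed.
Lemma BL_time : BL (fun s _ => r2c s).
Proof.
exists 1, 1; split => // [s z [/andP[s0 s1] _]|s s' z z' _ _].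
  by rewrite cnorm_r2c ger0_norm.
by rewrite -r2cN -r2cD cnorm_r2c mul1r lerDl zn_ge0.
Qed.
Lemma BL_add phi psi : BL phi -> BL psi -> BL (fun s z => phi s z + psi s z).
Proof.
move=> [M [L [M0 L0 h1 h2]]] [M' [L' [M0' L0' h1' h2']]]; exists (M + M'), (L + L').
split => [||s z b|s s' z z' b b']; [exact: addr_ge0|exact: addr_ge0| |].
  by apply: le_trans (cnormD _ _) (lerD (h1 _ _ b) (h1' _ _ b)).
rewrite opprD addrACA mulrDl.
by apply: le_trans (cnormD _ _) (lerD (h2 _ _ _ _ b b') (h2' _ _ _ _ b b')).
Qed.
Lemma BL_mul phi psi : BL phi -> BL psi -> BL (fun s z => phi s z * psi s z).
Proof.
move=> [M [L [M0 L0 h1 h2]]] [M' [L' [M0' L0' h1' h2']]]; exists (M * M'), (L * M' + M * L').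
split => [||s z b|s s' z z' b b']; [exact: mulr_ge0|by rewrite addr_ge0 ?mulr_ge0| |].
  by rewrite cnormM ler_pM ?cnorm_ge0 // ?h1 ?h1'.
have -> : phi s z * psi s z - phi s' z' * psi s' z' =
  (phi s z - phi s' z') * psi s z + phi s' z' * (psi s z - psi s' z') by ring.
apply: le_trans (cnormD _ _) _; rewrite !cnormM mulrDl; apply: lerD.
  by rewrite mulrAC ler_pM ?cnorm_ge0 ?h2 ?h1'.
by rewrite -mulrA ler_pM ?cnorm_ge0 ?h2' ?h1.
Qed.
Lemma BL_conj phi : BL phi -> BL (fun s z => cconj (phi s z)).
Proof.
move=> [M [L [M0 L0 h1 h2]]]; exists M, L; split => // [s z b|s s' z z' b b'].
  by rewrite cnorm_conj h1.
by rewrite -cconjN -cconjD cnorm_conj h2.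
Qed.
Lemma BL_opp phi : BL phi -> BL (fun s z => - phi s z).
Proof.
by move=> h; apply: BL_ext (BL_mul (BL_cst (-1)) h) => s z; rewrite mulN1r.
Qed.
Lemma BL_sub phi psi : BL phi -> BL psi -> BL (fun s z => phi s z - psi s z).
Proof. by move=> h h'; apply: BL_add h (BL_opp h'). Qed.
Lemma BL_sum (I : Type) (r : seq I) (P : pred I) (F : I -> R -> vec -> C) : (forall i, BL (F i)) ->
  BL (fun s z => \sum_(i <- r | P i) F i s z).
Proof.
move=> h; elim: r => [|i r IH].
  by apply: BL_ext (BL_cst 0) => s z; rewrite big_nil.
case e : (P i); last by apply: BL_ext IH => s z; rewrite big_cons e.
by apply: BL_ext (BL_add (h i) IH) => s z; rewrite big_cons e.
Qed.
Lemma BL_re phi : BL phi -> BL (fun s z => r2c (cre (phi s z))).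
Proof.
move=> h; apply: BL_ext (BL_mul (BL_add h (BL_conj h)) (BL_cst (2%:R^-1))) => s z.
by rewrite cre_def.
Qed.
(** Truncation from below at [c] makes the inverse Lipschitz, since |1/a - 1/a'| = |a - a'| / (a a')
    and both denominators are at least [c]. *)
Lemma BL_trunc_inv c phi : 0 < c -> BL phi -> BL (fun s z => r2c (Num.max (cre (phi s z)) c)^-1).
Proof.
move=> c0 [M [L [M0 L0 h1 h2]]]; exists c^-1, (L / c ^+ 2).
have mp s z : 0 < Num.max (cre (phi s z)) c by rewrite lt_max c0 orbT.
have mc s z : c <= Num.max (cre (phi s z)) c by rewrite le_max lexx orbT.
split => [||s z b|s s' z z' b b']; [by rewrite invr_ge0 ltW|by rewrite divr_ge0 // exprn_ge0 // ltW| |].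
  by rewrite cnorm_r2c gtr0_norm ?invr_gt0 // lef_pV2 ?posrE.
rewrite -r2cN -r2cD cnorm_r2c.
set a := Num.max _ c; set a' := Num.max _ c.
have a0 : 0 < a by exact: mp. have a'0 : 0 < a' by exact: mp.
have -> : a^-1 - a'^-1 = (a' - a) * (a^-1 * a'^-1) by field; rewrite !gt_eqF.
rewrite normrM mulrAC; apply: ler_pM => //; last first.
  rewrite gtr0_norm ?mulr_gt0 ?invr_gt0 // -exprVn expr2.
  by apply: ler_pM; rewrite ?invr_ge0 ?(ltW a0) ?(ltW a'0) // lef_pV2 ?posrE // ?mc.
apply: le_trans (h2 _ _ _ _ b b'); rewrite cnorm_distC.
apply: le_trans (cre_le _); rewrite creD creN /a /a'.
move: (cre _) (cre _) => u w; case: (lerP u c); case: (lerP w c) => h3 h4.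
- by rewrite subrr normr0.
- by rewrite ler_norml; apply/andP; split; have := ler_norm (w - u); have := ler_norm (u - w); have := distrC u w; lra.
- by rewrite ler_norml; apply/andP; split; have := ler_norm (w - u); have := ler_norm (u - w); have := distrC u w; lra.
by rewrite distrC.
Qed.

Definition taylor phi (phis : R -> vec -> C) (phiz : 'I_n -> R -> vec -> C) (s s' : R) (z z' : vec) : C :=
  phi s' z' - phi s z - (phis s z * r2c (s' - s) + \sum_i phiz i s z * (z' ord0 i - z ord0 i)).

(** A quantitative form of twice differentiability, stable under sums and products. Only z' - z
    occurs, not its conjugate, so [phi] is holomorphic in z. *)
Definition C2 phi phis phiz : Prop :=
  [/\ BL phi, BL phis, forall i, BL (phiz i) & exists2 K, 0 <= K &
     forall s s' z z', inbox s z -> inbox s' z' ->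
       cnorm (taylor phi phis phiz s s' z z') <= K * pdist s s' z z' ^+ 2].

Lemma C2_eq phi phis phiz psi psis psiz : C2 phi phis phiz -> (forall s z, phi s z = psi s z) ->
  (forall s z, phis s z = psis s z) -> (forall i s z, phiz i s z = psiz i s z) -> C2 psi psis psiz.
Proof.
move=> [h1 h2 h3 [K K0 h4]] e1 e2 e3; split; [exact: BL_ext h1|exact: BL_ext h2|by move=> i; apply: BL_ext (h3 i)|].
exists K => // s s' z z' b b'; have := h4 s s' z z' b b'.
by rewrite /taylor !e1 e2; under eq_bigr do rewrite e3.
Qed.

Lemma C2_cst c : C2 (fun _ _ => c) (fun _ _ => 0) (fun _ _ _ => 0).
Proof.
split; [exact: BL_cst|exact: BL_cst|by move=> i; exact: BL_cst|].
exists 0 => // s s' z z' _ _; rewrite /taylor subrr mul0r big1 => [|i _]; last by rewrite mul0r.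
by rewrite addr0 subrr cnorm0 mul0r.
Qed.
Lemma C2_coord j : C2 (fun _ z => z ord0 j) (fun _ _ => 0) (fun i _ _ => (i == j)%:R).
Proof.
split; [exact: BL_coord|exact: BL_cst|by move=> i; exact: BL_cst|].
exists 0 => // s s' z z' _ _; rewrite /taylor mul0r (bigD1 j) //= big1 => [|i /negPf->]; last by rewrite mul0r.
by rewrite eqxx mul1r addr0 add0r subrr cnorm0 mul0r.
Qed.
Lemma C2_time : C2 (fun s _ => r2c s) (fun _ _ => 1) (fun _ _ _ => 0).
Proof.
split; [exact: BL_time|exact: BL_cst|by move=> i; exact: BL_cst|].
exists 0 => // s s' z z' _ _; rewrite /taylor big1 => [|i _]; last by rewrite mul0r.
by rewrite mul1r addr0 r2cD r2cN subrr cnorm0 mul0r.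
Qed.
Lemma C2_add phi phis phiz psi psis psiz : C2 phi phis phiz -> C2 psi psis psiz ->
  C2 (fun s z => phi s z + psi s z) (fun s z => phis s z + psis s z) (fun i s z => phiz i s z + psiz i s z).
Proof.
move=> [h1 h2 h3 [K K0 h4]] [h1' h2' h3' [K' K0' h4']].
split; [exact: BL_add|exact: BL_add|by move=> i; exact: BL_add|].
exists (K + K'); rewrite ?addr_ge0 // => s s' z z' b b'.
have -> : taylor (fun s z => phi s z + psi s z) (fun s z => phis s z + psis s z)
   (fun i s z => phiz i s z + psiz i s z) s s' z z' =
   taylor phi phis phiz s s' z z' + taylor psi psis psiz s s' z z'.
  rewrite /taylor; under eq_bigr do rewrite mulrDl; rewrite big_split /=; ring.
apply: le_trans (cnormD _ _) _; rewrite mulrDl; exact: lerD (h4 _ _ _ _ b b') (h4' _ _ _ _ b b').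
Qed.
Lemma C2_mul phi phis phiz psi psis psiz : C2 phi phis phiz -> C2 psi psis psiz ->
  C2 (fun s z => phi s z * psi s z) (fun s z => phis s z * psi s z + phi s z * psis s z)
    (fun i s z => phiz i s z * psi s z + phi s z * psiz i s z).
Proof.
move=> [h1 h2 h3 [K K0 h4]] [h1' h2' h3' [K' K0' h4']].
split; [exact: BL_mul|by apply: BL_add; exact: BL_mul|by move=> i; apply: BL_add; exact: BL_mul|].
have [M [L [M0 L0 b1 b2]]] := h1; have [M' [L' [M0' L0' b1' b2']]] := h1'.
exists (K * M' + M * K' + L * L'); rewrite ?addr_ge0 ?mulr_ge0 // => s s' z z' b b'.
have -> : taylor (fun s z => phi s z * psi s z) (fun s z => phis s z * psi s z + phi s z * psis s z)
    (fun i s z => phiz i s z * psi s z + phi s z * psiz i s z) s s' z z' =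
   taylor phi phis phiz s s' z z' * psi s z + phi s z * taylor psi psis psiz s s' z z'
    + (phi s' z' - phi s z) * (psi s' z' - psi s z).
  rewrite /taylor; have -> : \sum_i (phiz i s z * psi s z + phi s z * psiz i s z) * (z' ord0 i - z ord0 i) =
     (\sum_i phiz i s z * (z' ord0 i - z ord0 i)) * psi s z + phi s z * \sum_i psiz i s z * (z' ord0 i - z ord0 i).
    by rewrite mulr_suml mulr_sumr -big_split; apply: eq_bigr => i _ /=; ring.
  ring.
apply: le_trans (cnormD _ _) _; rewrite [leRHS]mulrDl; apply: lerD.
  apply: le_trans (cnormD _ _) _; rewrite !cnormM [leRHS]mulrDl; apply: lerD.
    by rewrite mulrAC ler_pM ?cnorm_ge0 // ?h4 // b1'.
  by rewrite -mulrA ler_pM ?cnorm_ge0 // ?h4' // b1.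
by rewrite cnormM expr2 mulrACA ler_pM ?cnorm_ge0 // pdistC ?b2 ?b2'.
Qed.
Lemma C2_sum (I : Type) (r : seq I) (phi phis : I -> R -> vec -> C) (phiz : I -> 'I_n -> R -> vec -> C) :
  (forall j : I, C2 (phi j) (phis j) (phiz j)) ->
  C2 (fun s z => \sum_(j <- r) phi j s z) (fun s z => \sum_(j <- r) phis j s z)
     (fun i s z => \sum_(j <- r) phiz j i s z).
Proof.
move=> h; elim: r => [|j r IH].
  by apply: (C2_eq (C2_cst 0)) => [s z|s z|i s z]; rewrite big_nil.
by apply: (C2_eq (C2_add (h j) IH)) => [s z|s z|i s z]; rewrite big_cons.
Qed.

Lemma C2_reverse phi phis phiz : C2 phi phis phiz ->
  C2 (fun s z => phi (1 - s) z) (fun s z => - phis (1 - s) z) (fun i s z => phiz i (1 - s) z).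
Proof.
have ib s z : inbox s z -> inbox (1 - s) z.
  by move=> [/andP[s0 s1] h]; split => //; apply/andP; split; lra.
have pd s s' z z' : pdist (1 - s) (1 - s') z z' = pdist s s' z z'.
  by rewrite /pdist; congr (_ + _); rewrite distrC; congr `|_|; ring.
have rb psi : BL psi -> BL (fun s z => psi (1 - s) z).
  move=> [M [L [M0 L0 h1 h2]]]; exists M, L; split => // [s z /ib|s s' z z' /ib b /ib b']; first exact: h1.
  by rewrite -pd; exact: h2.
move=> [h1 h2 h3 [K K0 h4]]; split; [exact: rb|by apply/BL_opp/rb|by move=> i; exact: rb|].
exists K => // s s' z z' /ib b /ib b'; rewrite -pd; apply: le_trans (h4 _ _ _ _ b b').
rewrite /taylor (_ : r2c (1 - s' - (1 - s)) = - r2c (s' - s)) ?mulrN ?mulNr //.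
by rewrite -r2cN; congr r2c; ring.
Qed.

End BoxCalculus.

(** * The polynomial family along a segment of parameters *)

Section FamilyCalculus.
Variables (R : realType) (n : nat) (B : R).
Local Notation C := (CC R).
Local Notation vec := ('rV[C]_n).

Lemma C2_monomial (m : mpoly.multinom n) :
  C2 B (fun _ z => peval (mpoly.mpolyX C m) z) (fun _ _ => 0) (fun i _ z => dpeval (mpoly.mpolyX C m) i z).
Proof.
pose P (g : mpoly.mpoly n C) := C2 B (fun _ z => peval g z) (fun _ _ => 0) (fun i _ z => dpeval g i z).
have PC c : P (mpoly.mpolyC n c).
  apply: (C2_eq (C2_cst n B c)) => [s z|s z|i s z] //; first by rewrite /peval mpoly.mevalC.
  by rewrite /dpeval mpoly.mderivC /peval mpoly.meval0.
have PX j : P (mpoly.mpolyX C (mpoly.mnm1 j)).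
  apply: (C2_eq (C2_coord B j)) => [s z|s z|i s z] //; first by rewrite /peval mpoly.mevalXU.
  rewrite /dpeval /peval mpoly.mderivX mpoly.mevalZ mpoly.mnm1E eq_sym.
  case: eqP => [->|_]; last by rewrite mul0r.
  rewrite mpoly.mevalX big1 ?mulr1 // => k _.
  by rewrite mpoly.mnmBE subnn expr0.
have PM g h : P g -> P h -> P (g * h).
  move=> hg hh; apply: (C2_eq (C2_mul hg hh)) => [s z|s z|i s z].
  - by rewrite /peval mpoly.mevalM.
  - by rewrite mul0r mulr0 addr0.
  - by rewrite /dpeval /peval mpoly.mderivM mpoly.mevalD !mpoly.mevalM.
have P1 : P 1 by have := PC 1; rewrite mpoly.mpolyC1.
have Pexp g k : P g -> P (g ^+ k).
  move=> hg; elim: k => [|k IH]; first exact: (eq_ind_r P P1 (expr0 g)).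
  exact: (eq_ind_r P (PM _ _ hg IH) (exprS g k)).
apply: (eq_ind_r P _ (mpoly.mpolyXE_id C m)).
by apply: (big_ind P P1 PM) => i _; apply: Pexp; exact: PX.
Qed.

Lemma pevalX (z : vec) m : peval (mpoly.mpolyX C m) z = mon z m.
Proof. by rewrite /peval mpoly.mevalX. Qed.

Lemma C2_poly_path (q : {poly C}) (t0 t1 : C) :
  exists phis, C2 B (fun s (_ : vec) => q.[t0 + r2c s * (t1 - t0)]) phis (fun _ _ _ => 0).
Proof.
elim/poly_ind: q => [|q c [phis IH]].
  by exists (fun _ _ => 0); apply: (C2_eq (C2_cst n B 0)) => // s z; rewrite horner0.
have hT : C2 B (fun s (_ : vec) => t0 + r2c s * (t1 - t0)) (fun _ _ => t1 - t0) (fun _ _ _ => 0).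
  by apply: (C2_eq (C2_add (C2_cst n B t0) (C2_mul (C2_time n B) (C2_cst n B (t1 - t0))))) => [s z|s z|i s z] //; ring.
eexists; apply: (C2_eq (C2_add (C2_mul IH hT) (C2_cst n B c))) => [s z|s z|i s z].
- by rewrite hornerMXaddC.
- by [].
- by ring.
Qed.

Lemma C2_family (sp : C -> mpoly.mpoly n C) (co : mpoly.multinom n -> {poly C}) Ms t0 t1 :
  uniq Ms -> (forall t, {subset mpoly.msupp (sp t) <= Ms}) ->
  (forall t m, mpoly.mcoeff m (sp t) = (co m).[t]) ->
  exists phis, C2 B (fun s z => peval (sp (t0 + r2c s * (t1 - t0))) z) phis
    (fun i s z => dpeval (sp (t0 + r2c s * (t1 - t0))) i z).
Proof.
move=> un sub hco; pose T s := t0 + r2c s * (t1 - t0).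
have [ps hps] := choice (fun m => C2_poly_path (co m) t0 t1).
have h := C2_sum Ms (fun m => C2_mul (hps m) (C2_monomial m)).
eexists; apply: (C2_eq h) => [s z|s z|i s z]; last first.
- rewrite (dpeval_sum _ _ un (sub _)); apply: eq_bigr => m _.
  by rewrite hco mul0r add0r.
- by [].
- by rewrite (pevalE _ un (sub _)); apply: eq_bigr => m _; rewrite hco pevalX.
Qed.

(** The gradient of the product is recorded in logarithmic form off the zero set, the form in which
    [no_critical] restricts it. *)
Lemma C2_product (k0 : nat) (p : 'I_k0 -> R -> vec -> C) ps dp : (forall k, C2 B (p k) (ps k) (dp k)) ->
  exists Fs Fz, C2 B (fun s z => \prod_k p k s z) Fs Fz /\
    forall i s z, (forall k, p k s z != 0) -> Fz i s z = (\prod_k p k s z) * \sum_k dp k i s z / p k s z.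
Proof.
move=> h; elim: (index_enum 'I_k0) => [|k r [Fs [Fz [IH1 IH2]]]].
  exists (fun _ _ => 0), (fun _ _ _ => 0); split.
    by apply: (C2_eq (C2_cst n B 1)) => // s z; rewrite big_nil.
  by move=> i s z _; rewrite !big_nil mulr0.
do 2 eexists; split.
  by apply: (C2_eq (C2_mul (h k) IH1)) => // s z; rewrite big_cons.
move=> i s z p0 /=; rewrite IH2 // !big_cons; have := p0 k.
by move=> pk; field.
Qed.

End FamilyCalculus.
(** * The lifting vector field and its flow *)

Section Field.
Variables (R : realType) (n : nat) (eps : R).
Local Notation C := (CC R).
Local Notation vec := ('rV[C]_n).
Variables (F Fs : R -> vec -> C) (G : 'I_n -> R -> vec -> C).

Definition fW s z : C := \sum_i G i s z * cconj (G i s z).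
Definition fsg s (z : vec) : C := \sum_i z ord0 i * G i s z.
Definition fN (_ : R) (z : vec) : C := \sum_i z ord0 i * cconj (z ord0 i).
Definition frho s z : C := r2c (eps ^+ 2) - fN s z.
(** The first two terms form the Gram determinant of z and conj(G), which vanishes when these are
    proportional. The last term is zero only at critical points or on the sphere, where
    transversality makes the determinant positive. *)
Definition fD2 s z : C := fW s z * fN s z - fsg s z * cconj (fsg s z) + fW s z * (frho s z * frho s z).
Definition fD s z : C := fW s z * fD2 s z.
(** The uncorrected lift - Fs conj(G) / fW has radial component - Re(fP) / fW; the second term of
    [fnum] cancels it on the sphere. *)
Definition fP s z : C := Fs s z * cconj (fsg s z).
Definition fnum i s (z : vec) : C := - Fs s z * cconj (G i s z) * fD2 s z
  + r2c (cre (fP s z)) * (fW s z * z ord0 i - fsg s z * cconj (G i s z)).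

(* The vector field lifting d/ds to the fibres of F: minus Fs times the dual of dF,
   corrected along the projection of z to ker dF so that it is tangent to the sphere. *)
Definition field s z : vec := \row_i (fnum i s z / fD s z).

Definition rW s z : R := \sum_i normsq (G i s z).
Definition rD2 s z : R := rW s z * N2 z - normsq (fsg s z) + rW s z * (eps ^+ 2 - N2 z) ^+ 2.

Lemma fWE s z : fW s z = r2c (rW s z).
Proof. by rewrite r2c_sum; apply: eq_bigr => i _; rewrite cmul_conj. Qed.
Lemma fNE s z : fN s z = r2c (N2 z).
Proof. by rewrite r2c_sum; apply: eq_bigr => i _; rewrite cmul_conj. Qed.
Lemma frhoE s z : frho s z = r2c (eps ^+ 2 - N2 z).
Proof. by rewrite /frho fNE r2cD r2cN. Qed.
Lemma fD2E s z : fD2 s z = r2c (rD2 s z).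
Proof. by rewrite /fD2 fWE fNE frhoE cmul_conj /rD2 !(r2cD, r2cN, r2cM, expr2). Qed.
Lemma fDE s z : fD s z = r2c (rW s z * rD2 s z).
Proof. by rewrite /fD fWE fD2E r2cM. Qed.
Lemma cre_fD s z : cre (fD s z) = rW s z * rD2 s z.
Proof. by rewrite fDE. Qed.

Lemma field_lifts s z : fD s z != 0 -> Fs s z + \sum_i G i s z * field s z ord0 i = 0.
Proof.
move=> D0; have -> : \sum_i G i s z * field s z ord0 i = (\sum_i G i s z * fnum i s z) / fD s z.
  by rewrite mulr_suml; apply: eq_bigr => i _; rewrite mxE mulrA.
have -> : \sum_i G i s z * fnum i s z = (- Fs s z * fD2 s z) * (\sum_i G i s z * cconj (G i s z))
   + r2c (cre (fP s z)) * (fW s z * (\sum_i z ord0 i * G i s z)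
       - fsg s z * (\sum_i G i s z * cconj (G i s z))).
  rewrite !mulr_sumr -sumrB mulr_sumr -big_split /=.
  by apply: eq_bigr => i _; rewrite /fnum; ring.
rewrite -/(fW s z) -/(fsg s z).
move: D0; rewrite /fD => D0; have [w0 d0] : fW s z != 0 /\ fD2 s z != 0.
  by apply/andP; rewrite -negb_or -mulf_eq0.
by field; rewrite w0 d0.
Qed.

(** The correction would cancel the radial component if the denominator were the bare Gram
    determinant. The added term leaves a remainder with the factor (eps^2 - |z|^2)^2, so the field
    is tangent to the sphere. *)
Lemma field_radial s z : 0 < rW s z * rD2 s z ->
  cre (\sum_i cconj (z ord0 i) * field s z ord0 i) =
  - (cre (fP s z) * (eps ^+ 2 - N2 z) ^+ 2 * rW s z / (rW s z * rD2 s z)).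
Proof.
move=> D0; have -> : \sum_i cconj (z ord0 i) * field s z ord0 i = (\sum_i cconj (z ord0 i) * fnum i s z) / fD s z.
  by rewrite mulr_suml; apply: eq_bigr => i _; rewrite mxE mulrA.
have e : cconj (fsg s z) = \sum_i cconj (z ord0 i) * cconj (G i s z).
  by rewrite cconj_sum; apply: eq_bigr => i _; rewrite cconjM.
have -> : \sum_i cconj (z ord0 i) * fnum i s z =
   (- Fs s z * fD2 s z) * (\sum_i cconj (z ord0 i) * cconj (G i s z))
   + r2c (cre (fP s z)) * (fW s z * (\sum_i z ord0 i * cconj (z ord0 i))
      - fsg s z * (\sum_i cconj (z ord0 i) * cconj (G i s z))).
  rewrite !mulr_sumr -sumrB mulr_sumr -big_split /=.
  by apply: eq_bigr => i _; rewrite /fnum; ring.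
rewrite -e -/(fN s z).
have -> : - Fs s z * fD2 s z * cconj (fsg s z) = - fP s z * fD2 s z by rewrite /fP; ring.
rewrite fDE fD2E fWE fNE cmul_conj -r2cV.
have -> : r2c (rW s z) * r2c (N2 z) - r2c (normsq (fsg s z)) = r2c (rW s z * N2 z - normsq (fsg s z)).
  by rewrite [RHS]r2cD [in RHS]r2cN [in RHS]r2cM.
rewrite -!r2cM creM [cim (r2c _)]/= mulr0 subr0 creD cre_r2c creM creN cre_r2c [cim (r2c _)]/= mulr0 subr0 cre_r2c.
have n0 : rW s z * rD2 s z != 0 by rewrite gt_eqF.
have e' : rW s z * N2 z - normsq (fsg s z) = rD2 s z - rW s z * (eps ^+ 2 - N2 z) ^+ 2 by rewrite /rD2; ring.
rewrite e'; move: n0; rewrite mulf_eq0 negb_or => /andP[n1 n2].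
by field; rewrite n1 n2.
Qed.

Lemma rW_ge0 s z : 0 <= rW s z.
Proof. by apply: sumr_ge0 => i _; exact: normsq_ge0. Qed.

(** The vector W z - sg conj(G) is W times the orthogonal projection of z to the kernel of G. Its
    length gives the Cauchy-Schwarz inequality together with its case of equality. *)
Lemma lagrange_identity s z : rW s z * (rW s z * N2 z - normsq (fsg s z)) =
  \sum_i normsq (fW s z * z ord0 i - fsg s z * cconj (G i s z)).
Proof.
apply: r2c_inj; rewrite r2c_sum; under eq_bigr => i _ do rewrite -cmul_conj.
have cW : cconj (fW s z) = fW s z by rewrite fWE cconj_r2c.
have e1 : cconj (fsg s z) = \sum_i cconj (z ord0 i) * cconj (G i s z).
  by rewrite cconj_sum; apply: eq_bigr => i _; rewrite cconjM.
transitivity (fW s z * fW s z * fN s z - fW s z * cconj (fsg s z) * fsg s z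
    - fsg s z * fW s z * cconj (fsg s z) + fsg s z * cconj (fsg s z) * fW s z).
  by rewrite r2cM r2cD r2cN r2cM -cmul_conj fWE fNE; ring.
transitivity (fW s z * fW s z * (\sum_i z ord0 i * cconj (z ord0 i))
    - fW s z * cconj (fsg s z) * (\sum_i z ord0 i * G i s z)
    - fsg s z * fW s z * (\sum_i cconj (z ord0 i) * cconj (G i s z))
    + fsg s z * cconj (fsg s z) * (\sum_i G i s z * cconj (G i s z))).
  by rewrite -e1.
move: (fW s z) (fsg s z) cW => w sg cW.
rewrite !mulr_sumr -!sumrB -big_split /=.
by apply: eq_bigr => i _; rewrite cconjD cconjN !cconjM cconjK cW; ring.
Qed.

Variable delta0 : R.
Hypothesis eps0 : 0 < eps.
Hypothesis Hnb : forall s z (lam : C), 0 <= s <= 1 -> N2 z <= eps ^+ 2 -> F s z != 0 ->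
  cnorm (F s z) <= delta0 -> (lam = 0 \/ N2 z = eps ^+ 2) ->
  ~ (forall i, G i s z = lam * cconj (z ord0 i)).

(** The case lam = 0 of [Hnb] gives W > 0. Inside the ball the added term is positive; on the sphere
    a vanishing Gram determinant would make G a multiple of conj(z), with lam = W / conj(sg). *)
Lemma denominator_gt0 s z : 0 <= s <= 1 -> N2 z <= eps ^+ 2 -> F s z != 0 ->
  cnorm (F s z) <= delta0 -> 0 < rW s z * rD2 s z.
Proof.
move=> hs hz F0 Fd.
have W0 : 0 < rW s z.
  rewrite lt_neqAle rW_ge0 andbT eq_sym; apply/negP => /eqP e.
  apply: (Hnb hs hz F0 Fd (lam := 0)); first by left.
  move=> i; rewrite mul0r; apply/eqP; rewrite -normsq_eq0.
  move/eqP: e; rewrite psumr_eq0 => [/allP/(_ i (mem_index_enum _))//|j _]; exact: normsq_ge0.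
have Qs := lagrange_identity s z.
have Q0 : 0 <= rW s z * N2 z - normsq (fsg s z).
  rewrite -(pmulr_rge0 _ W0) Qs; apply: sumr_ge0 => i _; exact: normsq_ge0.
apply: mulr_gt0 => //.
have [e|ne] := eqVneq (eps ^+ 2 - N2 z) 0; last first.
  by rewrite ltr_wpDl // mulr_gt0 // lt_neqAle sqr_ge0 andbT eq_sym sqrf_eq0.
rewrite /rD2 e expr0n mulr0 addr0 lt_neqAle Q0 andbT eq_sym; apply/negP => /eqP Qz.
have hN : N2 z = eps ^+ 2 by apply/esym/eqP; rewrite -subr_eq0 e.
have hi i : fW s z * z ord0 i = fsg s z * cconj (G i s z).
  apply/eqP; rewrite -subr_eq0 -normsq_eq0; move: Qs; rewrite Qz mulr0 => /esym/eqP.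
  by rewrite psumr_eq0 => [/allP/(_ i (mem_index_enum _))//|j _]; exact: normsq_ge0.
have WC0 : fW s z != 0 by rewrite fWE r2c_eq0 gt_eqF.
have sg0 : fsg s z != 0.
  apply/eqP => sz; have : 0 < N2 z by rewrite hN exprn_gt0.
  rewrite /N2 big1 ?ltxx // => i _; apply/eqP; rewrite normsq_eq0.
  by have /eqP := hi i; rewrite sz mul0r mulf_eq0 (negPf WC0).
apply: (Hnb hs hz F0 Fd (lam := fW s z / cconj (fsg s z))); first by right.
have csg0 : cconj (fsg s z) != 0 by rewrite -cnorm_eq0 cnorm_conj cnorm_eq0.
move=> i; have := congr1 (@cconj R) (hi i); rewrite !cconjM cconjK fWE cconj_r2c -fWE => e'.
by rewrite mulrAC e' mulrAC divff ?mul1r.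
Qed.

End Field.

Section FieldBL.
Variables (R : realType) (n : nat) (eps B : R).
Local Notation C := (CC R).
Local Notation vec := ('rV[C]_n).
Variables (F Fs : R -> vec -> C) (G : 'I_n -> R -> vec -> C).
Hypothesis HC : C2 B F Fs G.

Lemma BL_fW : BL B (fW G).
Proof. by have [_ _ h _] := HC; apply: BL_sum => i; apply: BL_mul => //; exact: BL_conj. Qed.
Lemma BL_fsg : BL B (fsg G).
Proof. by have [_ _ h _] := HC; apply: BL_sum => i; apply: BL_mul => //; exact: BL_coord. Qed.
Lemma BL_fN : BL B (@fN R n).
Proof. by apply: BL_sum => i; apply: BL_mul; [exact: BL_coord|apply: BL_conj; exact: BL_coord]. Qed.
Lemma BL_frho : BL B (@frho R n eps).
Proof. by apply: BL_sub; [exact: BL_cst|exact: BL_fN]. Qed.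
Lemma BL_fD2 : BL B (fD2 eps G).
Proof.
apply: BL_add; last by apply: BL_mul; [exact: BL_fW|apply: BL_mul; exact: BL_frho].
apply: BL_sub; first by apply: BL_mul; [exact: BL_fW|exact: BL_fN].
by apply: BL_mul; [exact: BL_fsg|apply: BL_conj; exact: BL_fsg].
Qed.
Lemma BL_fD : BL B (fD eps G).
Proof. by apply: BL_mul; [exact: BL_fW|exact: BL_fD2]. Qed.
Lemma BL_fP : BL B (fP Fs G).
Proof. by have [_ h _ _] := HC; apply: BL_mul => //; apply: BL_conj; exact: BL_fsg. Qed.
Lemma BL_fnum i : BL B (fnum eps Fs G i).
Proof.
have [_ hs hG _] := HC; apply: BL_add.
  apply: BL_mul; last exact: BL_fD2.
  by apply: BL_mul; [exact: BL_opp|apply: BL_conj].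
apply: BL_mul; first by apply: BL_re; exact: BL_fP.
apply: BL_sub; first by apply: BL_mul; [exact: BL_fW|exact: BL_coord].
by apply: BL_mul; [exact: BL_fsg|apply: BL_conj].
Qed.

Lemma BL_tends (U : set_system nat) (phi : R -> vec -> C) (s : nat -> R) (z : nat -> vec) s' z' :
  free_ultra U -> BL B phi -> (forall v, inbox B (s v) (z v)) -> inbox B s' z' ->
  rtends U s s' -> (forall i, tends U (fun v => z v ord0 i) (z' ord0 i)) ->
  tends U (fun v => phi (s v) (z v)) (phi s' z').
Proof.
move=> hU [M [L [_ L0 _ h]]] b b' ts tz.
have t0 : tends U (fun v => phi (s v) (z v) - phi s' z') 0.
  have tp : rtends U (fun v => L * pdist (s v) s' (z v) z') (L * (0 + 0)).
    apply: (rtendsM hU); first exact: rtends_cst.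
    apply: (rtendsD hU); last exact: tends_zn.
    have : tends U (fun v => r2c (s v) - r2c s') 0.
      by rewrite -(subrr (r2c s')); apply: tendsB ts (tends_cst hU _).
    move=> /(tends_cnorm hU); rewrite cnorm0; apply: tends_ext => //; apply: uT => // v /=.
    by rewrite -r2cN -r2cD cnorm_r2c.
  rewrite addr0 mulr0 in tp; apply: (tends_squeeze hU tp); apply: uT => // v /=; exact: h.
have := tendsD hU t0 (tends_cst hU (phi s' z')); rewrite add0r.
by apply: tends_ext => //; apply: uT => // v /=; rewrite subrK.
Qed.

End FieldBL.

Section Clamp.
Variables (R : realType) (n : nat) (b : R).
Hypothesis b0 : 0 <= b.
Local Notation C := (CC R).
Local Notation vec := ('rV[C]_n).

Definition clamp (a : R) : R := if a <= - b then - b else if a <= b then a else b.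
Lemma clamp_le a : `|clamp a| <= b.
Proof.
rewrite /clamp ler_norml; case: (leP a (- b)) => h1; last case: (leP a b) => h2;
  by apply/andP; split; move: b0; lra.
Qed.
Lemma clamp_id a : `|a| <= b -> clamp a = a.
Proof.
rewrite ler_norml => /andP[h1 h2]; rewrite /clamp h2; case: (leP a (- b)) => // h3.
by apply/eqP; rewrite eq_le h1 h3.
Qed.
Lemma clamp_lip a a' : `|clamp a - clamp a'| <= `|a - a'|.
Proof.
have := ler_norm (a - a'); have := ler_norm (a' - a); rewrite (distrC a' a) ler_norml.
move: (`|a - a'|) => x; rewrite /clamp => h1 h2.
case: (leP a (- b)) => h3; last case: (leP a b) => h4;
case: (leP a' (- b)) => h5; try case: (leP a' b) => h6;
  by apply/andP; split; move: b0; lra.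
Qed.
(** Clamping the real and the imaginary part separately costs a factor 2 in modulus, whence the box
    of size 2 (eps + 1) used for the flow. *)
Definition cclamp (x : C) : C := r2c (clamp (cre x)) + (Complex 0 1 : C) * r2c (clamp (cim x)).
Lemma cI_norm : cnorm (Complex 0 1 : C) = 1.
Proof. by rewrite /cnorm /normsq /= expr0n add0r expr1n sqrtr1. Qed.
Lemma cclamp_le x : cnorm (cclamp x) <= 2 * b.
Proof.
apply: le_trans (cnormD _ _) _; rewrite cnormM cI_norm mul1r !cnorm_r2c.
by have := clamp_le (cre x); have := clamp_le (cim x); lra.
Qed.
Lemma cclamp_id x : cnorm x <= b -> cclamp x = x.
Proof.
move=> h; rewrite /cclamp !clamp_id ?(le_trans (cre_le _)) ?(le_trans (cim_le _)) //.
by rewrite [RHS](complexE (x : R[i])).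
Qed.
Lemma cclamp_lip x y : cnorm (cclamp x - cclamp y) <= 2 * cnorm (x - y).
Proof.
have -> : cclamp x - cclamp y = r2c (clamp (cre x) - clamp (cre y)) + (Complex 0 1 : C) * r2c (clamp (cim x) - clamp (cim y)).
  by rewrite /cclamp !r2cD !r2cN; ring.
apply: le_trans (cnormD _ _) _; rewrite cnormM cI_norm mul1r !cnorm_r2c.
have := clamp_lip (cre x) (cre y); have := clamp_lip (cim x) (cim y).
have := cre_le (x - y); have := cim_le (x - y); rewrite creD creN cimD cimN; lra.
Qed.
Definition vclamp (z : vec) : vec := \row_i cclamp (z ord0 i).
Lemma vclamp_inbox s z : 0 <= s <= 1 -> inbox (2 * b) s (vclamp z).
Proof. by move=> h; split => // i; rewrite mxE; exact: cclamp_le. Qed.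
Lemma vclamp_id (z : vec) : (forall i, cnorm (z ord0 i) <= b) -> vclamp z = z.
Proof. by move=> h; apply/rowP => i; rewrite mxE cclamp_id. Qed.
Lemma vclamp_lip y z : zn (vclamp y - vclamp z) <= 2 * zn (y - z).
Proof.
rewrite /zn mulr_sumr; apply: ler_sum => i _; rewrite !mxE; exact: cclamp_lip.
Qed.

Lemma BL_extend (phi : 'I_n -> R -> vec -> C) : (forall i, BL (2 * b) (phi i)) ->
  exists M L, bounded_lipschitz (fun s y => \row_i phi i s (vclamp y)) M L.
Proof.
move=> h.
have h' i : exists ML : R * R, [/\ 0 <= ML.1, 0 <= ML.2,
  forall s z, inbox (2 * b) s z -> cnorm (phi i s z) <= ML.1 &
  forall s s' z z', inbox (2 * b) s z -> inbox (2 * b) s' z' ->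
    cnorm (phi i s z - phi i s' z') <= ML.2 * pdist s s' z z'].
  by have [M [L hML]] := h i; exists (M, L).
have [ML hML] := choice h'.
exists (\sum_i (ML i).1), (\sum_i (ML i).2 * 2); split.
- by apply: sumr_ge0 => i _; case: (hML i).
- by apply: sumr_ge0 => i _; rewrite mulr_ge0 //; case: (hML i).
- move=> s y hs; apply: ler_sum => i _; rewrite mxE; have [_ _ h1 _] := hML i.
  by apply: h1; exact: vclamp_inbox.
move=> s s' y y' hs hs'; rewrite mulr_suml; apply: ler_sum => i _; rewrite !mxE.
have [_ L0 _ h2] := hML i.
apply: le_trans (h2 _ _ _ _ (vclamp_inbox y hs) (vclamp_inbox y' hs')) _.
rewrite -mulrA; apply: ler_wpM2l => //; rewrite /pdist mulrDr.
by apply: lerD (vclamp_lip _ _); rewrite ler_peMl // ler1n.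
Qed.
End Clamp.

(** * Trajectories in the closed ball *)

Section MilnorFlow.
Variables (R : realType) (n : nat) (U : set_system nat).
Hypothesis hU : free_ultra U.
Local Notation C := (CC R).
Local Notation vec := ('rV[C]_n).
Variables (eps delta0 : R) (F Fs : R -> vec -> C) (G : 'I_n -> R -> vec -> C).
Local Notation B := (2 * (eps + 1)).
Hypothesis eps0 : 0 < eps.
Hypothesis HC : C2 B F Fs G.
Hypothesis Hnb : forall s z (lam : C), 0 <= s <= 1 -> N2 z <= eps ^+ 2 -> F s z != 0 ->
  cnorm (F s z) <= delta0 -> (lam = 0 \/ N2 z = eps ^+ 2) ->
  ~ (forall i, G i s z = lam * cconj (z ord0 i)).

Local Notation rD s z := (rW G s z * rD2 eps G s z).

Lemma eps1_ge0 : 0 <= eps + 1. Proof. by rewrite addr_ge0 // ltW. Qed.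

Lemma inbox_eps1 s (z : vec) : 0 <= s <= 1 -> (forall i, cnorm (z ord0 i) <= eps + 1) -> inbox B s z.
Proof.
move=> hs h; split => // i; apply: le_trans (h i) _.
by rewrite ler_peMl ?eps1_ge0 // ler1n.
Qed.

Lemma ball_eps1 (z : vec) : N2 z <= eps ^+ 2 -> forall i, cnorm (z ord0 i) <= eps + 1.
Proof.
by move=> h i; apply: le_trans (cnorm_le_N2 i (ltW eps0) h) _; rewrite lerDl.
Qed.

(** A compactness argument: along a sequence of counterexamples the limit point would have a
    nonpositive denominator. The factor 2 lets the denominator fall to [c] during a short time. *)
Lemma uniform_denominator eta1 : 0 < eta1 -> exists2 c, 0 < c &
  forall s z, 0 <= s <= 1 -> N2 z <= eps ^+ 2 -> eta1 <= cnorm (F s z) -> cnorm (F s z) <= delta0 ->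
    2 * c <= rD s z.
Proof.
move=> eta0; apply: contrapT => hneg.
have bad v : exists x : R * vec, [/\ 0 <= x.1 <= 1, N2 x.2 <= eps ^+ 2, eta1 <= cnorm (F x.1 x.2),
    cnorm (F x.1 x.2) <= delta0 & rD x.1 x.2 < 2 * v.+1%:R^-1].
  apply: contrapT => hv; apply: hneg; exists v.+1%:R^-1; first by rewrite invr_gt0 ltr0n.
  move=> s z h1 h2 h3 h4; rewrite leNgt; apply/negP => h5; apply: hv; by exists (s, z).
have [x hx] := choice bad.
pose s v := (x v).1; pose z v := (x v).2.
have s01 v : 0 <= s v <= 1 by case: (hx v).
have zb v i : cnorm (z v ord0 i) <= eps + 1 by apply: ball_eps1; case: (hx v).
have [s' ts] : exists s', rtends U s s'.
  apply: (@real_limit _ _ hU _ 1); apply: uT => // v /=; have /andP[h1 h2] := s01 v.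
  by rewrite ger0_norm.
have [zl tz] := @bounded_limit_vec _ _ hU _ (fun v i => z v ord0 i) (eps + 1) (uT hU zb).
pose z' : vec := \row_i zl i.
have tz' i : tends U (fun v => z v ord0 i) (z' ord0 i) by rewrite mxE.
have s'01 : 0 <= s' <= 1.
  by apply/andP; split; [apply: (rtends_ge hU ts)|apply: (rtends_le hU ts)]; apply: uT => // v; have /andP[] := s01 v.
have z'b i : cnorm (z' ord0 i) <= eps + 1 by apply: (tends_cnorm_le hU (tz' i)); apply: uT => // v /=; exact: zb.
have ib v := inbox_eps1 (s01 v) (zb v); have ib' := inbox_eps1 s'01 z'b.
have [HF _ _ _] := HC.
have tF := BL_tends hU HF ib ib' ts tz'.
have tN := BL_tends hU (BL_fN n B) ib ib' ts tz'.
have tD := BL_tends hU (BL_fD eps HC) ib ib' ts tz'.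
have N2' : N2 z' <= eps ^+ 2.
  apply: (@tends_le _ _ hU (fun v => N2 (z v))); last by apply: uT => // v; case: (hx v).
  by move: tN; rewrite fNE; apply: tends_ext => //; apply: uT => // v /=; rewrite fNE.
have F1 : eta1 <= cnorm (F s' z').
  by apply: (tends_ge hU (tends_cnorm hU tF)); apply: uT => // v; case: (hx v).
have F2 : cnorm (F s' z') <= delta0.
  by apply: (tends_le hU (tends_cnorm hU tF)); apply: uT => // v; case: (hx v).
have F0 : F s' z' != 0 by rewrite -cnorm_gt0; apply: lt_le_trans F1.
have := denominator_gt0 eps0 Hnb s'01 N2' F0 F2; rewrite ltNge => /negP; apply.
have tR : rtends U (fun v => rD (s v) (z v) + (-2) * v.+1%:R^-1) (rD s' z' + (-2) * 0).
  apply: (rtendsD hU); last by apply: (rtendsM hU); [exact: rtends_cst|exact: rtends_inv_nat].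
  by move: tD; rewrite fDE; apply: tends_ext => //; apply: uT => // v /=; rewrite fDE.
rewrite mulr0 addr0 in tR; apply: (rtends_le hU tR); apply: uT => // v /=.
by rewrite mulNr subr_le0; apply/ltW; case: (hx v).
Qed.

(** Bounded and Lipschitz everywhere, so solutions exist up to time 1 before it is known that they
    remain in the ball; it equals [field] where the denominator is at least [c] and the coordinates
    are at most eps + 1. *)
Definition cutoff (c : R) (s : R) (y : vec) : vec :=
  \row_i (fnum eps Fs G i s (vclamp (eps + 1) y) *
    r2c (Num.max (cre (fD eps G s (vclamp (eps + 1) y))) c)^-1).

Lemma cutoff_bounded_lipschitz c : 0 < c -> exists M L, bounded_lipschitz (cutoff c) M L.
Proof.
move=> c0; apply: (BL_extend eps1_ge0 (phi := fun i s z => fnum eps Fs G i s z *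
   r2c (Num.max (cre (fD eps G s z)) c)^-1)) => i.
by apply: BL_mul; [exact: BL_fnum HC i|apply: BL_trunc_inv => //; exact: BL_fD HC].
Qed.

Lemma cutoff_field c s (z : vec) : 0 < c -> (forall i, cnorm (z ord0 i) <= eps + 1) -> c <= rD s z ->
  cutoff c s z = field eps Fs G s z.
Proof.
move=> c0 hz hD; apply/rowP => i; rewrite !mxE (vclamp_id hz) cre_fD max_l //.
by rewrite fDE r2cV.
Qed.

(** By [field_lifts] the first order terms of the expansion of F cancel; the Taylor remainder and
    the error of the step are quadratic in h. *)
Lemma F_increment A K : 0 <= A -> 0 <= K -> exists2 C1, 0 <= C1 & forall u h y y',
  inbox B u y -> inbox B (u + h) y' -> fD eps G u y != 0 -> 0 <= h ->
  zn (y' - y - r2c h *: field eps Fs G u y) <= K * h ^+ 2 -> zn (y' - y) <= A * h ->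
  cnorm (F (u + h) y' - F u y) <= C1 * h ^+ 2.
Proof.
move=> A0 K0; have [_ _ hG [Kt Kt0 hT]] := HC.
have hG' i : exists M, 0 <= M /\ forall s z, inbox B s z -> cnorm (G i s z) <= M.
  by have [M [L [M0 _ h _]]] := hG i; exists M.
have [MG hMG] := choice hG'.
have MG0 : 0 <= \sum_i MG i by apply: sumr_ge0 => i _; case: (hMG i).
exists (Kt * (1 + A) ^+ 2 + (\sum_i MG i) * K); first by apply: addr_ge0; apply: mulr_ge0 => //; exact: sqr_ge0.
move=> u h y y' b b' D0 h0 hE hA.
set er := y' - y - _ in hE.
have kE i : y' ord0 i - y ord0 i = r2c h * field eps Fs G u y ord0 i + er ord0 i.
  by rewrite /er !mxE; ring.
have -> : F (u + h) y' - F u y = taylor F Fs G u (u + h) y y' + \sum_i G i u y * er ord0 i.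
  rewrite /taylor; under eq_bigr do rewrite kE mulrDr mulrCA.
  rewrite big_split /= -mulr_sumr.
  have /eqP := field_lifts Fs D0; rewrite addr_eq0 => /eqP->.
  by rewrite (_ : u + h - u = h); [ring|rewrite addrAC subrr add0r].
apply: le_trans (cnormD _ _) _; rewrite mulrDl; apply: lerD.
  apply: le_trans (hT _ _ _ _ b b') _; rewrite -mulrA; apply: ler_wpM2l => //.
  rewrite -exprMn ler_pXn2r ?nnegrE ?pdist_ge0 ?mulr_ge0 ?addr_ge0 // /pdist zn_distC mulrDl mul1r.
  apply: lerD => //; rewrite opprD addrA subrr add0r normrN ger0_norm //.
apply: le_trans (cnorm_sum _ _ _) _; rewrite -mulrA mulr_suml; apply: ler_sum => i _.
rewrite cnormM; apply: ler_pM; rewrite ?cnorm_ge0 //; first by case: (hMG i) => _; apply.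
exact: le_trans (cnorm_le_zn _ _) hE.
Qed.

Lemma N2_add (y k : vec) : N2 (y + k) = N2 y + 2 * cre (\sum_i cconj (y ord0 i) * k ord0 i) + N2 k.
Proof.
rewrite cre_sum mulr_sumr /N2 -!big_split /=; apply: eq_bigr => i _; rewrite mxE.
rewrite /normsq -!/(cre _) -!/(cim _) creD cimD creM cre_conj cim_conj; ring.
Qed.

Lemma N2_le_zn (z : vec) : N2 z <= zn z ^+ 2.
Proof.
rewrite expr2 {1}/zn mulr_suml; apply: ler_sum => i _; rewrite -cnorm_sqr expr2.
by apply: ler_wpM2l; [exact: cnorm_ge0|exact: cnorm_le_zn].
Qed.

(** One factor of (eps^2 - |z|^2)^2 in the radial component is bounded, the other kept: the first
    order growth of |z|^2 - eps^2 is then proportional to its own size, as a Gronwall argument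
    requires. *)
Lemma N2_increment c A K : 0 < c -> 0 <= A -> 0 <= K -> exists C1 C2, [/\ 0 <= C1, 0 <= C2 & forall u h y y',
  inbox B u y -> c <= rD u y -> 0 <= h ->
  zn (y' - y - r2c h *: field eps Fs G u y) <= K * h ^+ 2 -> zn (y' - y) <= A * h ->
  N2 y' - eps ^+ 2 <= (N2 y - eps ^+ 2) + h * (C1 * `|eps ^+ 2 - N2 y|) + C2 * h ^+ 2].
Proof.
move=> c0 A0 K0.
have [MP [_ [MP0 _ hP _]]] := BL_fP HC.
have [MW [_ [MW0 _ hW _]]] := BL_fW HC.
have [Mr [_ [Mr0 _ hr _]]] := BL_frho n eps B.
exists (2 * (MP * Mr * MW / c)), (2 * (`|B| * K) + A ^+ 2).
split; first by rewrite !mulr_ge0 // invr_ge0 ltW.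
  by rewrite addr_ge0 ?sqr_ge0 // !mulr_ge0.
move=> u h y y' b hD h0 hE hA.
set er := y' - y - _ in hE.
have -> : y' = y + (y' - y) by rewrite addrC subrK.
set k := y' - y in hA *.
have kE i : k ord0 i = r2c h * field eps Fs G u y ord0 i + er ord0 i.
  by rewrite /er /k !mxE; ring.
rewrite N2_add.
have -> : \sum_i cconj (y ord0 i) * k ord0 i = r2c h * (\sum_i cconj (y ord0 i) * field eps Fs G u y ord0 i)
    + \sum_i cconj (y ord0 i) * er ord0 i.
  by rewrite mulr_sumr -big_split; apply: eq_bigr => i _ /=; rewrite kE; ring.
have D0 : 0 < rD u y by apply: lt_le_trans c0 hD.
rewrite creD creM [cim (r2c h)]/= mul0r subr0 cre_r2c (field_radial Fs D0).
have e1 : cre (\sum_i cconj (y ord0 i) * er ord0 i) <= `|B| * K * h ^+ 2.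
  apply: le_trans (ler_norm _) _; apply: le_trans (cre_le _) _.
  apply: le_trans (cnorm_sum _ _ _) _; rewrite -mulrA.
  apply: le_trans (ler_wpM2l (normr_ge0 B) hE); rewrite /zn mulr_sumr; apply: ler_sum => i _.
  rewrite cnormM cnorm_conj; apply: ler_wpM2r; first exact: cnorm_ge0.
  by case: b => _ /(_ i) hb; apply: le_trans hb (ler_norm _).
have e2 : N2 k <= A ^+ 2 * h ^+ 2.
  apply: le_trans (N2_le_zn k) _; rewrite -exprMn ler_pXn2r ?nnegrE ?zn_ge0 ?mulr_ge0 //.
have e3 : - (cre (fP Fs G u y) * (eps ^+ 2 - N2 y) ^+ 2 * rW G u y / rD u y)
   <= MP * Mr * MW / c * `|eps ^+ 2 - N2 y|.
  apply: le_trans (ler_norm _) _; rewrite normrN !normrM.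
  have q1 : `|cre (fP Fs G u y)| <= MP := le_trans (cre_le _) (hP _ _ b).
  have q2 : `|eps ^+ 2 - N2 y| <= Mr by have := hr _ _ b; rewrite frhoE cnorm_r2c.
  have q3 : `|rW G u y| <= MW by have := hW _ _ b; rewrite fWE cnorm_r2c.
  have q4 : `|(rD u y)^-1| <= c^-1.
    by rewrite gtr0_norm ?invr_gt0 // lef_pV2 ?posrE.
  have -> : MP * Mr * MW / c * `|eps ^+ 2 - N2 y| = MP * (Mr * `|eps ^+ 2 - N2 y|) * MW / c by ring.
  apply: ler_pM; [by rewrite !mulr_ge0|by []| |exact: q4].
  apply: ler_pM; [by rewrite !mulr_ge0|by []| |exact: q3].
  apply: ler_pM; [by []|by rewrite !mulr_ge0|exact: q1|].
  by apply: ler_wpM2r.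
have e4 := ler_wpM2l h0 e3.
move: e1 e2 e4; move: (cre (\sum_i _)) (N2 k) (- (_ / _)) (`|eps ^+ 2 - N2 y|) (MP * Mr * MW / c) => p q r t m e1 e2 e4.
have -> : h * (2 * m * t) = 2 * (h * (m * t)) by ring.
have -> : (2 * (`|B| * K) + A ^+ 2) * h ^+ 2 = 2 * (`|B| * K * h ^+ 2) + A ^+ 2 * h ^+ 2 by ring.
move: (`|B| * K * h ^+ 2) (A ^+ 2 * h ^+ 2) (h * r) (h * (m * t)) (N2 y) (eps ^+ 2) e1 e2 e4 => b1 b2 b3 b4 b5 b6.
lra.
Qed.

Definition good (eta : C) (s : R) (z : vec) : Prop := N2 z <= eps ^+ 2 /\ F s z = eta.

(** A bootstrap. Starting in the ball and on the level eta, for a time r independent of the starting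
    point the cutoff cannot act, so the estimates for [field] hold and Gronwall returns the curve to
    the ball and the level. *)
Lemma short_time eta1 c M L K : 0 < c ->
  (forall s z, 0 <= s <= 1 -> N2 z <= eps ^+ 2 -> eta1 <= cnorm (F s z) -> cnorm (F s z) <= delta0 ->
    2 * c <= rD s z) ->
  bounded_lipschitz (cutoff c) M L -> 0 <= K ->
  exists2 r, 0 < r & forall y eta, solves (cutoff c) y K -> eta1 <= cnorm eta -> cnorm eta <= delta0 ->
    forall s0 s, 0 <= s0 -> good eta s0 (y s0) -> s0 <= s -> s <= s0 + r -> s <= 1 -> good eta s (y s).
Proof.
move=> c0 hc HV K0; have [M0 L0 _ _] := HV.
have [_ [LD [_ LD0 _ hLD]]] := BL_fD eps HC.
pose A := M + K; have A0 : 0 <= A by rewrite addr_ge0.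
have [C1 C10 hF] := F_increment A0 K0.
have [C3 [C4 [C30 C40 hN]]] := N2_increment c0 A0 K0.
have A1 : 0 < 1 + A by rewrite ltr_wpDr.
have cL : 0 < c + LD by rewrite ltr_wpDr.
(* With speed at most [A], the bound A r <= 1 keeps the coordinates below eps + 1, and LD (1 + A) r
   <= c keeps the denominator, at least 2c initially, above c. *)
pose r := c / ((c + LD) * (1 + A)).
have r0 : 0 < r by rewrite divr_gt0 // mulr_gt0.
have rA : A * r <= 1.
  rewrite /r mulrA ler_pdivrMr ?mulr_gt0 // mul1r mulrC.
  apply: ler_pM => //; first exact: ltW. 
    by rewrite lerDl.
  by rewrite lerDr.
have rL : LD * ((1 + A) * r) <= c.
  have -> : LD * ((1 + A) * r) = c * (LD / (c + LD)).
    by rewrite /r; field; rewrite !gt_eqF.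
  by rewrite ler_piMr ?(ltW c0) // ler_pdivrMr // mul1r lerDr ltW.
exists r => // y eta hy e1 e2 s0 s s00 [g1 g2] s0s sr s1.
have s0b : 0 <= s0 <= 1 by rewrite s00 (le_trans s0s).
have lip u h : 0 <= u -> 0 <= h -> u + h <= 1 -> zn (y (u + h) - y u) <= A * h.
  exact: (solution_lipschitz HV K0 hy).
have near u : s0 <= u -> u <= s -> [/\ 0 <= u <= 1, forall i, cnorm (y u ord0 i) <= eps + 1 & c <= rD u (y u)].
  move=> u0 us; have u01 : 0 <= u <= 1 by rewrite (le_trans s00 u0) (le_trans us).
  have d1 : zn (y u - y s0) <= A * (u - s0).
    have := lip s0 (u - s0) s00; rewrite subr_ge0 addrC subrK => /(_ u0); apply.
    by case/andP: u01.
  have ur : u - s0 <= r by rewrite lerBlDl; apply: le_trans us sr.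
  have d2 : zn (y u - y s0) <= A * r by apply: le_trans d1 _; apply: ler_wpM2l.
  have zb i : cnorm (y u ord0 i) <= eps + 1.
    have := cnormD (y u ord0 i - y s0 ord0 i) (y s0 ord0 i); rewrite subrK.
    have := cnorm_le_zn (y u - y s0) i; rewrite !mxE.
    have := cnorm_le_N2 i (ltW eps0) g1.
    move: rA d2; move: (A * r) (zn _) (cnorm _) (cnorm _) (cnorm _) => q1 q2 q3 q4 q5; lra.
  split => //.
  have := hc s0 (y s0) s0b g1; rewrite g2 => /(_ e1 e2) h1.
  have := hLD _ _ _ _ (inbox_eps1 s0b (ball_eps1 g1)) (inbox_eps1 u01 zb).
  move=> h2; have := le_trans (cre_le _) h2; rewrite creD creN !cre_fD.
  have h3 : LD * pdist s0 u (y s0) (y u) <= c.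
    apply: le_trans rL; apply: ler_wpM2l => //; rewrite mulrDl mul1r /pdist zn_distC.
    by apply: lerD => //; rewrite distrC ger0_norm // subr_ge0.
  move=> /le_trans/(_ h3); rewrite ler_norml => /andP[_].
  move: h1; move: (rD s0 (y s0)) (rD u (y u)) => q1 q2; lra.
have incr u h : s0 <= u -> 0 <= h -> u + h <= s ->
   zn (y (u + h) - y u - r2c h *: field eps Fs G u (y u)) <= K * h ^+ 2.
  move=> u0 h0 uh; have us : u <= s by apply: le_trans uh; rewrite lerDl.
  have [b1 b2 b3] := near u u0 us; rewrite -(cutoff_field c0 b2 b3).
  by apply: hy => //; [exact: le_trans s00 u0|exact: le_trans uh s1].
have s01 : s - s0 <= 1 by rewrite lerBlDr (le_trans s1) // lerDl.
have lip' u h : s0 <= u -> 0 <= h -> u + h <= s -> zn (y (u + h) - y u) <= A * h.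
  by move=> u0 h0 uh; apply: lip => //; [exact: le_trans s00 u0|exact: le_trans uh s1].
have inb u : s0 <= u -> u <= s -> inbox B u (y u).
  by move=> h1 h2; have [b1 b2 _] := near u h1 h2; apply: inbox_eps1.
have uhs u h : 0 <= h -> u + h <= s -> u <= s by move=> h0; apply: le_trans; rewrite lerDl.
split; last first.
  apply/eqP; rewrite -subr_eq0 -cnorm_eq0 eq_le cnorm_ge0 andbT.
  (* Growth rate 0: the distance of F to eta starts at 0 and each step adds at most C1 h^2. *)
  have := @discrete_gronwall _ _ hU (fun u => cnorm (F u (y u) - eta)) 0 C1 1 s0 s (lexx _) C10 ltr01 s0s s01.
  rewrite g2 subrr cnorm0 mulr0; apply=> // u h u0 h0 _ uh.
  have us := uhs _ _ h0 uh; have u0' : s0 <= u + h by apply: le_trans u0 _; rewrite lerDl.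
  have [_ _ b3] := near u u0 us.
  have D0 : fD eps G u (y u) != 0 by rewrite fDE r2c_eq0 gt_eqF // (lt_le_trans c0).
  have := hF u h _ _ (inb u u0 us) (inb _ u0' uh) D0 h0 (incr u h u0 h0 uh) (lip' u h u0 h0 uh).
  rewrite mul0r addr0 mul1r => h1.
  have := cnormD (F (u + h) (y (u + h)) - F u (y u)) (F u (y u) - eta).
  rewrite addrA subrK => /le_trans; apply; rewrite addrC; exact: lerD.
have h00 : 0 < (C3 + 1)^-1 by rewrite invr_gt0 ltr_wpDl.
(* Gronwall for the excess of |y|^2 over eps^2, initially 0. Steps h <= 1 / (C3 + 1) give h C3 <= 1,
   so from inside the ball the first order term cannot push the curve across the sphere. *)
have := @discrete_gronwall _ _ hU (fun u => Num.max 0 (N2 (y u) - eps ^+ 2)) C3 C4 (C3 + 1)^-1 s0 s C30 C40 h00 s0s s01.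
have -> : Num.max 0 (N2 (y s0) - eps ^+ 2) = 0 by apply/max_l; rewrite subr_le0.
rewrite mulr0 lexx => /(_ isT) => hg.
have : Num.max 0 (N2 (y s) - eps ^+ 2) <= 0; last by rewrite ge_max subr_le0 => /andP[].
apply: hg => u h u0 h0 hh uh.
have us := uhs _ _ h0 uh; have [_ _ b3] := near u u0 us.
have := hN u h _ _ (inb u u0 us) b3 h0 (incr u h u0 h0 uh) (lip' u h u0 h0 uh).
have C4h : 0 <= C4 * h ^+ 2 by rewrite mulr_ge0 ?sqr_ge0.
have hC3 : h * C3 <= 1.
  have C31 : 0 < C3 + 1 by rewrite ltr_wpDl.
  have := ler_wpM2r (ltW C31) hh; rewrite mulVf ?gt_eqF // mulrDr mulr1; lra.
rewrite mulrDl mul1r ge_max; move: C4h; move: (C4 * h ^+ 2) (N2 _ - _) => q1 q2 q10.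
have [p|p] := leP 0 (N2 (y u) - eps ^+ 2).
  have -> : `|eps ^+ 2 - N2 (y u)| = N2 (y u) - eps ^+ 2 by rewrite distrC ger0_norm.
  move=> h1; apply/andP; split.
    by rewrite addr_ge0 // addr_ge0 // !mulr_ge0.
  by apply: le_trans h1 _; rewrite !lerD2r // -mulrA [h * _]mulrCA.
have -> : `|eps ^+ 2 - N2 (y u)| = - (N2 (y u) - eps ^+ 2) by rewrite distrC ltr0_norm.
move: p; move: (N2 (y u) - eps ^+ 2) => x x0 h1; apply/andP; split; first by rewrite mulr0 !addr0 add0r.
rewrite mulr0 !add0r; apply: le_trans h1 _; rewrite gerDr.
have -> : x + h * (C3 * - x) = x * (1 - h * C3) by ring.
by apply: mulr_le0_ge0; [exact: ltW|rewrite subr_ge0].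
Qed.

Lemma stays_good eta1 c M L K y eta : 0 < c ->
  (forall s z, 0 <= s <= 1 -> N2 z <= eps ^+ 2 -> eta1 <= cnorm (F s z) -> cnorm (F s z) <= delta0 ->
    2 * c <= rD s z) ->
  bounded_lipschitz (cutoff c) M L -> 0 <= K ->
  solves (cutoff c) y K -> eta1 <= cnorm eta -> cnorm eta <= delta0 -> good eta 0 (y 0) ->
  forall s, 0 <= s <= 1 -> good eta s (y s).
Proof.
move=> c0 hc HV K0 hy e1 e2 g0.
have [r r0 step] := short_time c0 hc HV K0.
have main j : forall s, 0 <= s <= 1 -> s <= j%:R * r -> good eta s (y s).
  elim: j => [s /andP[s0 s1]|j IH s /andP[s0 s1] sj].
    rewrite mul0r => s0'; by have -> : s = 0 by apply/eqP; rewrite eq_le s0 s0'.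
  have [sr|sr] := leP s r.
    by apply: (step y eta hy e1 e2 0 s) => //; rewrite add0r.
  have p1 : 0 <= s - r by rewrite subr_ge0 ltW.
  have p2 : s - r <= s by rewrite lerBlDr lerDl ltW.
  apply: (step y eta hy e1 e2 (s - r) s) => //; last by rewrite subrK.
  apply: IH; first by rewrite p1 (le_trans p2).
  by rewrite lerBlDr; move: sj; rewrite -natr1 mulrDl mul1r.
move=> s /andP[s0 s1]; apply: (main (Num.truncn r^-1).+1); first by rewrite s0.
apply: le_trans s1 _; rewrite -ler_pdivrMr // mul1r; exact/ltW/truncnS_gt.
Qed.

(** A relation, because the cutoff producing the curve depends on the level of z. The curve is
    required to solve [field] itself, so the relation does not mention that cutoff. *)
Definition flow (z z' : vec) : Prop := exists y K, [/\ 0 <= K, y 0 = z, y 1 = z',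
  forall s, 0 <= s <= 1 -> good (F 0 z) s (y s) & solves (field eps Fs G) y K].

Lemma flow_exists z : N2 z <= eps ^+ 2 -> F 0 z != 0 -> cnorm (F 0 z) <= delta0 -> exists z', flow z z'.
Proof.
move=> hz F0 Fd; have e0 : 0 < cnorm (F 0 z) by rewrite cnorm_gt0.
have [c c0 hc] := uniform_denominator e0.
have [M [L HV]] := cutoff_bounded_lipschitz c0; have [M0 L0 _ _] := HV.
have [y [y0 hy]] := solution_exists hU HV z.
have K0 : 0 <= L * (1 + M) by rewrite mulr_ge0 // addr_ge0.
have sg : forall s, 0 <= s <= 1 -> good (F 0 z) s (y s).
  by apply: (stays_good c0 hc HV K0 hy) => //; rewrite y0.
exists (y 1), y, (L * (1 + M)); split; [exact: K0|exact: y0|reflexivity|exact: sg|move=> s h s0 h0 sh].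
have s01 : 0 <= s <= 1 by rewrite s0 (le_trans _ sh) // lerDl.
have [g1 g2] := sg s s01; rewrite -(cutoff_field c0 (ball_eps1 g1)); first exact: hy.
have := hc s (y s) s01 g1; rewrite g2 lexx => /(_ isT Fd); lra.
Qed.

Lemma flow_cutoff eta1 c z z' : 0 < c ->
  (forall s z, 0 <= s <= 1 -> N2 z <= eps ^+ 2 -> eta1 <= cnorm (F s z) -> cnorm (F s z) <= delta0 ->
    2 * c <= rD s z) ->
  eta1 <= cnorm (F 0 z) -> cnorm (F 0 z) <= delta0 -> flow z z' ->
  exists y K, [/\ 0 <= K, y 0 = z, y 1 = z' & forall s, 0 <= s <= 1 -> good (F 0 z) s (y s)] /\
     [/\ solves (field eps Fs G) y K, solves (cutoff c) y K &
     forall s, 0 <= s <= 1 -> cutoff c s (y s) = field eps Fs G s (y s)].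
Proof.
move=> c0 hc e1 e2 [y [K [K0 y0 y1 sg hy]]].
have eqf s : 0 <= s <= 1 -> cutoff c s (y s) = field eps Fs G s (y s).
  move=> s01; have [g1 g2] := sg s s01; apply: cutoff_field => //; first exact: ball_eps1.
  have := hc s (y s) s01 g1; rewrite g2 => /(_ e1 e2); lra.
exists y, K; split; first by split.
split; [exact: hy|move=> s h s0 h0 sh|exact: eqf].
rewrite eqf; first exact: hy.
by rewrite s0 (le_trans _ sh) // lerDl.
Qed.

(** All levels of modulus at least [eta1] share one cutoff, so trajectories in different fibres can
    be compared. The constant depends on [eta1], which suffices for local estimates off the zero
    set. *)
Lemma flow_lipschitz eta1 : 0 < eta1 -> exists2 L, 0 <= L & forall z1 z2 z1' z2',
  eta1 <= cnorm (F 0 z1) -> cnorm (F 0 z1) <= delta0 -> eta1 <= cnorm (F 0 z2) -> cnorm (F 0 z2) <= delta0 ->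
  flow z1 z1' -> flow z2 z2' -> zn (z1' - z2') <= L * zn (z1 - z2).
Proof.
move=> e0; have [c c0 hc] := uniform_denominator e0.
have [M [L HV]] := cutoff_bounded_lipschitz c0.
exists (expR L); first exact: expR_ge0.
move=> z1 z2 z1' z2' a1 a2 a3 a4 /(flow_cutoff c0 hc a1 a2)[y1 [K1 [[K10 <- <- _] [_ h1 _]]]].
move=> /(flow_cutoff c0 hc a3 a4)[y2 [K2 [[K20 <- <- _] [_ h2 _]]]].
by apply: (solutions_contract hU HV K10 K20 h1 h2); rewrite ler01 lexx.
Qed.

Lemma flow_unique z z1 z2 : F 0 z != 0 -> cnorm (F 0 z) <= delta0 -> flow z z1 -> flow z z2 -> z1 = z2.
Proof.
move=> F0 Fd h1 h2; have e0 : 0 < cnorm (F 0 z) by rewrite cnorm_gt0.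
have [L L0 h] := flow_lipschitz e0.
have := h z z z1 z2 (lexx _) Fd (lexx _) Fd h1 h2; rewrite subrr zn0 mulr0 => hz.
apply/eqP; rewrite -subr_eq0; apply/eqP/zn_eq0/eqP; by rewrite eq_le hz zn_ge0.
Qed.

Lemma flow_end z z' : flow z z' -> N2 z' <= eps ^+ 2 /\ F 1 z' = F 0 z.
Proof.
move=> [y [K [_ _ <- sg _]]]; apply: sg; by rewrite ler01 lexx.
Qed.

End MilnorFlow.

Section Reversal.
Variables (R : realType) (n : nat) (U : set_system nat).
Hypothesis hU : free_ultra U.
Local Notation C := (CC R).
Local Notation vec := ('rV[C]_n).
Variables (eps delta0 : R) (F Fs : R -> vec -> C) (G : 'I_n -> R -> vec -> C).
Local Notation B := (2 * (eps + 1)).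
Hypothesis eps0 : 0 < eps.
Hypothesis HC : C2 B F Fs G.
Hypothesis Hnb : forall s z (lam : C), 0 <= s <= 1 -> N2 z <= eps ^+ 2 -> F s z != 0 ->
  cnorm (F s z) <= delta0 -> (lam = 0 \/ N2 z = eps ^+ 2) ->
  ~ (forall i, G i s z = lam * cconj (z ord0 i)).

Local Notation rF := (fun s z => F (1 - s) z).
Local Notation rFs := (fun s z => - Fs (1 - s) z).
Local Notation rG := (fun i s z => G i (1 - s) z).

Lemma field_reverse s z : field eps rFs rG s z = - field eps Fs G (1 - s) z.
Proof.
apply/rowP => i; rewrite 3!mxE.
have -> : fnum eps rFs rG i s z = - fnum eps Fs G i (1 - s) z.
  have eP : fP rFs rG s z = - fP Fs G (1 - s) z by rewrite /fP mulNr.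
  rewrite /fnum eP creN r2cN -[fD2 eps rG s z]/(fD2 eps G (1 - s) z).
  rewrite -[fsg rG s z]/(fsg G (1 - s) z) -[fW rG s z]/(fW G (1 - s) z); ring.
by rewrite mulNr.
Qed.

(** The reversed curve needs the field at the other end of each step. By the Lipschitz bounds on
    field and curve the discrepancy is at most L (1 + M + K) h^2, again a second order error. *)
Lemma flow_reverse z z' : F 0 z != 0 -> cnorm (F 0 z) <= delta0 ->
  flow eps F Fs G z z' -> flow eps rF rFs rG z' z.
Proof.
move=> F0 Fd hf; have [_ Fe] := flow_end hf.
have e0 : 0 < cnorm (F 0 z) by rewrite cnorm_gt0.
have [c c0 hc] := uniform_denominator hU eps0 HC Hnb e0.
have [M [L HV]] := cutoff_bounded_lipschitz eps0 HC c0; have [M0 L0 _ hL] := HV.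
have [y [K [[K0 y0 y1 sg] [hy hy' eqf]]]] := flow_cutoff eps0 c0 hc (lexx _) Fd hf.
have rev01 (s : R) : 0 <= s <= 1 -> 0 <= 1 - s <= 1.
  by move=> /andP[s0 s1]; apply/andP; split; lra.
exists (fun s => y (1 - s)), (K + L * (1 + (M + K))); split.
- by rewrite !addr_ge0 // mulr_ge0 // addr_ge0 // addr_ge0.
- by rewrite subr0.
- by rewrite subrr.
- move=> s s01; have [g1 g2] := sg _ (rev01 s s01); split => //.
  by rewrite g2 subr0 Fe.
move=> s h s0 h0 sh.
pose u := 1 - (s + h).
have u0 : 0 <= u by rewrite subr_ge0.
have uh : u + h = 1 - s by rewrite /u opprD addrA subrK.
have uh1 : u + h <= 1 by rewrite uh lerBlDr lerDl.
have u01 : 0 <= u <= 1 by rewrite u0 (le_trans _ uh1) // lerDl.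
have uh01 : 0 <= u + h <= 1 by rewrite addr_ge0.
rewrite field_reverse -/u -uh.
have -> : y u - y (u + h) - r2c h *: - field eps Fs G (u + h) (y (u + h)) =
  - (y (u + h) - y u - r2c h *: field eps Fs G u (y u)) +
  r2c h *: (field eps Fs G (u + h) (y (u + h)) - field eps Fs G u (y u)).
  by apply/rowP => i; rewrite !mxE; ring.
apply: le_trans (znD _ _) _; rewrite znN mulrDl; apply: lerD; first exact: hy.
rewrite znZ (ger0_norm h0) -!eqf //.
have := hL _ _ (y (u + h)) (y u) uh01 u01.
rewrite [u + h - u]addrAC subrr add0r (ger0_norm h0) => h1.
have h2 := solution_lipschitz HV K0 hy' u0 h0 uh1.
apply: le_trans (ler_wpM2l h0 h1) _.
have -> : L * (1 + (M + K)) * h ^+ 2 = h * (L * (h + (M + K) * h)) by ring.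
by do 2 apply: ler_wpM2l => //; rewrite lerD2l.
Qed.

End Reversal.
(** * Isomorphism of the Milnor fibrations *)

Section Topology.
Variables (R : realType) (n : nat).
Local Notation C := (CC R).
Local Notation vec := ('rV[C]_n).

Lemma nbhs_complexP (x : C) (A : set C) : nbhs x A <-> exists2 e : R, 0 < e & forall y, cnorm (y - x) < e -> A y.
Proof.
rewrite nbhs_ballP; split=> [[e /= e0 h]|[e e0 h]].
  have eE : e = r2c (cre e).
    by case: e e0 {h} => a b; rewrite ltcE /= => /andP[/eqP-> _].
  exists (cre e); first by rewrite -(ltr_r2c 0) -eE.
  by move=> y hy; apply: h; rewrite /ball /= distrC cnormE eE ltr_r2c.
exists (r2c e); first by rewrite /= -(ltr_r2c 0) in e0 *.
by move=> y; rewrite /ball /= distrC cnormE ltr_r2c; exact: h.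
Qed.

Lemma common_radius (e : 'I_n -> R) : (forall i, 0 < e i) -> exists2 r, 0 < r & forall i, r <= e i.
Proof.
move=> h; have s0 : 0 < 1 + \sum_i (e i)^-1.
  by rewrite ltr_pwDl // sumr_ge0 // => i _; rewrite invr_ge0 ltW.
exists (1 + \sum_i (e i)^-1)^-1; first by rewrite invr_gt0.
move=> i; rewrite -[leRHS]invrK lef_pV2 ?posrE ?invr_gt0 // (bigD1 i) //= addrCA lerDl.
by rewrite addr_ge0 // sumr_ge0 // => j _; rewrite invr_ge0 ltW.
Qed.

Lemma within_continuous_lipschitz (E : set vec) (f : vec -> vec) :
  (forall z0, E z0 -> exists L r, [/\ 0 <= L, 0 < r & forall z, E z -> zn (z - z0) < r ->
     zn (f z - f z0) <= L * zn (z - z0)]) -> {within E, continuous f}.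
Proof.
move=> h; apply/subspace_continuousP => z0 Ez0 W [P hP sPW].
have [L [r [L0 r0 hL]]] := h z0 Ez0.
have he j : exists e : R, 0 < e /\ forall y, cnorm (y - f z0 ord0 j) < e -> P ord0 j y.
  by have /nbhs_complexP[e e0 he] := hP ord0 j; exists e.
have [e he'] := choice he.
have [d d0 hd] := common_radius (fun j => (he' j).1).
have L1 : 0 < L + 1 by rewrite ltr_wpDl.
have n1 : 0 < n.+1%:R :> R by rewrite ltr0n.
(* Neighbourhoods of a vector are given entrywise whereas [zn] is a sum, hence radius rho / (n + 1)
   per entry; n + 1 also covers n = 0. *)
pose rho := Num.min r (d / (L + 1)).
have rho0 : 0 < rho by rewrite lt_min r0 divr_gt0.
exists (fun i j => [set y | cnorm (y - z0 i j) < rho / n.+1%:R]).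
  by move=> i j; apply/nbhs_complexP; exists (rho / n.+1%:R) => //; rewrite divr_gt0.
move=> z /= hz Ez; apply: sPW => i j; rewrite (ord1 i); apply: (he' j).2.
have hzn : zn (z - z0) < rho.
  apply: (@le_lt_trans _ _ (\sum_(i < n) rho / n.+1%:R)).
    by apply: ler_sum => k _; rewrite !mxE; exact: ltW (hz ord0 k).
  rewrite sumr_const card_ord -[_ *+ n]mulr_natr mulrAC ltr_pdivrMr // ltr_pM2l // ltr_nat.
  exact: ltnSn.
have h1 : zn (z - z0) < r by apply: lt_le_trans hzn _; rewrite ge_min lexx.
have h2 : zn (z - z0) < d / (L + 1) by apply: lt_le_trans hzn _; rewrite ge_min lexx orbT.
apply: lt_le_trans (hd j); have h3 := cnorm_le_zn (f z - f z0) j; rewrite !mxE in h3.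
apply: le_lt_trans h3 _; apply: le_lt_trans (hL z Ez h1) _.
apply: (@le_lt_trans _ _ ((L + 1) * zn (z - z0))); first by rewrite ler_wpM2r ?zn_ge0 // lerDl.
by rewrite mulrC -ltr_pdivlMr.
Qed.

End Topology.

Section FibrationIso.
Variables (R : realType) (n : nat) (U : set_system nat).
Hypothesis hU : free_ultra U.
Local Notation C := (CC R).
Local Notation vec := ('rV[C]_n).

Definition no_tangency (eps delta0 : R) (F : R -> vec -> C) (G : 'I_n -> R -> vec -> C) : Prop :=
  forall s z (lam : C), 0 <= s <= 1 -> N2 z <= eps ^+ 2 -> F s z != 0 ->
  cnorm (F s z) <= delta0 -> (lam = 0 \/ N2 z = eps ^+ 2) ->
  ~ (forall i, G i s z = lam * cconj (z ord0 i)).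

Lemma no_tangency_reverse eps delta0 F G : no_tangency eps delta0 F G ->
  no_tangency eps delta0 (fun s z => F (1 - s) z) (fun i s z => G i (1 - s) z).
Proof.
move=> h s z lam /andP[s0 s1]; apply: h; apply/andP; split; lra.
Qed.

Lemma flow_map_continuous eps delta0 delta (F Fs : R -> vec -> C) G (h : vec -> C) (Phi : vec -> vec) :
  0 < eps -> delta <= delta0 -> C2 (2 * (eps + 1)) F Fs G -> no_tangency eps delta0 F G ->
  (forall z, F 0 z = h z) ->
  (forall z, milnor_total h eps delta z -> flow eps F Fs G z (Phi z)) ->
  {within milnor_total h eps delta, continuous Phi}.
Proof.
move=> e0 dd HC Hnb hF hPhi; apply: within_continuous_lipschitz => z0 Ez0.
have [N0 [p0 d0]] := Ez0; rewrite -hF in p0 d0.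
(* Near z0 the modulus of F stays above half its value, so one Lipschitz constant serves a whole
   neighbourhood. *)
have p2 : 0 < cnorm (F 0 z0) / 2 by rewrite divr_gt0.
have [L L0 hL] := flow_lipschitz hU e0 HC Hnb p2.
have [[_ [LF [_ LF0 _ hLF]]] _ _ _] := HC.
have LF1 : 0 < LF + 1 by rewrite ltr_wpDl.
exists L, (cnorm (F 0 z0) / 2 / (LF + 1)); split => //; first by rewrite divr_gt0.
move=> z Ez hz; have [N1 [p1 d1]] := Ez; rewrite -hF in p1 d1.
have b01 : 0 <= (0 : R) <= 1 by rewrite lexx ler01.
have ib (z' : vec) : N2 z' <= eps ^+ 2 -> inbox (2 * (eps + 1)) 0 z'.
  by move=> hz'; apply: (inbox_eps1 e0 b01); apply: ball_eps1.
have lb : cnorm (F 0 z0) / 2 <= cnorm (F 0 z).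
  have h1 := hLF _ _ _ _ (ib z0 N0) (ib z N1).
  rewrite /pdist subrr normr0 add0r zn_distC in h1.
  have h2 : LF * zn (z - z0) <= cnorm (F 0 z0) / 2.
    move: hz; rewrite ltr_pdivlMr // => /ltW; apply: le_trans.
    by rewrite mulrC ler_wpM2l ?zn_ge0 // lerDl.
  have h3 := cnormD (F 0 z0 - F 0 z) (F 0 z); rewrite subrK in h3.
  move: h1 h2 h3; move: (cnorm _) (cnorm _) (cnorm _) (LF * _) => a b c d; lra.
apply: hL; [ | exact: le_trans (ltW d1) dd | | exact: le_trans (ltW d0) dd| exact: hPhi|exact: hPhi] => //.
by rewrite ler_pdivrMr // ler_peMr ?cnorm_ge0 // ler1n.
Qed.

(** Both maps are time-one flows, one of the family and one of its reversal. Their composites are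
    identities because a reversed trajectory is a trajectory of the reversed family and such
    trajectories are unique. *)
Theorem fibration_iso_of_flow eps delta0 delta (F Fs : R -> vec -> C) G (h1 h2 : vec -> C) :
  0 < eps -> delta <= delta0 -> C2 (2 * (eps + 1)) F Fs G -> no_tangency eps delta0 F G ->
  (forall z, F 0 z = h1 z) -> (forall z, F 1 z = h2 z) -> fibration_iso h1 h2 eps delta.
Proof.
move=> e0 dd HC Hnb hF1 hF2.
pose rF s z := F (1 - s) z; pose rFs s z := - Fs (1 - s) z; pose rG i s z := G i (1 - s) z.
have HC' : C2 (2 * (eps + 1)) rF rFs rG := C2_reverse HC.
have Hnb' : no_tangency eps delta0 rF rG := no_tangency_reverse Hnb.
have hF1' z : rF 0 z = h2 z by rewrite /rF subr0.
have hF2' z : rF 1 z = h1 z by rewrite /rF subrr.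
have nz (h : vec -> C) z : milnor_total h eps delta z -> h z != 0 /\ cnorm (h z) <= delta0.
  by move=> [_ [p d]]; rewrite -cnorm_gt0 p; split => //; apply: le_trans (ltW d) dd.
have [Phi hPhi] : exists Phi : vec -> vec, forall z, milnor_total h1 eps delta z -> flow eps F Fs G z (Phi z).
  have h z : exists z', milnor_total h1 eps delta z -> flow eps F Fs G z z'.
    have [Ez|nE] := pselect (milnor_total h1 eps delta z); last by exists z.
    have [n1 n2] := nz _ _ Ez; have [N0 _] := Ez; rewrite -hF1 in n1 n2.
    by have [z' hz'] := flow_exists hU e0 HC Hnb N0 n1 n2; exists z'.
  by have [Phi hPhi] := choice h; exists Phi.
have [Psi hPsi] : exists Psi : vec -> vec, forall z, milnor_total h2 eps delta z -> flow eps rF rFs rG z (Psi z).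
  have h z : exists z', milnor_total h2 eps delta z -> flow eps rF rFs rG z z'.
    have [Ez|nE] := pselect (milnor_total h2 eps delta z); last by exists z.
    have [n1 n2] := nz _ _ Ez; have [N0 _] := Ez; rewrite -hF1' in n1 n2.
    by have [z' hz'] := flow_exists hU e0 HC' Hnb' N0 n1 n2; exists z'.
  by have [Psi hPsi] := choice h; exists Psi.
have E12 z : milnor_total h1 eps delta z -> milnor_total h2 eps delta (Phi z) /\ h2 (Phi z) = h1 z.
  move=> Ez; have [a b] := flow_end (hPhi z Ez); rewrite hF1 hF2 in b; split => //.
  by case: Ez => _ hh; split => //; rewrite b.
have E21 z : milnor_total h2 eps delta z -> milnor_total h1 eps delta (Psi z) /\ h1 (Psi z) = h2 z.
  move=> Ez; have [a b] := flow_end (hPsi z Ez); rewrite hF1' hF2' in b; split => //.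
  by case: Ez => _ hh; split => //; rewrite b.
exists Phi, Psi; split; first by move=> z /E12[].
split; first by move=> z /E21[].
split.
  move=> z Ez; have [n1 n2] := nz _ _ Ez; have [Ez' _] := E12 z Ez; have [n3 n4] := nz _ _ Ez'.
  rewrite -hF1 in n1 n2; rewrite -hF1' in n3 n4.
  have r1 := flow_reverse hU e0 HC Hnb n1 n2 (hPhi z Ez).
  exact: (flow_unique hU e0 HC' Hnb' n3 n4 (hPsi _ Ez') r1).
split.
  move=> z Ez; have [n1 n2] := nz _ _ Ez; have [Ez' _] := E21 z Ez; have [n3 n4] := nz _ _ Ez'.
  rewrite -hF1' in n1 n2; rewrite -hF1 in n3 n4.
  have r1 := flow_reverse hU e0 HC' Hnb' n1 n2 (hPsi z Ez).
  have eF : (fun s z => rF (1 - s) z) = F.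
    by apply/funext => s; apply/funext => x; rewrite /rF opprB addrC subrK.
  have eFs : (fun s z => - rFs (1 - s) z) = Fs.
    by apply/funext => s; apply/funext => x; rewrite /rFs opprK opprB addrC subrK.
  have eG : (fun i s z => rG i (1 - s) z) = G.
    by apply/funext => i; apply/funext => s; apply/funext => x; rewrite /rG opprB addrC subrK.
  rewrite eF eFs eG in r1.
  exact: (flow_unique hU e0 HC Hnb n3 n4 (hPhi _ Ez') r1).
split; first exact: (flow_map_continuous e0 dd HC Hnb hF1 hPhi).
split; first exact: (flow_map_continuous e0 dd HC' Hnb' hF1' hPsi).
by move=> z /E12[].
Qed.

End FibrationIso.

(** * Assembly for an admissible family *)

Section FamilyIso.
Variables (R : realType) (n k0 : nat).
Local Notation C := (CC R).
Local Notation mnm := (mpoly.multinom n).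
Variables (sp : 'I_k0 -> C -> mpoly.mpoly n C) (co : 'I_k0 -> mnm -> {poly C}).
Variables (tau Rad : R) (Ms : seq mnm).
Hypothesis tau0 : 0 < tau.
Hypothesis Rad0 : 0 < Rad.
Hypothesis Ms0 : mpoly.mnm0 \in Ms.
Hypothesis Ms1 : forall i, mpoly.mnm1 i \in Ms.
Hypothesis Msu : uniq Ms.
Hypothesis Hsub : forall k t0, {subset mpoly.msupp (sp k t0) <= Ms}.
Hypothesis Hco : forall k t m, mpoly.mcoeff m (sp k t) = (co k m).[t].
Hypothesis Hadm : forall t : C, cnorm t < tau ->
    (forall k, newton_boundary (sp k t) = newton_boundary (sp k 0)) /\
    (forall S : {set 'I_k0}, S != finset.set0 ->
       nondegenerate_ci S (fun k => sp k t) /\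
       exists Rad', Rad < Rad' /\
                    radius_local_tameness S (fun k => sp k t) Rad').

Lemma tends_horner (U : set_system nat) (q : {poly C}) t t' : free_ultra U ->
  tends U t t' -> tends U (fun v => q.[t v]) q.[t'].
Proof.
move=> hU h; rewrite horner_coef.
have : tends U (fun v => \sum_(i < size q) q`_i * t v ^+ i) (\sum_(i < size q) q`_i * t' ^+ i).
  apply: tends_sum => // i _; apply: tendsM => //; [exact: tends_cst|exact: tendsX].
by apply: tends_ext => //; apply: uT => // v /=; rewrite horner_coef.
Qed.

Theorem admissible_family_iso t : cnorm t <= tau / 2 ->
  milnor_fibrations_iso (fun z => \prod_k peval (sp k t) z) (fun z => \prod_k peval (sp k 0) z).
Proof.
move=> htau; have [U hU] := free_ultra_exists.
have Hcont k m (s : nat -> C) s' : tends U s s' ->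
    tends U (fun v => mpoly.mcoeff m (sp k (s v))) (mpoly.mcoeff m (sp k s')).
  move=> hs; have := tends_horner (co k m) hU hs; rewrite -Hco.
  by apply: tends_ext => //; apply: uT => // v /=; rewrite Hco.
have [eps1 e10 hmil] := milnor_radius hU tau0 Ms0 Ms1 Msu Hsub Hcont Hadm.
(* As eps0 <= 1, its square is at most eps0 <= Rad / 2, below the radius of tameness; eps1 excludes
   tangencies with the strata. *)
pose eps0 := Num.min eps1 (Num.min 1 (Rad / 2)).
have eps00 : 0 < eps0 by rewrite !lt_min e10 ltr01 divr_gt0.
have le1 : eps0 <= eps1 by rewrite ge_min lexx.
have le2 : eps0 <= 1 by rewrite !ge_min lexx !orbT.
have le3 : eps0 <= Rad / 2 by rewrite !ge_min lexx !orbT.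
have eRad : eps0 ^+ 2 < Rad.
  apply: (@le_lt_trans _ _ (Rad / 2)); last by move: Rad0; lra.
  by apply: le_trans le3; rewrite expr2 ler_piMr // ltW.
have hmil' s (z : 'rV[C]_n) S c mu : cnorm s <= tau / 2 -> z != 0 -> N2 z <= eps0 ^+ 2 ->
    tangent sp s z S c mu -> forall k, k \in S -> c k = 0.
  move=> h1 h2 h3; apply: hmil => //; apply: le_trans h3 _.
  by rewrite ler_pXn2r ?nnegrE ?(ltW eps00) ?(ltW e10).
exists eps0; split => // eps e0 ee.
have [delta0 d0 hcrit] := no_critical hU tau0 Ms0 Ms1 Msu Hsub Hcont Hadm eRad hmil' e0 ee.
exists delta0; split => // delta dp dd.
pose T (s : R) := t + r2c s * (0 - t).
have hT s : 0 <= s <= 1 -> cnorm (T s) <= tau / 2.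
  move=> /andP[s0 s1]; have -> : T s = r2c (1 - s) * t by rewrite /T r2cD r2cN; ring.
  rewrite cnormM cnorm_r2c ger0_norm ?subr_ge0 //; apply: le_trans htau.
  by rewrite ler_piMl ?cnorm_ge0 // lerBlDr lerDl.
have hfam k := @C2_family R n (2 * (eps + 1)) (sp k) (co k) Ms t 0 Msu (@Hsub k) (Hco k).
have [ps hps] := choice hfam.
have [Fs [G [HC HG]]] := C2_product hps.
apply: (fibration_iso_of_flow hU e0 dd HC).
- move=> s z lam s01 hz F0 Fd hl hG.
  have p0 k : peval (sp k (T s)) z != 0.
    by move/prodf_neq0 : F0 => /(_ k isT).
  (* The gradient of the product is the product times the logarithmic gradient, so the multiplier is
     divided by the product. *)
  apply: (hcrit (T s) z (lam / \prod_k peval (sp k (T s)) z) (hT s s01) hz p0 Fd).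
    by case: hl => [->|]; [left; rewrite mul0r|right].
  move=> i; have := HG i s z p0; rewrite hG -cmul_conj.
  have F0' : \prod_k peval (sp k (T s)) z != 0 by exact: F0.
  move: F0'; rewrite -/(T s).
  move: (z ord0 i) (cconj _) (\sum_k _) (\prod_k _) => x w S P P0 e.
  have -> : S = lam * w / P by rewrite e mulrAC divff // mul1r.
  by ring.
- by move=> z; rewrite r2c0 mul0r addr0.
- by move=> z; rewrite r2c1 mul1r addrC subrK.
Qed.

End FamilyIso.
Lemma mcoeff_spec (R : realType) (n : nat) (t : CC R) (F : mpoly.mpoly n {poly CC R}) m :
  mpoly.mcoeff m (spec t F) = (mpoly.mcoeff m F).[t].
Proof. exact: (mpoly.mcoeff_map_mpoly (horner_eval t) m F). Qed.

Lemma msupp_spec (R : realType) (n : nat) (t : CC R) (F : mpoly.mpoly n {poly CC R}) :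
  {subset mpoly.msupp (spec t F) <= mpoly.msupp F}.
Proof.
move=> m; rewrite !mpoly.mcoeff_msupp mcoeff_spec; apply: contraNN => /eqP->.
by rewrite horner0.
Qed.

Theorem theorem5p3 (R : realType) (n k0 : nat)
  (f : 'I_k0 -> mpoly.mpoly n {poly CC R}) :
  (0 < k0)%N ->
  (forall k, nonconstant (f k)) ->
  (forall k (t : CC R), peval (spec t (f k)) 0 = 0) ->
  newton_admissible f ->
  exists tau : R, 0 < tau /\
    forall t : CC R, cnorm t < tau ->
      milnor_fibrations_iso (f_at f t) (f_at f 0).
Proof.
move=> _ _ _ [Rad [Rad0 [tau [tau0 Hadm]]]].
exists (tau / 2); split; first by rewrite divr_gt0.
move=> t /ltW ht.
(* Besides all supports the list contains 0 and the unit exponents, through which coordinates are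
   compared with 1 and with one another. *)
pose Ms := undup (mpoly.mnm0 :: [seq mpoly.mnm1 i | i <- enum 'I_n] ++
  flatten [seq mpoly.msupp (f k) | k <- enum 'I_k0] : seq (mpoly.multinom n)).
have Ms0 : mpoly.mnm0 \in Ms by rewrite mem_undup mem_head.
have Ms1 i : mpoly.mnm1 i \in Ms.
  by rewrite mem_undup in_cons mem_cat map_f ?orbT ?mem_enum.
have Msu : uniq Ms := undup_uniq _.
have Hsub k t0 : {subset mpoly.msupp (spec t0 (f k)) <= Ms}.
  move=> m /msupp_spec ms; rewrite mem_undup in_cons mem_cat.
  apply/orP; right; apply/orP; right; apply/flatten_mapP; exists k => //.
  by rewrite mem_enum.
exact: (@admissible_family_iso R n k0 (fun k t => spec t (f k)) (fun k m => mpoly.mcoeff m (f k))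
  tau Rad Ms tau0 Rad0 Ms0 Ms1 Msu Hsub (fun k t m => mcoeff_spec t (f k) m) Hadm t ht).
Qed.
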